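(* Consider the Córdoba–Córdoba–Fontelos model $$\partial_t\omega-2\,u\,\partial_x\omega=2\,\omega\,\partial_xu,\qquad u=-\Lambda^{-1}\omega\qquad(x\in\mathbb{R}).$$ There exist constants $\alpha_0>0$ and $C_0>0$ and, for every $\alpha\in\{1/n:n\in\mathbb{N},\,n\ge1\}$ with $\alpha<\alpha_0$, a number $\lambda(\alpha)>-1$ and a solution $\omega^\alpha(x,t)$ of this model such that: the initial datum $\omega^\alpha(\cdot,0)$ belongs to $L^{\frac{1+\lambda(\alpha)}{\alpha},\infty}(\mathbb{R})\cap C^\alpha(\mathbb{R})$; $\lambda(\alpha)\le C_0\alpha$ as $\alpha\to0$; and $\omega^\alpha$ blows up at $t=1$ in a neighborhood of $x=0$. Moreover, the associated velocity field $u^\alpha=-\Lambda^{-1}\omega^\alpha$ remains uniformly bounded in the space $C^{1-\frac{\alpha}{1+\lambda(\alpha)}}([-1,1])$ up to the time of blow-up, i.e. $\sup_{t\in[0,1)}\|u^\alpha(\cdot,t)\|_{C^{1-\alpha/(1+\lambda(\alpha))}([-1,1])}<\infty$, and $\frac12<1-\frac{\alpha}{1+\lambda(\alpha)}$ for $\alpha$ sufficiently small.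
   Context: The Hilbert transform is $Hf(x)=\frac1\pi\,\mathrm{p.v.}\int_{\mathbb{R}}\frac{f(y)}{x-y}\,dy$, and $\Lambda^{-1}f(x)=\int_0^xHf(y)\,dy$; thus $\partial_xu=-H\omega$ and $u(0,t)=0$. The model is the case $a=-2$ of $\partial_t\omega+a\,u\,\partial_x\omega=2\omega\,\partial_xu$, $u=-\Lambda^{-1}\omega$. For $0<q<\infty$, $L^{q,\infty}(\mathbb{R})$ (weak $L^q$) is the set of measurable $f$ with $\sup_{s>0}s\,|\{x:|f(x)|>s\}|^{1/q}<\infty$. Blow-up at $t=1$ in a neighborhood of $x=0$ means that $\omega^\alpha$ is a solution for $0\le t<1$ and that its sup-norm on neighborhoods of $x=0$ becomes unbounded as $t\to1^-$. *)

(* Defs.v *)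
From HB Require Import structures.
From mathcomp Require Import all_boot all_order all_algebra.
From mathcomp Require Import all_classical all_reals all_analysis.

Set Implicit Arguments.
Unset Strict Implicit.
Unset Printing Implicit Defensive.

Import Order.TTheory GRing.Theory Num.Theory.
Import numFieldNormedType.Exports.

Local Open Scope classical_set_scope.
Local Open Scope ring_scope.

Section HilbertTransform.
Context {R : realType}.
Implicit Types (f : R -> R) (x eps : R).

Definition hilbert_truncated f x eps : R :=
  pi^-1 * \int[lebesgue_measure]_(y in [set y | eps < `|x - y|]) (f y / (x - y)).

(* [Rintegral] and [lim] are total; this is the condition under which
   [hilbert f x] is the actual principal value. *)
Definition hilbert_defined f x : Prop :=
  (forall eps, 0 < eps ->
    lebesgue_measure.-integrable [set y | eps < `|x - y|]
      (fun y => (f y / (x - y))%:E)) /\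
  cvg (hilbert_truncated f x eps @[eps --> 0^'+]).

Definition hilbert f x : R := lim (hilbert_truncated f x eps @[eps --> 0^'+]).

Definition Lambda_inv f x : R :=
  if 0 <= x then \int[lebesgue_measure]_(y in `[0, x]) hilbert f y
  else - \int[lebesgue_measure]_(y in `[x, 0]) hilbert f y.

End HilbertTransform.

Section FunctionSpaces.
Context {R : realType}.
Implicit Types (f : R -> R) (A : set R).

Definition weak_Lp (q : R) f : Prop :=
  measurable_fun setT f /\
  (ereal_sup [set s%:E * (lebesgue_measure [set x | (s < `|f x|)%R]) `^ q^-1
             | s in [set s : R | (0 < s)%R]] < +oo)%E.

Definition sup_norm A f : \bar R := ereal_sup [set `|f x|%:E | x in A].

Definition holder_seminorm A (b : R) f : \bar R :=
  ereal_sup [set (`|f p.1 - f p.2| / `|p.1 - p.2| `^ b)%:E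
            | p in [set p : R * R | [/\ A p.1, A p.2 & p.1 != p.2]]].

Definition holder_norm A (b : R) f : \bar R :=
  (sup_norm A f + holder_seminorm A b f)%E.

Definition test_function (phi : R -> R) : Prop :=
  [/\ forall x, derivable phi x 1,
      continuous (derive1 phi) &
      exists r, forall x, r < `|x| -> phi x = 0].

End FunctionSpaces.

Section Model.
Context {R : realType}.

Definition velocity (w : R -> R -> R) (x t : R) : R := - Lambda_inv (w ^~ t) x.

(* A vorticity that is merely Hoelder continuous in x need not have a
   derivative in x at every point, so the transport equation is required in
   the sense of distributions, u d_x w being tested against phi as
   - \int w d_x (u phi), and in addition pointwise at almost every x. *)
Record CCF_solution (T : R) (w : R -> R -> R) : Prop := {
  CCF_continuous :
    {within [set p : R * R | 0 <= p.2 < T], continuous (fun p => w p.1 p.2)} ;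
  CCF_hilbert_defined :
    forall x t, 0 <= t < T -> hilbert_defined (w ^~ t) x ;
  CCF_hilbert_locally_integrable :
    forall t, 0 <= t < T -> locally_integrable setT (hilbert (w ^~ t)) ;
  CCF_weak :
    forall phi, test_function phi -> forall t, 0 < t < T ->
      is_derive t 1 (fun s => \int[lebesgue_measure]_x (w x s * phi x))
        (2 * - (\int[lebesgue_measure]_x
                  (w x t * derive1 (fun y => velocity w y t * phi y) x)) +
         2 * \int[lebesgue_measure]_x
               (w x t * derive1 (velocity w ^~ t) x * phi x)) ;
  CCF_ae :
    forall t, 0 < t < T -> {ae lebesgue_measure, forall x : R,
      [/\ derivable (w x) t 1, derivable (w ^~ t) x 1,
          derivable (velocity w ^~ t) x 1 &
          derive1 (w x) t - 2 * velocity w x t * derive1 (w ^~ t) x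
            = 2 * w x t * derive1 (velocity w ^~ t) x]}
}.

Definition blows_up_near0 (T : R) (w : R -> R -> R) : Prop :=
  forall V : set R, nbhs 0 V ->
    sup_norm V (w ^~ t) @[t --> T^'-] --> +oo%E.

End Model.

(* Main.v *)
Require Import Defs.
From HB Require Import structures.
From mathcomp Require Import all_boot all_order all_algebra.
From mathcomp Require Import all_classical all_reals all_analysis.
From mathcomp Require Import measurable_realfun ring lra.

Set Implicit Arguments.
Unset Strict Implicit.
Unset Printing Implicit Defensive.

Import Order.TTheory GRing.Theory Num.Theory.
Import numFieldNormedType.Exports.

Local Open Scope classical_set_scope.
Local Open Scope ring_scope.

(** One profile serves every [alpha].  For a large integer [N], look for a solution
    [w(x,t) = (1-t)^-1 Om(x / (1-t)^N)] with [Om] odd; with [lambda = N alpha - 1] the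
    required exponents are [(1 + lambda)/alpha = N] and [1 - alpha/(1 + lambda) = 1 - 1/N].
    Put [eps = 1/N] and, for [x > 0], [Om(x) = (pi eps/2) phi(eps ln x)], with velocity
    [x v(eps ln x)].  Then the Biot-Savart law reads [v = p + (eps/2) kap * phi], where
    [p(z) = \int_z^oo phi] and [*] is a multiplicative convolution with an integrable kernel,
    and the profile equation becomes [phi (1 - 2 eps v) = G] with [G' = -(1 - 2 v) phi].
    At [eps = 0] this is the logistic equation [p' = - p (1 - p)]; for small [eps] a
    contraction around the logistic solution gives a positive [phi] that is [O(e^(z/2))] at
    [-oo] and [O(e^-z)] at [+oo], that is, an [Om] that is Hoelder continuous and
    [O(|x|^(-1/N))] at infinity.

    The primitive [th] of [Om] satisfies [N x Om - (N-1) th = 2 U Om], [U] being the velocity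
    profile; hence [(1-t)^(N-1) th(x / (1-t)^N)] has [x]-derivative [w] and [t]-derivative
    [2 u w], which gives the weak formulation after one integration by parts.  Since [U] is
    differentiable, the identity also shows that [Om] is differentiable off [0] and, once
    differentiated, that the equation holds at every [x <> 0]. *)

(** * Primitives and tails *)

(** Three obstacles shape the construction of [phi]. Linearising at the logistic solution gives
    [h' + Th h = tail g + f] for [h = tail k]. Its homogeneous solution [W^2] decays at both ends,
    reflecting the dilation symmetry in [x]; imposing [h 0 = 0] removes this freedom. The source
    [tail g] need not decay at [-oo], so the decay of [k = - h'] rests on a cancellation, which an
    integration by parts against [Bw] makes explicit. What remains is of size [z W^2], hence the
    contraction runs in the weight [W], of order [e^(-|z|/2)]. On the right this rate is too weak: a
    second pass integrates [G' = - a G] with [a] tending to [1] to reach [e^-z]. The left rate is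
    kept and gives the Hölder exponent [1/(2N)] of the profile; the right rate gives weak [L^N] and
    a velocity estimate that the self-similar scaling leaves invariant. The nonlocal term is only
    known to be as regular as [phi], so [phi] is never differentiated: its increments are estimated
    through [phi (1 - 2 eps v) = G]. *)

Section Calculus.
Context {R : realType}.
Notation mu := (@lebesgue_measure R).
Implicit Types (f g F G S : R -> R).

Lemma derive1_continuous F f : (forall x : R, is_derive x 1 F (f x)) -> continuous F.
Proof.
move=> dF x; apply: differentiable_continuous.
by apply/derivable1_diffP; case: (dF x).
Qed.

Lemma derive_le F f (a b : R) : a <= b -> (forall x : R, is_derive x 1 F (f x)) ->
  (forall x, a <= x <= b -> 0 <= f x) -> F a <= F b.
Proof.
move=> ab dF f0.
have [c] := MVT_segment ab (fun x _ => dF x) (continuous_subspaceT (derive1_continuous dF)).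
rewrite in_itv/= => cab E; rewrite -subr_ge0 E mulr_ge0 ?subr_ge0// f0//.
Qed.

(** Both [S + F] and [S - F] have a nonnegative derivative. Later bounds on primitives then need
    only an explicit primitive [S] of the majorant. *)
Lemma derive_norm_le F f S s (a b : R) : a <= b ->
  (forall x : R, is_derive x 1 F (f x)) -> (forall x : R, is_derive x 1 S (s x)) ->
  (forall x, `|f x| <= s x) -> `|F b - F a| <= S b - S a.
Proof.
move=> ab dF dS fs; rewrite ler_norml; apply/andP; split.
- have := @derive_le (S + F) _ a b ab (fun x => is_deriveD (dS x) (dF x)).
  have H : forall x, a <= x <= b -> 0 <= s x + f x.
    by move=> x _; have := fs x; rewrite ler_norml => /andP[]; lra.
  by move=> /(_ H); rewrite !fctE; lra.
- have := @derive_le (S - F) _ a b ab (fun x => is_deriveB (dS x) (dF x)).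
  have H : forall x, a <= x <= b -> 0 <= s x - f x.
    by move=> x _; have := fs x; rewrite ler_norml => /andP[]; lra.
  by move=> /(_ H); rewrite !fctE; lra.
Qed.

Lemma derive_0_const F : (forall x : R, is_derive x 1 F 0) -> forall x y, F x = F y.
Proof.
move=> dF; suff H x y : x <= y -> F x = F y.
  by move=> x y; case: (leP x y) => [/H//|/ltW/H->].
move=> xy; apply/le_anti/andP; split; first exact: (derive_le xy dF).
have dN z : is_derive z (1 : R) (- F) 0 by rewrite -oppr0; exact: is_deriveN.
by have := derive_le xy dN (fun _ _ => lexx 0); rewrite !fctE lerN2.
Qed.

(** Written with the same case split as [Lambda_inv], so that [Lambda_inv f] is
    [signed_integral (hilbert f)] by conversion. *)
Definition signed_integral g x : R :=
  if 0 <= x then \int[mu]_(y in `[0, x]) g y else - \int[mu]_(y in `[x, 0]) g y.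

Lemma continuous_itv_integrable g (a b : R) : continuous g ->
  mu.-integrable `[a, b] (EFin \o g).
Proof.
move=> cg; apply: continuous_compact_integrable; first exact: segment_compact.
exact: continuous_subspaceT.
Qed.

Lemma Rintegral_itv_cat g (a b c : R) : continuous g -> a <= b -> b <= c ->
  \int[mu]_(y in `[a, c]) g y = \int[mu]_(y in `[a, b]) g y + \int[mu]_(y in `[b, c]) g y.
Proof.
move=> cg ab bc; rewrite addrC; apply/eqP; rewrite -subr_eq; apply/eqP.
rewrite (@Rintegral_itvB _ _ (BLeft a) (BRight c) b) ?bnd_simp//; last exact: continuous_itv_integrable.
rewrite Rintegral_itv_obnd_cbnd//.
apply: integrableS (continuous_itv_integrable b c cg) => //.
exact: subset_itv_oc_cc.
Qed.

Lemma signed_integral_from g (a x : R) : continuous g -> a <= 0 -> a <= x ->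
  signed_integral g x = \int[mu]_(y in `[a, x]) g y - \int[mu]_(y in `[a, 0]) g y.
Proof.
move=> cg a0 ax; rewrite /signed_integral; case: ifPn => x0.
  by rewrite (Rintegral_itv_cat cg a0 x0) addrAC subrr add0r.
rewrite -ltNge in x0.
by rewrite (Rintegral_itv_cat cg ax (ltW x0)) opprD addrA subrr add0r.
Qed.

Lemma signed_integral_derive g : continuous g ->
  forall x : R, is_derive x 1 (signed_integral g) (g x).
Proof.
(* A base point to the left of both [0] and [x] removes the case split in a neighbourhood of [x]. *)
move=> cg x; pose a := - `|x| - 1.
have a0 : a < 0 by rewrite /a; have := normr_ge0 x; lra.
have ax : a < x by rewrite /a; have := ler_norm (- x); rewrite normrN; lra.
pose F := fun y => \int[mu]_(t in `[a, y]) g t - \int[mu]_(t in `[a, 0]) g t.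
have [dG dGE] := @continuous_FTC1 R g (BLeft a) x (x + 1) (ltac:(by rewrite ltrDl)) (continuous_itv_integrable a (x+1) cg) ax (cg x).
have dF : is_derive x 1 F (g x).
  rewrite -[g x]subr0; apply: is_deriveB.
  by apply: DeriveDef; [exact: dG|rewrite -derive1E; exact: dGE].
apply: near_eq_is_derive dF.
near=> y; rewrite /F -signed_integral_from//; first exact: ltW.
by apply: ltW; near: y; exact: lt_nbhsr.
Unshelve. all: by end_near. Qed.

Lemma signed_integral0 g : signed_integral g 0 = 0.
Proof. by rewrite /signed_integral lexx set_itv1 Rintegral_set1. Qed.

End Calculus.

Section Tail.
Context {R : realType}.
Implicit Types (f g D S s : R -> R).

(** On [[x, y]] the increment is at most [S y - S x <= L - S x]; then [y] tends to infinity. *)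
Lemma le_tail D g S s (L : R) : (forall x : R, is_derive x 1 D (g x)) ->
  (forall x : R, is_derive x 1 S (s x)) -> (forall x, `|g x| <= s x) ->
  (forall x, S x <= L) -> D x @[x --> +oo] --> 0 -> forall x, `|D x| <= L - S x.
Proof.
move=> dD dS gs SL D0 x.
have H : `|D x - D y| @[y --> +oo] --> `|D x - 0|.
  by apply: cvg_norm; apply: cvgB => //; exact: cvg_cst.
rewrite subr0 in H; apply: (@cvgr_to_le _ _ _ _ _ _ _ H).
near=> y.
have xy : x <= y by near: y; apply: nbhs_pinfty_ge; rewrite num_real.
rewrite distrC; apply: le_trans (derive_norm_le xy dD dS gs) _.
by rewrite lerB.
Unshelve. all: by end_near. Qed.

(** The improper integral of [g] from [x] to [+oo], taken as a limit of primitives so that its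
    derivative is immediate. *)
Definition tail g (x : R) : R :=
  lim (signed_integral g y @[y --> +oo]) - signed_integral g x.

(** [S] and [S + signed_integral g] are both nondecreasing and bounded above, so their difference
    converges. *)
Lemma signed_integral_cvg g S s (L : R) : continuous g ->
  (forall x : R, is_derive x 1 S (s x)) -> (forall x, `|g x| <= s x) ->
  (forall x, S x <= L) -> cvg (signed_integral g y @[y --> +oo]).
Proof.
move=> cg dS gs SL; have dg := signed_integral_derive cg.
have s0 x : 0 <= s x by apply: le_trans (gs x).
have ndS : {homo S : x y / x <= y}.
  by move=> x y xy; apply: (derive_le xy dS) => z _.
have cS : cvg (S y @[y --> +oo]).
  apply/cvg_ex; eexists; apply: (nondecreasing_cvgr ndS).
  by exists L => _ [x _ <-].
have ndT : {homo (S + signed_integral g) : x y / x <= y}.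
  move=> x y xy.
  apply: (derive_le xy (fun x => is_deriveD (dS x) (dg x))) => z _.
  by have := gs z; rewrite ler_norml => /andP[]; lra.
have cT : cvg ((S + signed_integral g) y @[y --> +oo]).
  apply/cvg_ex; eexists; apply: (nondecreasing_cvgr ndT).
  exists (L + (L - S 0)) => _ [x _ <-] /=; rewrite fctE.
  have := SL x; case: (leP 0 x) => x0.
    have := derive_norm_le x0 dg dS gs.
    by rewrite signed_integral0 subr0 ler_norml => /andP[]; lra.
  have := ndT _ _ (ltW x0); rewrite !fctE signed_integral0.
  by have := SL 0; lra.
have -> : signed_integral g = (S + signed_integral g) - S.
  by apply/funext => x; rewrite !fctE addrC addKr.
exact: is_cvgB.
Qed.

Lemma tail_derive g : continuous g -> forall x : R, is_derive x 1 (tail g) (- g x).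
Proof.
move=> cg x; rewrite -[- g x]add0r; apply: is_deriveB.
exact: signed_integral_derive.
Qed.

Lemma tail_cvg g S s (L : R) : continuous g ->
  (forall x : R, is_derive x 1 S (s x)) -> (forall x, `|g x| <= s x) ->
  (forall x, S x <= L) -> tail g x @[x --> +oo] --> 0.
Proof.
move=> cg dS gs SL; rewrite -(subrr (lim (signed_integral g y @[y --> +oo]))).
by apply: cvgB; [exact: cvg_cst|exact: (signed_integral_cvg cg dS gs SL)].
Qed.

End Tail.

(** * The hyperbolic weight *)

Section Weight.
Context {R : realType}.

(* [W ^+ 2] is the derivative of the logistic function and [Bw] is a primitive of [W ^- 2]. *)
Definition W (x : R) : R := (expR (x / 2) + expR (- (x / 2)))^-1.
(** Since [W x = 1 / (2 cosh (x/2))], this is [tanh (x/2)], and [(1 - Th) / 2] is the logistic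
    solution of [p' = - p (1 - p)]. *)
Definition Th (x : R) : R := (expR (x / 2) - expR (- (x / 2))) * W x.
Definition SW (x : R) : R := 2 * atan (expR (x / 2)).

Lemma expR_half_inv (x : R) : expR (x / 2) * expR (- (x / 2)) = 1.
Proof. exact: expRxMexpNx_1. Qed.

Lemma W_gt0 x : 0 < W x.
Proof. by rewrite invr_gt0 addr_gt0// expR_gt0. Qed.

Lemma W_denom x : (expR (x / 2) + expR (- (x / 2))) * W x = 1.
Proof. by rewrite mulfV// gt_eqF// addr_gt0// expR_gt0. Qed.

Lemma Th_sqr x : Th x ^+ 2 = 1 - 4 * W x ^+ 2.
Proof.
have h1 := W_denom x; have h2 := expR_half_inv x.
rewrite /Th; move: (W x) h1 => w h1.
have : ((expR (x / 2) + expR (- (x / 2))) * w) ^+ 2 = 1 by rewrite h1 expr1n.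
by move: (expR (x/2)) (expR (-(x/2))) h2 => a b; nra.
Qed.

Lemma W_le_half x : W x <= 1/2.
Proof. by have := Th_sqr x; have := sqr_ge0 (Th x); have := W_gt0 x; nra. Qed.

Lemma Th_le1 x : `|Th x| <= 1.
Proof.
rewrite ler_norml; have := Th_sqr x; have := W_gt0 x; move: (Th x) (W x) => t w.
by move=> w0 E; apply/andP; split; nra.
Qed.

Lemma is_derive_half (x : R) : is_derive x 1 (fun x : R => x / 2) (2^-1).
Proof.
have -> : (fun x : R => x / 2) = (2^-1 : R) *: id by apply/funext => y; rewrite /= /GRing.scale/= mulrC.
by apply: is_derive_eq; rewrite /GRing.scale/= mulr1.
Qed.

Lemma is_derive_exphalf (x : R) : is_derive x 1 (fun x => expR (x / 2)) (expR (x / 2) / 2).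
Proof.
exact: (@is_derive1_comp _ expR (fun x => x / 2) _ _ _ _ (is_derive_half x)).
Qed.

Lemma is_derive_exphalfN (x : R) : is_derive x 1 (fun x => expR (- (x / 2))) (- (expR (- (x / 2)) / 2)).
Proof.
rewrite -mulrN.
exact: (@is_derive1_comp _ expR (fun x => - (x / 2)) _ _ _ _ (is_deriveN (is_derive_half x))).
Qed.

Lemma is_derive_W (x : R) : is_derive x 1 W (- (1/2) * Th x * W x).
Proof.
have h := is_deriveD (is_derive_exphalf x) (is_derive_exphalfN x).
have n0 : (expR (x / 2) + expR (- (x / 2))) != 0 by rewrite gt_eqF// addr_gt0// expR_gt0.
have := @is_deriveV _ (fun x : R => expR (x / 2) + expR (- (x / 2))) x _ 1 n0 h.
move=> /is_derive_eq; apply.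
rewrite /Th /W /GRing.scale/= -exprVn.
by field.
Qed.

Lemma is_derive_SW (x : R) : is_derive x 1 SW (W x).
Proof.
have h := @is_derive1_comp _ atan (fun x : R => expR (x / 2)) x _ _ (is_derive1_atan (expR (x/2))) (is_derive_exphalf x).
have -> : SW = 2 *: (atan \o (fun x => expR (x/2))) by [].
apply: is_derive_eq; rewrite /W /GRing.scale/= expRN.
have := expR_gt0 (x/2); set e := expR _ => e0.
have ? : 1 + e ^+ 2 != 0 by nra.
have ? : e != 0 by rewrite gt_eqF.
by field; rewrite ?andbT; apply/andP; split => //; nra.
Qed.

Lemma SW_bounds x : 0 < SW x < 4.
Proof.
rewrite /SW; have /andP[h1 h2] : (-(pi/2) < atan (expR (x/2)) < pi/2) by rewrite atan_gtNpi2 atan_ltpi2.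
have : 0 < atan (expR (x/2)) by rewrite -[X in X < _]atan0 lt_atan ?expR_gt0.
by have := pihalf_lt2 R; lra.
Qed.

Lemma norm_expR_half_le (x : R) : expR (`|x| / 2) <= (W x)^-1.
Proof.
rewrite /W invrK; case: (ger0P x) => _; first by rewrite lerDl expR_ge0.
by rewrite mulNr lerDr expR_ge0.
Qed.

(** Absorbs the factor [z] that occurs in [lin], at the price of one power of [W]. *)
Lemma norm_W_le x : `|x| * W x <= 2.
Proof.
have h : `|x| / 2 <= (W x)^-1.
  apply: le_trans (norm_expR_half_le x).
  by have := expR_ge1Dx (`|x| / 2); lra.
rewrite ler_pdivrMr// in h; have := W_gt0 x.
by rewrite mulrC -ler_pdivlMl ?W_gt0// => _; lra.
Qed.

Definition Bw (x : R) : R := expR x - expR (- x) + 2 * x.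

Lemma W_sqr_inv x : (W x ^+ 2)^-1 = expR x + 2 + expR (- x).
Proof.
rewrite /W -exprVn invrK sqrrD expR_half_inv -!expRM_natl.
by congr (expR _ + _ + expR _); field.
Qed.

Lemma is_derive_Bw (x : R) : is_derive x 1 Bw ((W x ^+ 2)^-1).
Proof.
have h : is_derive x 1 (fun x : R => expR (- x)) (- expR (- x)).
  by apply: (is_derive_eq (is_derive1_comp (is_derive_expR (- x)) (is_deriveNid x 1))); rewrite mulrN1.
have h2 : is_derive x 1 (fun x : R => 2 * x) 2.
  have -> : (fun x : R => 2 * x) = (2 : R) *: id by [].
  by apply: is_derive_eq; rewrite /GRing.scale/= mulr1.
apply: (is_derive_eq (is_deriveD (is_deriveB (is_derive_expR x) h) h2)).
by rewrite W_sqr_inv opprK; ring.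
Qed.

Lemma Bw_le x : `|Bw x| <= 3 / W x ^+ 2.
Proof.
rewrite W_sqr_inv /Bw.
have := expR_ge1Dx x; have := expR_ge1Dx (- x).
have := expR_gt0 x; have := expR_gt0 (- x).
by move=> *; rewrite ler_norml; apply/andP; split; lra.
Qed.

End Weight.

(** * The logarithmic kernel *)

Section Improper.
Context {R : realType}.
Notation mu := (@lebesgue_measure R).
Implicit Types (f F : R -> R) (D : set R).

Lemma is_derive_cont (F : R -> R) (x d : R) : is_derive x 1 F d -> {for x, continuous F}.
Proof. by case=> dF _; apply: differentiable_continuous; apply/derivable1_diffP. Qed.

Lemma FTC2_segment F f (a b : R) : a <= b ->
  (forall x : R, a <= x <= b -> is_derive x 1 F (f x)) ->
  (forall x, a <= x <= b -> {for x, continuous f}) ->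
  (\int[mu]_(x in `[a, b]) (f x)%:E = (F b - F a)%:E)%E.
Proof.
rewrite le_eqVlt => /predU1P[<- _ _|ab dF cf].
  by rewrite set_itv1 integral_set1 subrr.
rewrite (@continuous_FTC2 _ f F)//.
- apply: continuous_in_subspaceT => x; rewrite inE/= in_itv/=; exact: cf.
- split.
  + by move=> x; rewrite in_itv/= => /andP[ax xb]; case: (dF x) => //; rewrite (ltW ax) (ltW xb).
  + apply: cvg_at_right_filter; apply: (is_derive_cont (dF a _)); rewrite lexx (ltW ab)//.
  + apply: cvg_at_left_filter; apply: (is_derive_cont (dF b _)); rewrite lexx (ltW ab)//.
- move=> x; rewrite in_itv/= => /andP[ax xb]; rewrite derive1E.
  by case: (dF x) => //; rewrite (ltW ax) (ltW xb).
Qed.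

(** Monotone convergence along the exhausting segments: on each nonempty one the integral is
    [F (b_ n) - F (a_ n)], at most [2 |M|]. *)
Lemma improper_integrable D f F (a_ b_ : nat -> R) (M : R) :
  D = \bigcup_n `[a_ n, b_ n]%classic ->
  {homo a_ : m n / (m <= n)%N >-> n <= m} -> {homo b_ : m n / (m <= n)%N >-> m <= n} ->
  measurable D -> 
  (forall x : R, D x -> is_derive x 1 F (f x)) ->
  (forall x, D x -> {for x, continuous f}) ->
  (forall x, D x -> 0 <= f x) -> (forall x, D x -> `|F x| <= M) ->
  mu.-integrable D (EFin \o f).
Proof.
move=> DE nda ndb mD dF cf f0 FM.
have sub n : `[a_ n, b_ n]%classic `<=` D by rewrite DE => x ?; exists n.
have mf : measurable_fun D f.
  rewrite DE; apply/measurable_fun_bigcup => // n.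
  apply: subspace_continuous_measurable_fun => //.
  by apply: continuous_in_subspaceT => x; rewrite inE/= => /sub; exact: cf.
have ndD : {homo (fun n => `[a_ n, b_ n]%classic) : m n / (m <= n)%N >-> (m <= n)%O}.
  move=> m n mn; apply/subsetPset => x /=; rewrite !in_itv/= => /andP[h1 h2].
  by rewrite (le_trans (nda _ _ mn) h1) (le_trans h2 (ndb _ _ mn)).
apply/integrableP; split; first exact/measurable_EFinP.
under eq_integral.
  move=> x; rewrite inE => Dx; rewrite /= ger0_norm ?f0//; over.
have /= H := @ge0_nondecreasing_set_cvg_integral _ (measurableTypeR R) _ (fun n => `[a_ n, b_ n]%classic) (EFin \o f) mu ndD (fun _ => measurable_itv _).
rewrite DE -(cvg_lim _ (H _ _))//; last 2 first.
- by move=> n; apply/measurable_EFinP; apply: measurable_funS mf.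
- by move=> n x /sub Dx; rewrite lee_fin f0.
apply: (@le_lt_trans _ _ (2 * `|M|)%:E); last exact: ltry.
apply: lime_le.
  by apply/cvg_ex; eexists; apply: H => [n|n x /sub Dx]; [apply/measurable_EFinP; apply: measurable_funS mf|rewrite lee_fin f0].
near=> n.
have [ab|ba] := leP (a_ n) (b_ n); last first.
  rewrite set_itv_ge ?integral_set0 ?lee_fin ?mulr_ge0// bnd_simp -ltNge//.
have -> := FTC2_segment ab (fun x xab => dF x (sub n x xab)) (fun x xab => cf x (sub n x xab)).
have h x : D x -> `|F x| <= `|M| by move=> /FM h; apply: le_trans h (ler_norm _).
have := h (b_ n) (sub n _ _); have := h (a_ n) (sub n _ _); rewrite lee_fin.
rewrite /= !in_itv/= !lexx ab/= => /(_ isT) + /(_ isT).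
by rewrite !ler_norml => /andP[h1 h2] /andP[h3 h4]; lra.
Unshelve. all: by end_near. Qed.

Lemma improper_integrable_oo f F (a b M : R) : a < b ->
  (forall x : R, a < x < b -> is_derive x 1 F (f x)) ->
  (forall x, a < x < b -> {for x, continuous f}) ->
  (forall x, a < x < b -> 0 <= f x) -> (forall x, a < x < b -> `|F x| <= M) ->
  mu.-integrable `]a, b[ (EFin \o f).
Proof.
move=> ab dF cf f0 FM.
apply: (@improper_integrable _ f F (fun n => a + n.+1%:R^-1) (fun n => b - n.+1%:R^-1) M) => //.
- apply/seteqP; split => [x /=|x [n _]/=]; rewrite !in_itv/=.
    move=> /andP[ax xb].
    have e0 : 0 < Num.min (x - a) (b - x) by rewrite lt_min !subr_gt0 ax xb.
    have [n] := ltr_add_invr e0.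
    rewrite add0r lt_min => /andP[h1 h2]; exists n => //=.
    rewrite in_itv/=; move: (_^-1) h1 h2 => e h1 h2; apply/andP; split; lra.
  have : 0 < n.+1%:R^-1 :> R by rewrite invr_gt0 ltr0n.
  move: (_^-1) => e h /andP[h1 h2]; apply/andP; split; lra.
- by move=> m n mn; rewrite lerD2l lef_pV2 ?posrE ?ltr0n// ler_nat ltnS.
- by move=> m n mn; rewrite lerD2l lerN2 lef_pV2 ?posrE ?ltr0n// ler_nat ltnS.
Qed.

Lemma improper_integrable_oy f F (a M : R) :
  (forall x : R, a < x -> is_derive x 1 F (f x)) ->
  (forall x, a < x -> {for x, continuous f}) ->
  (forall x, a < x -> 0 <= f x) -> (forall x, a < x -> `|F x| <= M) ->
  mu.-integrable `]a, +oo[ (EFin \o f).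
Proof.
move=> dF cf f0 FM.
have H x : `]a, +oo[%classic x -> a < x by rewrite /= in_itv/= andbT.
apply: (@improper_integrable _ f F (fun n => a + n.+1%:R^-1) (fun n => a + n%:R) M) => //;
  try by move=> x /H ax; auto.
- apply/seteqP; split => [x /=|x [n _]/=]; rewrite !in_itv/= ?andbT.
    move=> ax; have := ax; rewrite -subr_gt0 => e0.
    have [n] := ltr_add_invr e0.
    rewrite add0r => h1.
    have [m h2] : exists m : nat, x - a < m%:R.
      by exists (Num.truncn (x - a)).+1; rewrite truncnS_gt.
    exists (maxn n m) => //=; rewrite in_itv/=; apply/andP; split.
      rewrite -lerBrDl; apply: le_trans (ltW h1).
      by rewrite lef_pV2 ?posrE ?ltr0n// ler_nat ltnS leq_maxl.
    rewrite -lerBlDl; apply: le_trans (ltW h2) _.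
    by rewrite ler_nat leq_maxr.
  have : 0 < n.+1%:R^-1 :> R by rewrite invr_gt0 ltr0n.
  move: (_^-1) => e h /andP[h1 h2]; lra.
- by move=> m n mn; rewrite lerD2l lef_pV2 ?posrE ?ltr0n// ler_nat ltnS.
- by move=> m n mn; rewrite lerD2l ler_nat.
Qed.

End Improper.

(** * Integrability of the reduced kernel *)

Section Kernel.
Context {R : realType}.
Notation mu := (@lebesgue_measure R).
Implicit Types (f F : R -> R) (D : set R).

Lemma integrable_setU (A B : set R) (f : R -> \bar R) : measurable A -> measurable B ->
  mu.-integrable A f -> mu.-integrable B f -> mu.-integrable (A `|` B) f.
Proof.
move=> mA mB fA fB; have mAB : measurable (B `\` A) by exact: measurableD.
have fBA : mu.-integrable (B `\` A) f by apply: integrableS fB => //; exact: subDsetl.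
have -> : A `|` B = A `|` (B `\` A) by rewrite setUDr setDv setD0 // ; apply/seteqP; split=> x; rewrite /setU/=; tauto.
move/integrableP : fA => [mfA iA]; move/integrableP : fBA => [mfB iB].
have mf : measurable_fun (A `|` (B `\` A)) f by apply/measurable_funU.
apply/integrableP; split => //.
rewrite ge0_integral_setU//; first exact: lte_add_pinfty.
- exact: measurableT_comp.
- apply/disj_setPS => x [Ax [_ nA]]; exact: nA.
Qed.

Lemma integrable_set1 (a : R) (f : R -> R) : mu.-integrable [set a] (EFin \o f).
Proof.
apply/integrableP; split; first exact: measurable_fun_set1.
by rewrite integral_set1.
Qed.

Lemma integrable_dominated D f g : measurable D -> measurable_fun D f ->
  mu.-integrable D (EFin \o g) -> (forall x, D x -> `|f x| <= g x) ->
  mu.-integrable D (EFin \o f).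
Proof.
move=> mD mf ig fg; apply: le_integrable ig => //; first exact/measurable_EFinP.
by move=> x Dx /=; rewrite lee_fin (le_trans (fg _ Dx))// ler_norm.
Qed.

Lemma integrableZ D f (c : R) : measurable D -> mu.-integrable D (EFin \o f) ->
  mu.-integrable D (EFin \o (fun x => c * f x)).
Proof.
by move=> mD iF; exact: (@integrableZl _ _ _ mu D mD c (EFin \o f) iF).
Qed.

Lemma is_derive_powR_affine (c e a x : R) : 0 < c + e * x ->
  is_derive x 1 (fun x => (c + e * x) `^ a) (e * (a * (c + e * x) `^ (a - 1))).
Proof.
move=> h; have d : is_derive x 1 (fun x : R => c + e * x) e.
  rewrite -[X in is_derive _ _ _ X]add0r; apply: is_deriveD.
  have := is_deriveZ e (is_derive_id x (1 : R)); rewrite /GRing.scale/= mulr1; exact.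
rewrite [X in is_derive _ _ _ X]mulrC.
exact: (@is_derive1_comp _ (fun y => y `^ a) (fun x => c + e * x) x _ _ (is_derive1_powR a h) d).
Qed.

(** The condition [e ^+ 2 = 1] stands for [e = 1] or [e = -1], so that one statement treats a power
    singularity at either end of the interval. *)
Lemma powR_affine_integrable (c e a L : R) (u v : R) : u < v -> e ^+ 2 = 1 -> 0 < a ->
  (forall x, u < x < v -> 0 < c + e * x <= L) ->
  mu.-integrable `]u, v[ (fun x => ((c + e * x) `^ (a - 1))%:E).
Proof.
move=> uv e1 a0 H.
have H0 x : u < x < v -> 0 < c + e * x by move=> /H/andP[].
apply: (@improper_integrable_oo R (fun x => (c + e * x) `^ (a - 1)) (fun x => e * a^-1 * (c + e * x) `^ a) u v (`|e * a^-1| * L `^ a)) => //.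
- move=> x /H0 x0.
  have -> : (fun x => e * a^-1 * (c + e * x) `^ a) = (e * a^-1) *: (fun x => (c + e * x) `^ a) by [].
  have dF := is_derive_powR_affine a x0.
  apply: is_derive_eq; rewrite /GRing.scale/=.
  transitivity (e ^+ 2 * (a^-1 * a) * (c + e * x) `^ (a - 1)); first by ring.
  by rewrite e1 mulVf ?gt_eqF// !mul1r.
- move=> x /H0 x0; exact: (is_derive_cont (is_derive_powR_affine (a - 1) x0)).
- by move=> x _; exact: powR_ge0.
- move=> x xuv; have /andP[x0 xL] := H x xuv.
  rewrite normrM ler_wpM2l// ger0_norm ?powR_ge0// ge0_ler_powR ?nnegrE ?(ltW a0) ?(ltW x0)//.
  exact: ltW (lt_le_trans x0 xL).
Qed.

Lemma powR_integrable0 (a L : R) : 0 < a -> 0 < L ->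
  mu.-integrable `]0, L[ (fun x => (x `^ (a - 1))%:E).
Proof.
move=> a0 L0.
have H (x : R) : 0 < x < L -> 0 < 0 + 1 * x <= L.
  by move=> /andP[x0 xL]; rewrite add0r mul1r x0 ltW.
have := @powR_affine_integrable 0 1 a L 0 L L0 (expr1n _ _) a0 H.
by congr integrable; apply/funext => x; rewrite add0r mul1r.
Qed.

Lemma powR_integrabley (b r : R) : 0 < b -> 0 < r ->
  mu.-integrable `]r, +oo[ (fun x => (x `^ (- b - 1))%:E).
Proof.
move=> b0 r0.
apply: (@improper_integrable_oy R (fun x => x `^ (- b - 1)) (fun x => - b^-1 * x `^ (- b)) r (b^-1 * r `^ (- b))).
- move=> x rx; have x0 := lt_trans r0 rx.
  have -> : (fun x => - b^-1 * x `^ (- b)) = (- b^-1) *: (fun x => x `^ (- b)) by [].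
  have dF := is_derive1_powR (- b) x0.
  by apply: is_derive_eq; rewrite /GRing.scale/= mulrA mulrNN mulVf ?gt_eqF// mul1r.
- by move=> x rx; exact: (is_derive_cont (is_derive1_powR (- b - 1) (lt_trans r0 rx))).
- by move=> x _; exact: powR_ge0.
- move=> x rx; have x0 := lt_trans r0 rx.
  rewrite normrM normrN (gtr0_norm (x := b^-1)) ?invr_gt0// ler_wpM2l ?invr_ge0 1?(ltW b0)//.
  rewrite ger0_norm ?powR_ge0// !powRN lef_pV2 ?posrE ?powR_gt0//.
  by rewrite ge0_ler_powR ?nnegrE ?ltW.
Qed.

(** [- ln x = 2 ln (x^(-1/2))]. This trades the logarithmic singularity of the kernel at [1] for an
    integrable power. *)
Lemma Nln_le_powR (x : R) : 0 < x -> - ln x <= 2 * x `^ (- (1 / 2)).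
Proof.
move=> x0; rewrite -[X in - ln X](invrK x) lnV ?posrE ?invr_gt0// opprK.
have -> : ln x^-1 = 2 * ln (x `^ (- (1/2))) by rewrite ln_powR lnV ?posrE//; lra.
by rewrite ler_wpM2l// ltW// ln_sublinear// powR_gt0.
Qed.

Lemma ln_le_subr1 (x : R) : 0 < x -> ln x <= x - 1.
Proof. by move=> x0; have := @le_ln1Dx R (x - 1); rewrite addrCA subrr addr0; apply; lra. Qed.

(* [Lambda_inv f X = - (X / pi) \int_0^oo f (X s) log_kernel s ds] for odd [f] and [X > 0];
   [kap] is what is left of [log_kernel] once its non-integrable tail is removed, and stays
   integrable against the weight [wt], which dominates the decay rates used for profiles. *)
Definition log_kernel (s : R) : R := ln (1 + s) - ln `|1 - s|.
Definition kap (s : R) : R := log_kernel s - (if 1 < s then 2 / s else 0).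
Definition wt (s : R) : R := 1 + s `^ (- (1 / 2)).

Lemma measurable_log_kernel : measurable_fun setT log_kernel.
Proof.
apply: measurable_funB; apply: measurableT_comp => //; first exact: measurable_funD.
by apply: measurableT_comp => //; exact: measurable_funB.
Qed.

Lemma measurable_kap : measurable_fun (`]0%R, +oo[%classic : set R) kap.
Proof.
apply: measurable_funB; first exact: measurable_funTS measurable_log_kernel.
apply: measurable_fun_if => //.
- apply: measurable_fun_ltr => //.
- apply: measurable_funM => //.
  apply: (@measurable_funS _ _ _ _ (`]0%R, +oo[%classic : set R)) => //.
  apply: open_continuous_measurable_fun; first exact: interval_open.
  move=> x; rewrite inE/= in_itv/= andbT => x0.
  by apply: inv_continuous; rewrite gt_eqF.
Qed.

Lemma measurable_wt D : measurable_fun D wt.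
Proof.
apply: measurable_funTS; apply: measurable_funD => //; exact: measurable_powR.
Qed.

Lemma wt_ge1 s : 1 <= wt s.
Proof. by rewrite lerDl powR_ge0. Qed.

Lemma powRNhalf_ge1 (x : R) : 0 < x <= 1 -> 1 <= x `^ (- (1 / 2)).
Proof.
move=> x1; rewrite -[X in X <= _](powRr0 x) ger_powR//; lra.
Qed.

(** Two regimes: for [s <= 1/2] the bound [kap s <= 3 s] compensates the factor [s^(-1/2)] of [wt];
    for [s > 1/2] the weight is at most [3] and only the logarithm at [1] matters. *)
Lemma kap_wt_le1 s : 0 < s < 1 -> `|kap s * wt s| <= 9 * (1 + (-1) * s) `^ (1 / 2 - 1).
Proof.
move=> /andP[s0 s1]; rewrite mulN1r (_ : 1 / 2 - 1 = - (1 / 2)); last by lra.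
rewrite /kap ltNge (ltW s1)/= subr0 /log_kernel (_ : `|1 - s| = 1 - s); last first.
  by rewrite gtr0_norm ?subr_gt0.
have u0 : 0 < 1 - s by lra.
have l1 : ln (1 + s) <= s by apply: le_ln1Dx; lra.
have l2 : 0 <= ln (1 + s) by apply: ln_ge0; lra.
have l3 : ln (1 - s) <= 0 by apply: ln_le0; lra.
have l4 := Nln_le_powR u0.
have p1 : 1 <= (1 - s) `^ (- (1/2)) by apply: powRNhalf_ge1; lra.
have k0 : 0 <= ln (1 + s) - ln (1 - s) by lra.
rewrite ger0_norm; last by rewrite mulr_ge0// (le_trans ler01)// wt_ge1.
set P := (1 - s) `^ _ in p1 l4 *.
have [s2|s2] := leP s (1/2).
- have : - ln (1 - s) <= 2 * s.
    rewrite -lnV ?posrE//; apply: le_trans (ln_le_subr1 _) _; rewrite ?invr_gt0//.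
    by rewrite lerBlDr -[X in X <= _]mul1r ler_pdivrMr//; nra.
  move=> l5.
  have q1 : s * s `^ (- (1/2)) <= 1.
    rewrite powRN -(@ler_pM2r _ (s `^ (1/2))) ?powR_gt0// -mulrA mulVf ?gt_eqF ?powR_gt0// mulr1 !mul1r.
    rewrite -[X in X <= _]powRr1 ?(ltW s0)// ger_powR ?s0 ?(ltW s1)//; lra.
  rewrite /wt; set Q := s `^ _ in q1 *.
  have Q0 : 0 <= Q by exact: powR_ge0.
  set K := ln _ - ln _ in k0 *; have kle : K <= 3 * s by rewrite /K; lra.
  have : K * Q <= 3 * s * Q by rewrite ler_wpM2r.
  have : K <= 3 * P by rewrite /K; lra.
  by rewrite mulrDr mulr1; lra.
- have q1 : wt s <= 3.
    rewrite /wt powRN.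
    suff : (s `^ (1/2))^-1 <= 2 by lra.
    rewrite -[X in _ <= X]invrK lef_pV2 ?posrE ?powR_gt0//.
    have : s `^ 1 <= s `^ (1/2) by rewrite ger_powR ?s0 ?ltW//; lra.
    rewrite (powRr1 (ltW s0)); lra.
  have := wt_ge1 s; set w := wt s in q1 *.
  set K := ln _ - ln _ in k0 *; have kle : K <= 3 * P by rewrite /K; lra.
  move=> w1; have : K * w <= 3 * P * 3 by rewrite ler_pM//; lra.
  lra.
Qed.

Lemma wt_le2 s : 1 <= s -> wt s <= 2.
Proof.
move=> s1; suff : s `^ (- (1/2)) <= 1 by rewrite /wt; lra.
by rewrite -[X in _ <= X](powRr0 s) ler_powR//; lra.
Qed.

Lemma kap_wt_le2 s : 1 < s < 2 -> `|kap s * wt s| <= 8 * (- 1 + 1 * s) `^ (1 / 2 - 1).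
Proof.
move=> /andP[s1 s2]; rewrite mul1r (_ : 1 / 2 - 1 = - (1 / 2)); last by lra.
have u0 : 0 < -1 + s by lra.
have p1 : 1 <= (-1 + s) `^ (- (1/2)) by apply: powRNhalf_ge1; lra.
have l4 := Nln_le_powR u0.
rewrite /kap s1 /log_kernel (_ : `|1 - s| = s - 1); last first.
  by rewrite ltr0_norm ?subr_lt0// opprB.
rewrite (addrC s (-1)).
have l1 : ln (1 + s) <= s by apply: le_ln1Dx; lra.
have l2 : 0 <= ln (1 + s) by apply: ln_ge0; lra.
have l3 : ln (-1 + s) <= 0 by apply: ln_le0; lra.
have i1 : 0 <= 2 / s by rewrite divr_ge0//; lra.
have i2 : 2 / s <= 2 by rewrite ler_pdivrMr; lra.
set P := (-1 + s) `^ _ in p1 l4 *.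
rewrite normrM (_ : 8 * P = (4 * P) * 2); last by ring.
rewrite ler_pM//; last by rewrite ger0_norm ?wt_le2 ?(le_trans ler01) ?wt_ge1// ltW.
by rewrite ler_norml; apply/andP; split; lra.
Qed.

(** The subtracted [2 / s] is the leading term of [ln ((s + 1) / (s - 1))]. Applying [ln y <= y - 1]
    to this ratio and to its inverse bounds the remainder by [4 / s^2] from both sides. *)
Lemma kap_wt_le3 s : 2 < s -> `|kap s * wt s| <= 8 * s `^ (- 1 - 1).
Proof.
move=> s2; have s1 : 1 < s by lra.
rewrite /kap s1 /log_kernel (_ : `|1 - s| = s - 1); last first.
  by rewrite ltr0_norm ?subr_lt0// opprB.
have -> : s `^ (- 1 - 1) = (s^-1) ^+ 2.
  rewrite (_ : -1 - 1 = - 2%:R); last by lra.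
  by rewrite powR_invn ?exprVn; lra.
have a0 : 0 < s - 1 by lra.
have b0 : 0 < 1 + s by lra.
have l1 : ln (1 + s) - ln (s - 1) <= (1 + s) / (s - 1) - 1.
  by rewrite -ln_div ?posrE//; apply: ln_le_subr1; rewrite divr_gt0.
have l2 : ln (s - 1) - ln (1 + s) <= (s - 1) / (1 + s) - 1.
  by rewrite -ln_div ?posrE//; apply: ln_le_subr1; rewrite divr_gt0.
rewrite normrM (_ : 8 * _ = (4 * (s^-1) ^+ 2) * 2); last by ring.
rewrite ler_pM//; last by rewrite ger0_norm ?wt_le2 ?(le_trans ler01) ?wt_ge1// ltW.
have e1 : (1 + s) / (s - 1) - 1 - 2 / s <= 4 * s^-1 ^+ 2.
  rewrite -subr_ge0 (_ : _ - _ = (2 * s - 4) / (s ^+ 2 * (s - 1))); last first.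
    by field; rewrite ?andbT; apply/andP; split; lra.
  by rewrite divr_ge0 ?mulr_ge0 ?sqr_ge0//; lra.
have e2 : (s - 1) / (1 + s) - 1 + 2 / s <= 4 * s^-1 ^+ 2.
  rewrite -subr_ge0 (_ : _ - _ = (2 * s + 4) / (s ^+ 2 * (1 + s))); last first.
    by field; rewrite ?andbT; apply/andP; split; lra.
  by rewrite divr_ge0 ?mulr_ge0 ?sqr_ge0//; lra.
by rewrite ler_norml; apply/andP; split; lra.
Qed.

Lemma itv0y_split : `]0%R, +oo[%classic =
  (((`]0, 1[ `|` [set 1]) `|` `]1, 2[) `|` [set 2]) `|` `]2, +oo[ :> set R.
Proof.
apply/seteqP; split => x /=; rewrite !in_itv/= ?andbT.
- move=> x0; case: (ltgtP x 1) => h1; case: (ltgtP x 2) => h2; rewrite ?x0 /=; do ?[by left; left; left; left|by left; left; left; right|by left; left; right|by left; right|by right]; try lra.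
- by move=> [[[[/andP[]|->]|/andP[h _]]|->]|] //; lra.
Qed.

Lemma kap_wt_integrable : mu.-integrable `]0, +oo[ (fun s => (kap s * wt s)%:E).
Proof.
have mk D : measurable D -> D `<=` `]0, +oo[ -> measurable_fun D (fun s => kap s * wt s).
  move=> mD s; apply: measurable_funM; last exact: measurable_wt.
  by apply: measurable_funS measurable_kap.
rewrite itv0y_split; repeat apply: integrable_setU; rewrite ?measurableU//; repeat apply: measurableU => //; try exact: integrable_set1.
- apply: (@integrable_dominated _ _ (fun x => 9 * (1 + (-1) * x) `^ (1/2 - 1))) => //.
  + by apply: mk => //; exact: subset_itvl.
  + apply: integrableZ => //; apply: (@powR_affine_integrable _ _ _ 1); rewrite ?sqrrN ?expr1n//; do ?[by lra|by move=> x; lra].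
  + by move=> x /=; rewrite in_itv/=; exact: kap_wt_le1.
- apply: (@integrable_dominated _ _ (fun x => 8 * (- 1 + 1 * x) `^ (1/2 - 1))) => //.
  + apply: mk => // x /=; rewrite !in_itv/= andbT; lra.
  + apply: integrableZ => //; apply: (@powR_affine_integrable _ _ _ 1); rewrite ?sqrrN ?expr1n//; do ?[by lra|by move=> x; lra].
  + by move=> x /=; rewrite in_itv/=; exact: kap_wt_le2.
- apply: (@integrable_dominated _ _ (fun x => 8 * x `^ (- 1 - 1))) => //.
  + apply: mk => // x /=; rewrite !in_itv/= !andbT; lra.
  + by apply: integrableZ => //; exact: powR_integrabley.
  + by move=> x /=; rewrite in_itv/= andbT; exact: kap_wt_le3.
Qed.

End Kernel.

(** * Convolution with the reduced kernel *)

Section Convolution.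
Context {R : realType}.
Notation mu := (@lebesgue_measure R).
Implicit Types (f g phi psi : R -> R).

(** One constant that bounds [conv] for sup norms and for exponential rates alike; the weight [wt]
    pays for the latter. *)
Definition kap_mass : R := \int[mu]_(s in `]0, +oo[) `|kap s * wt s|.

Lemma kap_integrable_dominated g (b : R) :
  measurable_fun (`]0%R, +oo[%classic : set R) g ->
  (forall s, 0 < s -> `|g s| <= b * wt s) ->
  mu.-integrable `]0, +oo[ (fun s => (kap s * g s)%:E).
Proof.
move=> mg gb.
apply: (@integrable_dominated R _ _ (fun s => b * `|kap s * wt s|)) => //.
- by apply: measurable_funM => //; exact: measurable_kap.
- apply: integrableZ => //.
  have := integrable_abse (@kap_wt_integrable R); apply: eq_integrable => //.
- move=> s /=; rewrite in_itv/= andbT => s0.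
  rewrite !normrM [`|wt s|]ger0_norm ?(le_trans ler01) ?wt_ge1//.
  by rewrite mulrCA ler_wpM2l// gb.
Qed.

Lemma kap_integral_le g (b : R) :
  measurable_fun (`]0%R, +oo[%classic : set R) g ->
  (forall s, 0 < s -> `|g s| <= b * wt s) ->
  `|\int[mu]_(s in `]0, +oo[) (kap s * g s)| <= kap_mass * b.
Proof.
move=> mg gb.
have iw := integrable_abse (@kap_wt_integrable R).
apply: le_trans (le_normr_Rintegral _ _) _ => //; first exact: (kap_integrable_dominated mg gb).
rewrite /kap_mass mulrC -RintegralZl//.
apply: le_Rintegral => //.
- by have := integrable_abse (kap_integrable_dominated mg gb); apply: eq_integrable.
- by apply: integrableZ => //; apply: eq_integrable iw.
- move=> s /=; rewrite in_itv/= andbT => s0.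
  rewrite !normrM [`|wt s|]ger0_norm ?(le_trans ler01) ?wt_ge1//.
  by rewrite mulrCA ler_wpM2l// gb.
Qed.

Lemma kap_mass_ge0 : 0 <= kap_mass.
Proof. exact: Rintegral_ge0. Qed.

Variable eps : R.

(** In the variable [z = eps ln x], dilating [x] by [s] is translating [z] by [eps ln s]. *)
Definition conv phi (z : R) : R := \int[mu]_(s in `]0, +oo[) (kap s * phi (z + eps * ln s)).

Lemma conv_measurable phi z : continuous phi ->
  measurable_fun (`]0%R, +oo[%classic : set R) (fun s => phi (z + eps * ln s)).
Proof.
move=> cp; apply: measurable_funTS.
apply: measurableT_comp; first exact: continuous_measurable_fun.
by apply: measurable_funD => //; apply: measurable_funM => //; exact: measurable_ln.
Qed.

Lemma wt_scale_ge (b s : R) : 0 <= b -> b <= b * wt s.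
Proof. by move=> b0; rewrite ler_peMr// wt_ge1. Qed.

Lemma conv_integrable phi z (b : R) : continuous phi -> (forall y, `|phi y| <= b) ->
  mu.-integrable `]0, +oo[ (fun s => (kap s * phi (z + eps * ln s))%:E).
Proof.
move=> cp pb; apply: (kap_integrable_dominated (b := b)); first exact: conv_measurable.
by move=> s _; apply: le_trans (pb _) _; apply: wt_scale_ge; apply: le_trans (pb 0).
Qed.

Lemma conv_le phi z (b : R) : continuous phi -> (forall y, `|phi y| <= b) ->
  `|conv phi z| <= kap_mass * b.
Proof.
move=> cp pb; apply: kap_integral_le; first exact: conv_measurable.
by move=> s _; apply: le_trans (pb _) _; apply: wt_scale_ge; apply: le_trans (pb 0).
Qed.

Lemma conv_sub_le phi psi z (b B : R) : continuous phi -> continuous psi ->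
  (forall y, `|phi y| <= B) -> (forall y, `|psi y| <= B) ->
  (forall y, `|phi y - psi y| <= b) ->
  `|conv phi z - conv psi z| <= kap_mass * b.
Proof.
move=> cp cq pB qB pqb; rewrite /conv -RintegralB//; try exact: conv_integrable.
have -> : \int[mu]_(s in `]0%R, +oo[) (kap s * phi (z + eps * ln s) - kap s * psi (z + eps * ln s)) = conv (phi - psi) z.
  by apply: eq_Rintegral => s _; rewrite mulrBr.
apply: conv_le => //.
by move=> x; apply: cvgB; [exact: cp|exact: cq].
Qed.

Lemma conv_shift phi z y : conv phi (z + y) = conv (fun x => phi (x + y)) z.
Proof. by apply: eq_Rintegral => s _; rewrite addrAC. Qed.

Lemma conv_continuous phi (b : R) : continuous phi -> (forall y, `|phi y| <= b) ->
  continuous (conv phi).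
Proof.
move=> cp pb z.
have b0 : 0 <= b by apply: le_trans (pb 0).
have zI : z \in `]z - 1, z + 1[%classic by rewrite inE/= in_itv/=; apply/andP; split; lra.
have H := @continuity_under_integral R _ (measurableTypeR R) mu
  (fun z s => kap s * phi (z + eps * ln s)) `]0, +oo[ _ (z - 1) (z + 1) _ _ (fun s => b * `|kap s * wt s|) _ _.
apply: H zI => //.
- by move=> x _; exact: (conv_integrable _ cp pb).
- apply: aeW => s _ x _; apply: cvgM; first exact: cvg_cst.
  apply: (@continuous_comp _ _ _ (fun x => x + eps * ln s) phi); last exact: cp.
  by apply: cvgD; [exact: cvg_id|exact: cvg_cst].
- apply: integrableZ => //.
  have := integrable_abse (@kap_wt_integrable R); apply: eq_integrable => //.
- move=> x _; apply: aeW => s _.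
  rewrite !normrM [`|wt s|]ger0_norm ?(le_trans ler01) ?wt_ge1//.
  by rewrite mulrCA ler_wpM2l// (le_trans (pb _))// wt_scale_ge.
Qed.

Lemma powRN_le_wt (a s : R) : 0 <= a <= 1/2 -> 0 < s -> s `^ (- a) <= wt s.
Proof.
move=> /andP[a0 a1] s0; have := powR_ge0 s (- (1/2)); rewrite /wt => h.
case: (leP 1 s) => s1.
  suff : s `^ (- a) <= 1 by lra.
  by rewrite -[X in _ <= X](powRr0 s) ler_powR//; lra.
suff : s `^ (- a) <= s `^ (- (1/2)) by lra.
by apply: ger_powR; [rewrite s0 ltW|lra].
Qed.

(** The translation by [eps ln s] turns [e^(-a z)] into [e^(-a z) s^(-a eps)], and the last factor
    is below [wt s] as long as [a eps <= 1/2]. Convolution thus keeps an exponential rate. *)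
Lemma conv_decay phi z (a b : R) : continuous phi -> 0 <= a -> 0 <= a * eps <= 1/2 ->
  (forall y, `|phi y| <= b * expR (- (a * y))) ->
  `|conv phi z| <= kap_mass * b * expR (- (a * z)).
Proof.
move=> cp a0 ae pb; rewrite -mulrA; apply: kap_integral_le; first exact: conv_measurable.
move=> s s0; apply: le_trans (pb _) _; rewrite -mulrA ler_wpM2l//.
  have := le_trans (normr_ge0 _) (pb 0); rewrite mulr0 oppr0 expR0 mulr1//.
rewrite mulrDr opprD expRD ler_wpM2l ?expR_ge0//.
have -> : expR (- (a * (eps * ln s))) = s `^ (- (a * eps)).
  by rewrite /powR gt_eqF// mulrA mulNr.
exact: powRN_le_wt.
Qed.

End Convolution.

(** * The profile equation *)

Section LinearSolver.
Context {R : realType}.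
Implicit Types (f g k : R -> R).

Lemma cvg0_dominated {T : Type} {F : set_system T} {FF : Filter F} (f g : T -> R) (c : R) :
  (\forall x \near F, `|f x| <= c * `|g x|) -> g x @[x --> F] --> 0 -> f x @[x --> F] --> 0.
Proof.
move=> fg g0; apply: norm_cvg0.
have h : c * `|g x| @[x --> F] --> c * `|0 : R|.
  by apply: cvgM; [exact: cvg_cst|exact: cvg_norm].
rewrite normr0 mulr0 in h.
apply: (@squeeze_cvgr _ _ _ _ (cst 0) _ _ _ _ _ h); last exact: cvg_cst.
by apply: filterS fg => x ->; rewrite normr_ge0.
Qed.

Lemma continuous_W : continuous (@W R).
Proof. exact: derive1_continuous is_derive_W. Qed.

Lemma is_derive_Th (x : R) : is_derive x 1 Th (2 * W x ^+ 2).
Proof.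
have := is_deriveM (is_deriveB (is_derive_exphalf x) (is_derive_exphalfN x)) (is_derive_W x).
move=> /is_derive_eq; apply.
have := W_denom x; have := Th_sqr x; rewrite /Th /GRing.scale/= !fctE.
move: (expR (x / 2)) (expR (- (x / 2))) (W x) => a b w h1 h2.
have -> : (a - b) * (- (1 / 2) * ((a - b) * w) * w) + w * (a / 2 - - (b / 2)) =
  - (1 / 2) * ((a - b) * w) ^+ 2 + ((a + b) * w) / 2 by field.
by rewrite h1 h2; field.
Qed.

Lemma continuous_Th : continuous (@Th R).
Proof. exact: derive1_continuous is_derive_Th. Qed.

Lemma signed_integralB f g x : continuous f -> continuous g ->
  signed_integral (f - g) x = signed_integral f x - signed_integral g x.
Proof.
move=> cf cg.
have cfg : continuous (f - g) by move=> y; apply: cvgB; [exact: cf|exact: cg].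
pose F := signed_integral (f - g) - (signed_integral f - signed_integral g).
have dF y : is_derive y (1 : R) F 0.
  rewrite -(subrr ((f - g) y)); apply: is_deriveB; first exact: signed_integral_derive.
  by apply: is_deriveB; exact: signed_integral_derive.
have := derive_0_const dF x 0.
by rewrite /F !fctE !signed_integral0 !subrr => /eqP; rewrite subr_eq0 => /eqP.
Qed.

Lemma tailB f g (c d : R) x : continuous f -> continuous g ->
  (forall z, `|f z| <= c * W z) -> (forall z, `|g z| <= d * W z) ->
  tail (f - g) x = tail f x - tail g x.
Proof.
move=> cf cg fc gd.
have cfg : continuous (f - g) by move=> y; apply: cvgB; [exact: cf|exact: cg].
have cv (h : R -> R) (e : R) : continuous h -> (forall z, `|h z| <= e * W z) -> cvg (signed_integral h y @[y --> +oo]).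
  move=> ch he; have e0 : 0 <= e.
    by rewrite -(@pmulr_lge0 _ (W 0)) ?W_gt0//; apply: le_trans (he 0).
  apply: (@signed_integral_cvg R h (e *: SW) (fun z => e * W z) (e * 4)) => //.
    by move=> z; apply: is_deriveZ; exact: is_derive_SW.
  by move=> z; rewrite /GRing.scale/= ler_wpM2l//; have /andP[_ /ltW] := SW_bounds z.
rewrite /tail signed_integralB//.
have -> : lim (signed_integral (f - g) y @[y --> +oo]) =
  lim (signed_integral f y @[y --> +oo]) - lim (signed_integral g y @[y --> +oo]).
  rewrite -limB; [|exact: cv fc|exact: cv gd].
  by have -> : signed_integral (f - g) = signed_integral f - signed_integral g by apply/funext => y; rewrite signed_integralB.
by ring.
Qed.

Lemma tail_spec g (a : R) : continuous g -> (forall z, `|g z| <= a * W z) ->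
  [/\ forall x : R, is_derive x 1 (tail g) (- g x),
      tail g x @[x --> +oo] --> 0 & forall x, `|tail g x| <= 4 * a].
Proof.
move=> cg ga; have a0 : 0 <= a.
  by rewrite -(@pmulr_lge0 _ (W 0)) ?W_gt0//; apply: le_trans (ga 0).
have dS (z : R) : is_derive z 1 (a *: SW) (a * W z) by apply: is_deriveZ; exact: is_derive_SW.
have Sb z : (a *: SW) z <= 4 * a.
  by rewrite mulrC /GRing.scale/= ler_wpM2l//; have /andP[_ /ltW] := SW_bounds z.
have dt := tail_derive cg; have t0 := tail_cvg cg dS ga Sb.
split=> // x.
have := @le_tail R _ _ _ _ _ dt dS _ Sb t0 x; rewrite /= => H.
apply: le_trans (H _) _; first by move=> y; rewrite normrN.
by rewrite lerBlDr lerDl mulr_ge0//; have /andP[/ltW] := SW_bounds x.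
Qed.

(** This is [Th h - tail g - f], expanded, where [h] is the solution of the linearised equation with
    [h 0 = 0]. At [-oo] neither [Th h] nor [tail g] need decay, only their difference does; the
    identity [W^2 Bw = Th + 2 z W^2] merges them into the first coefficient, which is [O(W)]. *)
Definition lin g f (z : R) : R :=
  - (4 * W z ^+ 2 - 2 * z * W z ^+ 2 * Th z) * tail g z
  + Th z * W z ^+ 2 * signed_integral (fun x => g x * Bw x + f x / W x ^+ 2) z - f z.

Lemma continuous_lin_integrand g f : continuous g -> continuous f ->
  continuous (fun x => g x * Bw x + f x / W x ^+ 2).
Proof.
move=> cg cf x; apply: cvgD; apply: cvgM; [exact: cg| |exact: cf|].
  exact: (derive1_continuous is_derive_Bw).
apply: cvgV; first by rewrite expf_neq0// gt_eqF ?W_gt0.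
exact: (continuous_comp (continuous_W (x:=x)) (@exprn_continuous _ 2 _)).
Qed.

Lemma continuous_lin g f : continuous g -> continuous f -> continuous (lin g f).
Proof.
move=> cg cf x.
have cW2 : {for x, continuous (fun x => W x ^+ 2)}.
  exact: (continuous_comp (continuous_W (x:=x)) (@exprn_continuous _ 2 _)).
apply: cvgB; last exact: cf.
apply: cvgD; apply: cvgM.
- apply: cvgN; apply: cvgB; first by apply: cvgM; [exact: cvg_cst|exact: cW2].
  apply: cvgM; last exact: continuous_Th.
  by apply: cvgM; [apply: cvgM; [exact: cvg_cst|exact: cvg_id]|exact: cW2].
- exact: (derive1_continuous (tail_derive cg)).
- by apply: cvgM; [exact: continuous_Th|exact: cW2].
- exact: (derive1_continuous (signed_integral_derive (continuous_lin_integrand cg cf))).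
Qed.

(** The integrand is at most [(3 a + b) / W], and [1 / W = 2 cosh (x/2)] has an explicit
    primitive. *)
Lemma signed_integral_lin_le g f (a b : R) z : continuous g -> continuous f ->
(forall z, `|g z| <= a * W z) -> (forall z, `|f z| <= b * W z) ->
`|signed_integral (fun x => g x * Bw x + f x / W x ^+ 2) z| <= 2 * (3 * a + b) / W z.
Proof.
move=> cg cf ga fb; have w0 := W_gt0 z.
have a0 : 0 <= a by rewrite -(@pmulr_lge0 _ (W 0)) ?W_gt0//; apply: le_trans (ga 0).
have b0 : 0 <= b by rewrite -(@pmulr_lge0 _ (W 0)) ?W_gt0//; apply: le_trans (fb 0).
pose S (x : R) := (2 * (3 * a + b)) * (expR (x / 2) - expR (- (x / 2))).
have dS (x : R) : is_derive x 1 S ((3 * a + b) / W x).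
  have := is_deriveZ (2 * (3 * a + b)) (is_deriveB (is_derive_exphalf x) (is_derive_exphalfN x)).
  by move=> /is_derive_eq; apply; rewrite /W /GRing.scale/= invrK; field.
have bd x : `|g x * Bw x + f x / W x ^+ 2| <= (3 * a + b) / W x.
  have w0x := W_gt0 x.
  rewrite mulrDl; apply: le_trans (ler_normD _ _) _; apply: lerD.
    rewrite normrM; apply: le_trans (ler_pM _ _ (ga x) (Bw_le x)) _ => //.
    by rewrite le_eqVlt; apply/orP; left; apply/eqP; field; rewrite gt_eqF.
  rewrite normrM normrV ?unitfE ?expf_neq0 ?gt_eqF//.
  rewrite [X in _ / X]ger0_norm ?sqr_ge0// ler_pdivrMr ?exprn_gt0//.
  apply: le_trans (fb x) _; rewrite le_eqVlt; apply/orP; left; apply/eqP; field.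
  by rewrite gt_eqF.
have dI := signed_integral_derive (continuous_lin_integrand cg cf).
have S0 : S 0 = 0 by rewrite /S mul0r oppr0 subrr mulr0.
have h : `|signed_integral (fun x => g x * Bw x + f x / W x ^+ 2) z| <= `|S z|.
  case: (leP 0 z) => z0.
    have := derive_norm_le z0 dI dS bd.
    by rewrite signed_integral0 subr0 S0 subr0 => /le_trans; apply; exact: ler_norm.
  have := derive_norm_le (ltW z0) dI dS bd.
  by rewrite signed_integral0 sub0r normrN S0 sub0r => /le_trans; apply; rewrite -[`|S z|]normrN; exact: ler_norm.
apply: le_trans h _; rewrite /S normrM ger0_norm; last by lra.
rewrite ler_wpM2l//; first by lra.
rewrite /W invrK; have := expR_gt0 (z / 2); have := expR_gt0 (- (z / 2)).
by move=> *; rewrite ler_norml; apply/andP; split; lra.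
Qed.

(** The first coefficient is at most [6 W] and [|tail g| <= 4 a], which gives [24 a W]; the integral
    term gives [2 (3 a + b) W], and [f] itself [b W]. *)
Lemma lin_le g f (a b : R) z : continuous g -> continuous f ->
  (forall z, `|g z| <= a * W z) -> (forall z, `|f z| <= b * W z) ->
  `|lin g f z| <= (30 * a + 3 * b) * W z.
Proof.
move=> cg cf ga fb.
have w0 := W_gt0 z; have w1 := W_le_half z; have zw := norm_W_le z; have t1 := Th_le1 z.
have a0 : 0 <= a by rewrite -(@pmulr_lge0 _ (W 0)) ?W_gt0//; apply: le_trans (ga 0).
have b0 : 0 <= b by rewrite -(@pmulr_lge0 _ (W 0)) ?W_gt0//; apply: le_trans (fb 0).
have [_ _ tg] := tail_spec cg ga.
have c1 : `|4 * W z ^+ 2 - 2 * z * W z ^+ 2 * Th z| <= 6 * W z.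
  have h1 : `|4 * W z ^+ 2| <= 2 * W z by rewrite ger0_norm; nra.
  have h2 : `|2 * z * W z ^+ 2 * Th z| <= 4 * W z.
    rewrite (_ : 2 * z * W z ^+ 2 * Th z = (2 * W z) * (z * W z) * Th z); last by ring.
    rewrite normrM -[X in _ <= X]mulr1 ler_pM// normrM (ger0_norm (x := 2 * W z)); last by lra.
    rewrite normrM (ger0_norm (ltW w0)); nra.
  by apply: le_trans (ler_normB _ _) _; lra.
have c2 := signed_integral_lin_le z cg cf ga fb.
have h1 : `|- (4 * W z ^+ 2 - 2 * z * W z ^+ 2 * Th z) * tail g z| <= 6 * W z * (4 * a).
  by rewrite normrM normrN ler_pM.
have h2 : `|Th z * W z ^+ 2 * signed_integral (fun x => g x * Bw x + f x / W x ^+ 2) z|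
    <= 2 * (3 * a + b) * W z.
  rewrite normrM (normrM (Th z)) (ger0_norm (x := W z ^+ 2)) ?sqr_ge0//.
  have q : `|Th z| * W z ^+ 2 <= W z ^+ 2 by rewrite -[X in _ <= X]mul1r ler_wpM2r// sqr_ge0.
  have q0 : 0 <= `|Th z| * W z ^+ 2 by rewrite mulr_ge0// sqr_ge0.
  apply: le_trans (ler_pM q0 (normr_ge0 _) q c2) _.
  by rewrite le_eqVlt; apply/orP; left; apply/eqP; field; rewrite gt_eqF.
have h3 := fb z.
apply: le_trans (ler_normB _ _) _.
apply: le_trans (lerD (ler_normD _ _) (lexx _)) _.
rewrite (_ : (30 * a + 3 * b) * W z = 6 * W z * (4 * a) + 2 * (3 * a + b) * W z + b * W z); last by ring.
by rewrite !lerD.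
Qed.

(** Reduces the contraction estimate to [lin_le] applied to differences of sources. *)
Lemma linB g f g' f' (a a' : R) z :
  continuous g -> continuous f -> continuous g' -> continuous f' ->
  (forall z, `|g z| <= a * W z) -> (forall z, `|g' z| <= a' * W z) ->
  lin g f z - lin g' f' z = lin (g - g') (f - f') z.
Proof.
move=> cg cf cg' cf' ga ga'; rewrite /lin (tailB z cg cg' ga ga').
have -> : (fun x => (g - g') x * Bw x + (f - f') x / W x ^+ 2) =
  (fun x => g x * Bw x + f x / W x ^+ 2) - (fun x => g' x * Bw x + f' x / W x ^+ 2).
  by apply/funext => x; rewrite !fctE; ring.
rewrite signed_integralB; try exact: continuous_lin_integrand.
by rewrite !fctE; ring.
Qed.

Lemma W_cvg0 : @W R x @[x --> +oo] --> 0.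
Proof.
have h : expR (- (x / 2)) @[x --> +oo] --> (0 : R).
  apply: (@cvg_comp _ _ _ (fun x : R => x / 2) (fun x => expR (- x)) _ _ _ _ (cvgr_expR (R := R))).
  by apply: gt0_cvgMly => //; exact: cvg_id.
apply: (@squeeze_cvgr _ _ _ _ (cst 0) _ _ _ _ _ h); last exact: cvg_cst.
near=> x; rewrite /cst/= (ltW (W_gt0 x))/= expRN lef_pV2 ?posrE ?addr_gt0 ?expR_gt0//.
by rewrite lerDl expR_ge0.
Unshelve. all: by end_near. Qed.

Lemma tail_unique k H (c : R) : continuous k -> (forall z, `|k z| <= c * W z) ->
  (forall x : R, is_derive x 1 H (- k x)) -> H x @[x --> +oo] --> 0 -> tail k = H.
Proof.
move=> ck kc dH H0; have [dt t0 _] := tail_spec ck kc.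
have dD (x : R) : is_derive x 1 (tail k - H) 0.
  by rewrite -(subrr (- k x)); apply: is_deriveB.
have D0 : (tail k - H) x @[x --> +oo] --> 0 by rewrite -(subrr 0); apply: cvgB.
apply/funext => x; apply/eqP; rewrite -subr_eq0 -normr_le0.
have := @le_tail R (tail k - H) (cst 0) (cst 0) (cst 0) 0 dD _ _ _ D0 x; rewrite subrr; apply => //.
- by move=> y; rewrite normr0.
Qed.

Lemma Bw_W (z : R) : W z ^+ 2 * Bw z = Th z + 2 * z * W z ^+ 2.
Proof.
have -> : Bw z = (expR (z / 2) - expR (- (z / 2))) * (expR (z / 2) + expR (- (z / 2))) + 2 * z.
  by rewrite -subr_sqr -!expRM_natl /Bw; congr (expR _ - expR _ + _); field.
have := W_denom z; rewrite /Th; move: (expR (z / 2)) (expR (- (z / 2))) (W z) => a b w h.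
rewrite (_ : _ * _ = (a - b) * w * ((a + b) * w) + 2 * z * w ^+ 2); last by ring.
by rewrite h mulr1.
Qed.

(* With [h := W^2 (B tail g + I)], [I] the integral in [lin], [lin g f = - h'] and
   [h' = - Th h + tail g + f]. *)
Lemma lin_solves g f (a b : R) : continuous g -> continuous f ->
  (forall z, `|g z| <= a * W z) -> (forall z, `|f z| <= b * W z) ->
  tail (lin g f) = fun z => W z ^+ 2 * (Bw z * tail g z +
    signed_integral (fun x => g x * Bw x + f x / W x ^+ 2) z).
Proof.
move=> cg cf ga fb.
have a0 : 0 <= a by rewrite -(@pmulr_lge0 _ (W 0)) ?W_gt0//; apply: le_trans (ga 0).
have b0 : 0 <= b by rewrite -(@pmulr_lge0 _ (W 0)) ?W_gt0//; apply: le_trans (fb 0).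
have [dt t0 tb] := tail_spec cg ga.
have dI := signed_integral_derive (continuous_lin_integrand cg cf).
set I := signed_integral _ in dI *.
apply: (tail_unique (c := 30 * a + 3 * b)); first exact: continuous_lin.
- by move=> z; exact: lin_le.
- move=> z.
  have dW2 : is_derive z (1 : R) (fun z => W z ^+ 2) (- Th z * W z ^+ 2).
    have := is_deriveX 2 (is_derive_W z); move=> /is_derive_eq; apply.
    by rewrite /GRing.scale/= ?expr1; field.
  have := is_deriveM dW2 (is_deriveD (is_deriveM (is_derive_Bw z) (dt z)) (dI z)).
  move=> /is_derive_eq; apply; rewrite /GRing.scale/= !fctE /lin -/I.
  have := Bw_W z; have := Th_sqr z; have := W_gt0 z.
  move: (Th z) (W z) (Bw z) (tail g z) (g z) (f z) (I z) => t w B T gz fz i w0 h1 h2.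
  have wn : w != 0 by rewrite gt_eqF.
  rewrite (_ : _ + _ = T + fz - t * (w ^+ 2 * B) * T - t * w ^+ 2 * i); last by field.
  by rewrite h2 mulrDr -expr2 h1; ring.
- have h : W z ^+ 2 * Bw z * tail g z + W z ^+ 2 * I z @[z --> +oo] --> 0 + 0.
    apply: cvgD.
      apply: (cvg0_dominated (c := 3) _ t0); apply: nearW => z.
      rewrite normrM ler_wpM2r// normrM ger0_norm ?sqr_ge0// mulrC -ler_pdivlMr ?exprn_gt0 ?W_gt0//.
      exact: Bw_le.
    apply: (cvg0_dominated (c := 2 * (3 * a + b)) _ W_cvg0); apply: nearW => z.
    rewrite normrM (ger0_norm (sqr_ge0 _)) (ger0_norm (ltW (W_gt0 z))).
    apply: le_trans (ler_wpM2l (sqr_ge0 _) (signed_integral_lin_le z cg cf ga fb)) _.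
    by rewrite le_eqVlt; apply/orP; left; apply/eqP; field; rewrite gt_eqF ?W_gt0.
  rewrite addr0 in h; apply: cvg_trans h; apply: near_eq_cvg; near=> z.
  by ring.
Unshelve. all: by end_near. Qed.

End LinearSolver.

(** * A contraction principle in a weighted norm *)

Section FixedPoint.
Context {R : realType}.
Implicit Types (k l w : R -> R).

(** Banach's theorem for the norm [sup |k| / w] with ratio [1/2], stated pointwise so that no
    function space has to be built. The last hypothesis is the closedness of [P], asked only for
    limits at a geometric rate. *)
Lemma contraction_fixed_point (P : (R -> R) -> Prop) (T : (R -> R) -> R -> R) w (k0 : R -> R) (b : R) :
  (forall z, 0 <= w z) -> P k0 -> (forall k, P k -> P (T k)) ->
  (forall z, `|T k0 z - k0 z| <= b * w z) ->
  (forall k l d, P k -> P l -> (forall z, `|k z - l z| <= d * w z) ->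
    forall z, `|T k z - T l z| <= d / 2 * w z) ->
  (forall (u : nat -> R -> R) k d, (forall n, P (u n)) ->
    (forall n z, `|u n z - k z| <= d / 2 ^+ n * w z) -> P k) ->
  exists2 k, P k & T k = k.
Proof.
move=> w0 Pk0 TP Tb Tc Pl.
pose u n := iter n T k0.
have Pu n : P (u n) by elim: n => //= n; exact: TP.
have du n z : `|u n.+1 z - u n z| <= b / 2 ^+ n * w z.
  elim: n z => [|n IH] z; first by rewrite expr0 divr1; exact: Tb.
  have := Tc _ _ _ (Pu n.+1) (Pu n) IH z.
  by rewrite exprSr invfM mulrA.
have bw z : 0 <= b * w z by apply: le_trans (Tb z).
(* Keeping the exact value of the geometric sum, and not just its bound, lets the induction on [m]
   close. *)
have dum m n z : `|u (n + m)%N z - u n z| <= 2 * b / 2 ^+ n * w z - 2 * b / 2 ^+ (n + m) * w z.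
  elim: m => [|m IH]; first by rewrite addn0 !subrr normr0.
  rewrite addnS (_ : _ - _ = (u (n + m).+1 z - u (n + m)%N z) + (u (n + m)%N z - u n z)); last by ring.
  apply: le_trans (ler_normD _ _) _; apply: le_trans (lerD (du _ z) IH) _.
  rewrite exprS; set q := 2 ^+ (n + m).
  have q0 : q != 0 by rewrite expf_neq0.
  by rewrite le_eqVlt; apply/orP; left; apply/eqP; field; rewrite q0 expf_neq0.
have dum' m n z : `|u (n + m)%N z - u n z| <= 2 * b / 2 ^+ n * w z.
  apply: le_trans (dum m n z) _; rewrite lerBlDr lerDl.
  by rewrite mulrAC mulr_ge0 ?invr_ge0 ?exprn_ge0// -mulrA mulr_ge0.
have cu z : cvgn (u ^~ z).
  apply/cauchy_cvgP/cauchy_exP => e e0.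
  have h0 : 2 * b * w z / 2 ^+ n @[n --> \oo] --> 0.
    have := @cvg_geometric R (2 * b * w z) 2^-1; rewrite ger0_norm// => /(_ _).
    rewrite invf_lt1 ?ltr1n// => /(_ isT) h; apply: cvg_trans h.
    by apply: near_eq_cvg; near=> n; rewrite /geometric/= exprVn.
  have /cvgr0Pnorm_lt/(_ (e / 2)) := h0; rewrite divr_gt0// => /(_ isT)[N _ HN].
  have HN' : `|2 * b * w z / 2 ^+ N| < e / 2 by apply: HN => /=.
  have b1 n : (N <= n)%N -> `|u n z - u N z| < e / 2.
    move=> Nn; rewrite -(subnKC Nn); apply: le_lt_trans (dum' _ _ _) _.
    by apply: le_lt_trans HN'; rewrite mulrAC ler_norm.
  exists (u N z); exists N => //= n Nn; rewrite /ball/= distrC.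
  by apply: lt_le_trans (b1 n Nn) _; rewrite ler_pdivrMr// ler_peMr ?(ltW e0)// ler1n.
pose k z := limn (u ^~ z).
have uk n z : `|u n z - k z| <= 2 * b / 2 ^+ n * w z.
  have h : `|u n z - u m z| @[m --> \oo] --> `|u n z - k z|.
    by apply: cvg_norm; apply: cvgB; [exact: cvg_cst|exact: cu].
  apply: (cvgr_to_le h); near=> m.
  have nm : (n <= m)%N by near: m; exact: nbhs_infty_ge.
  by rewrite distrC -(subnKC nm).
have Pk : P k by exact: Pl uk.
exists k => //; apply/funext => z; apply/eqP; rewrite -subr_eq0 -normr_le0.
have h1 n : `|T k z - k z| <= 2 * b * w z / 2 ^+ n.
  have a1 := Tc _ _ _ Pk (Pu n) (fun z => _) z.
  have a2 : forall z, `|k z - u n z| <= 2 * b / 2 ^+ n * w z by move=> y; rewrite distrC.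
  have {a1} := a1 _ a2.
  have := uk n.+1 z; rewrite -[u n.+1]/(T (u n)) => h2 h1.
  rewrite (_ : _ - _ = (T k z - T (u n) z) + (T (u n) z - k z)); last by ring.
  apply: le_trans (ler_normD _ _) _; apply: le_trans (lerD h1 h2) _.
  rewrite exprS le_eqVlt; apply/orP; left; apply/eqP.
  have q0 : (2 : R) ^+ n != 0 by rewrite expf_neq0.
  by field; rewrite q0.
have h0 : 2 * b * w z / 2 ^+ n @[n --> \oo] --> 0.
  have := @cvg_geometric R (2 * b * w z) 2^-1; rewrite ger0_norm// => /(_ _).
  rewrite invf_lt1 ?ltr1n// => /(_ isT) h; apply: cvg_trans h.
  by apply: near_eq_cvg; near=> n; rewrite /geometric/= exprVn.
by apply: (cvgr_to_ge h0); near=> n.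
Unshelve. all: by end_near. Qed.

End FixedPoint.

(** * Contraction around the logistic solution *)

Section Profile.
Context {R : realType}.
Variables eps dl : R.
Hypothesis eps_gt0 : 0 < eps.
Hypothesis dl_gt0 : 0 < dl.
Hypothesis dl_small : 480 * dl <= 1/4.
Let M : R := kap_mass.
Hypothesis eps_small : eps * (60 * (M + 1)) <= dl.
Implicit Types (k l : R -> R).

Definition prof_phi k (z : R) : R := W z ^+ 2 + k z.
Definition prof_p k (z : R) : R := (1 - Th z) / 2 + tail k z.
Definition prof_v k (z : R) : R := prof_p k z + eps / 2 * conv eps (prof_phi k) z.
(** Put [phi = W^2 + k] and [p = (1 - Th)/2 + h], [h = tail k], into [phi (1 - 2 eps v) = p - p^2 -
    eps tail (conv phi)], the product with [phi] being understood inside the tail. As [W^2] solves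
    the equation at [eps = 0], what is left is [k = Th h - tail g - f]: [g] collects [h^2] and the
    nonlocal term, both written as tails, and [f] is the term [- 2 eps v phi]. *)
Definition prof_g k (z : R) : R :=
  2 * tail k z * k z + eps * (conv eps (prof_phi k) z * prof_phi k z).
Definition prof_f k (z : R) : R := - 2 * eps * prof_v k z * prof_phi k z.
Definition prof_step k : R -> R := lin (prof_g k) (prof_f k).
Definition prof_class k := continuous k /\ forall z, `|k z| <= dl * W z.

Let M0 : 0 <= M. Proof. exact: kap_mass_ge0. Qed.
Let eM0 : 0 <= eps * M. Proof. by rewrite mulr_ge0// ltW. Qed.
Let eMs : 60 * (eps * M) + 60 * eps <= dl.
Proof. by have -> : 60 * (eps * M) + 60 * eps = eps * (60 * (M + 1)) by ring. Qed.
Let dl2 : 480 * (dl * dl) <= 1/4 * dl.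
Proof. by rewrite mulrA ler_wpM2r// ltW. Qed.

Lemma prof_bounds k : prof_class k ->
  [/\ continuous (prof_phi k), continuous (tail k), continuous (conv eps (prof_phi k)),
      continuous (prof_v k) & [/\
      (forall z, `|prof_phi k z| <= W z), (forall z, `|tail k z| <= 4 * dl),
      (forall z, `|conv eps (prof_phi k) z| <= M / 2) & (forall z, `|prof_v k z| <= 3)]].
Proof.
move=> [ck kb].
have [dt t0 tb] := tail_spec ck kb.
have ct : continuous (tail k) by exact: derive1_continuous dt.
have cphi : continuous (prof_phi k).
  move=> x; apply: cvgD; last exact: ck.
  exact: (continuous_comp (continuous_W (x:=x)) (@exprn_continuous _ 2 _)).
have pb z : `|prof_phi k z| <= W z.
  have := kb z; have := W_gt0 z; have := W_le_half z; rewrite !ler_norml /prof_phi => w1 w0.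
  have : dl * W z <= 1/4 * W z by rewrite ler_wpM2r ?(ltW w0)//; move: dl_small dl_gt0; lra.
  by move=> dw /andP[k1 k2]; apply/andP; split; nra.
have pb2 z : `|prof_phi k z| <= 1/2 by apply: le_trans (pb z) (W_le_half z).
have cc : continuous (conv eps (prof_phi k)) by exact: conv_continuous pb2.
have cb z : `|conv eps (prof_phi k) z| <= M / 2.
  by have := conv_le eps z cphi pb2; rewrite -/M mulrA mulr1.
have cv : continuous (prof_v k).
  move=> x; apply: cvgD; last by apply: cvgM; [exact: cvg_cst|exact: cc].
  apply: cvgD; last exact: ct.
  by apply: cvgM; [apply: cvgB; [exact: cvg_cst|exact: continuous_Th]|exact: cvg_cst].
split=> //; split => // z.
have h1 := Th_le1 z; have h2 := tb z.
have h3 : `|eps / 2 * conv eps (prof_phi k) z| <= 1.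
  rewrite normrM ger0_norm; last by rewrite divr_ge0// ltW.
  have := cb z; move: eMs eps_gt0 eM0 dl_small dl_gt0 => *.
  have : eps / 2 * `|conv eps (prof_phi k) z| <= eps / 2 * (M / 2) by rewrite ler_wpM2l// divr_ge0// ltW.
  lra.
rewrite /prof_v /prof_p; move: h1 h2 h3; rewrite !ler_norml.
by move=> /andP[? ?] /andP[? ?] /andP[? ?]; move: dl_small dl_gt0 => *; apply/andP; split; lra.
Qed.

Lemma prof_gf_bounds k : prof_class k ->
  [/\ continuous (prof_g k), continuous (prof_f k),
      (forall z, `|prof_g k z| <= (8 * (dl * dl) + eps * M) * W z) &
      (forall z, `|prof_f k z| <= 6 * eps * W z)].
Proof.
move=> Pk; have [cphi ct cc cv [pb tb cb vb]] := prof_bounds Pk.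
have [ck kb] := Pk; split.
- move=> x; apply: cvgD; apply: cvgM; [|exact: ck|exact: cvg_cst|].
    by apply: cvgM; [exact: cvg_cst|exact: ct].
  by apply: cvgM; [exact: cc|exact: cphi].
- move=> x; apply: cvgM; last exact: cphi.
  by apply: cvgM; [exact: cvg_cst|exact: cv].
- move=> z; rewrite mulrDl; apply: le_trans (ler_normD _ _) _; apply: lerD.
    rewrite (_ : 8 * (dl * dl) * W z = 2 * (4 * dl) * (dl * W z)); last by field.
    by rewrite normrM ler_pM// normrM ger0_norm// ler_wpM2l.
  rewrite -mulrA normrM (gtr0_norm eps_gt0) ler_wpM2l ?(ltW eps_gt0)//.
  rewrite normrM ler_pM//; apply: le_trans (cb z) _; move: M0; lra.
- move=> z; rewrite (_ : 6 * eps * W z = 2 * eps * 3 * W z); last by ring.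
  rewrite normrM ler_pM// normrM mulNr normrN (gtr0_norm (x := 2 * eps)) ?mulr_gt0//.
  by rewrite ler_wpM2l// mulr_ge0// ltW.
Qed.

(** By [lin_le] the claim is [30 (8 dl^2 + eps M) + 18 eps <= dl]: the quadratic part is small by
    [dl_small], the rest by [eps_small]. *)
Lemma prof_step_class k : prof_class k -> prof_class (prof_step k).
Proof.
move=> Pk; have [cg cf gb fb] := prof_gf_bounds Pk.
split; first exact: continuous_lin.
move=> z; apply: le_trans (lin_le z cg cf gb fb) _.
rewrite ler_wpM2r ?(ltW (W_gt0 z))//; move: eMs eps_gt0 eM0 dl2 dl_small dl_gt0; lra.
Qed.

Lemma norm_prodB_le (a b c e A B C E : R) : `|a| <= A -> `|e| <= E -> `|a - c| <= C -> `|b - e| <= B ->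
  `|a * b - c * e| <= A * B + C * E.
Proof.
move=> h1 h2 h3 h4; rewrite (_ : _ - _ = a * (b - e) + (a - c) * e); last by ring.
by apply: le_trans (ler_normD _ _) _; rewrite !normrM lerD// ler_pM.
Qed.

(** The Lipschitz constant found is [480 dl + 60 eps M + 48 eps]; the numbers [480] and [60] of the
    smallness hypotheses come from here. *)
Lemma prof_step_contract k l (d : R) : prof_class k -> prof_class l ->
  (forall z, `|k z - l z| <= d * W z) ->
  forall z, `|prof_step k z - prof_step l z| <= d / 2 * W z.
Proof.
move=> Pk Pl kl z.
have [cphi ct cc cv [pb tb cb vb]] := prof_bounds Pk.
have [cphi' ct' cc' cv' [pb' tb' cb' vb']] := prof_bounds Pl.
have [cg cf gb fb] := prof_gf_bounds Pk.
have [cg' cf' gb' fb'] := prof_gf_bounds Pl.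
have [ck kb] := Pk; have [cl lb] := Pl.
have d0 : 0 <= d by rewrite -(@pmulr_lge0 _ (W 0)) ?W_gt0//; apply: le_trans (kl 0).
have ckl : continuous (k - l) by move=> x; apply: cvgB; [exact: ck|exact: cl].
have dt y : `|tail k y - tail l y| <= 4 * d.
  rewrite -(tailB y ck cl kb lb).
  by have [_ _] := tail_spec ckl kl; apply.
have dphi y : `|prof_phi k y - prof_phi l y| <= d * W y.
  have -> : prof_phi k y - prof_phi l y = k y - l y by rewrite /prof_phi; ring.
  exact: kl.
have W2 (y : R) : W y <= 1/2 := W_le_half y.
have dconv y : `|conv eps (prof_phi k) y - conv eps (prof_phi l) y| <= M * d.
  have -> : M * d = M * (2 * d * (1/2)) by field.
  apply: (@conv_sub_le R eps (prof_phi k) (prof_phi l) y (2 * d * (1/2)) (1/2)) => // x.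
  - by apply: le_trans (pb x) _.
  - by apply: le_trans (pb' x) _.
  - apply: le_trans (dphi x) _; have := W_gt0 x; have := W2 x; nra.
have dv y : `|prof_v k y - prof_v l y| <= 5 * d.
  rewrite /prof_v /prof_p (_ : _ - _ = (tail k y - tail l y) + eps / 2 * (conv eps (prof_phi k) y - conv eps (prof_phi l) y)); last by ring.
  apply: le_trans (ler_normD _ _) _.
  rewrite (_ : 5 * d = 4 * d + d); last by ring.
  rewrite lerD// normrM ger0_norm; last by rewrite divr_ge0// ltW.
  apply: le_trans (ler_wpM2l _ (dconv y)) _; first by rewrite divr_ge0// ltW.
  have -> : eps / 2 * (M * d) = (eps * M / 2) * d by field.
  rewrite -[X in _ <= X]mul1r ler_wpM2r//; move: eMs eps_gt0 eM0 dl_small dl_gt0; lra.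
rewrite /prof_step (linB z cg cf cg' cf' gb gb').
have dg y : `|(prof_g k - prof_g l) y| <= (16 * dl + 2 * (eps * M)) * d * W y.
  rewrite !fctE /prof_g opprD addrACA.
  rewrite (_ : _ * W y = (16 * dl * d * W y) + eps * (2 * M * d * W y)); last by ring.
  apply: le_trans (ler_normD _ _) _; apply: lerD.
    rewrite (_ : _ * W y = (8 * dl) * (d * W y) + (8 * d) * (dl * W y)); last by field.
    apply: norm_prodB_le => //.
      by rewrite normrM ger0_norm//; have := tb y; lra.
    rewrite -mulrBr normrM ger0_norm//; have := dt y; lra.
  rewrite -mulrBr normrM (gtr0_norm eps_gt0) ler_wpM2l ?(ltW eps_gt0)//.
  apply: le_trans (norm_prodB_le (cb y) (pb' y) (dconv y) (dphi y)) _.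
  have : 0 <= M * d * W y by rewrite !mulr_ge0// ltW ?W_gt0.
  lra.
have df y : `|(prof_f k - prof_f l) y| <= 16 * eps * d * W y.
  rewrite !fctE /prof_f -!mulrA -mulrBr mulNr normrN normrM ger0_norm//.
  rewrite -mulrBr normrM (gtr0_norm eps_gt0).
  rewrite (_ : 16 * _ = 2 * (eps * (3 * (d * W y) + 5 * d * W y))); last by ring.
  rewrite !ler_wpM2l ?(ltW eps_gt0)//.
  exact: norm_prodB_le.
have cgg : continuous (prof_g k - prof_g l) by move=> x; apply: cvgB; [exact: cg|exact: cg'].
have cff : continuous (prof_f k - prof_f l) by move=> x; apply: cvgB; [exact: cf|exact: cf'].
apply: le_trans (lin_le z cgg cff dg df) _.
rewrite ler_wpM2r ?(ltW (W_gt0 z))//.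
rewrite (_ : _ + _ = (30 * (16 * dl + 2 * (eps * M)) + 48 * eps) * d); last by ring.
rewrite mulrC ler_wpM2l//; move: eMs eps_gt0 eM0 dl2 dl_small dl_gt0; lra.
Qed.

Lemma prof_class_lim (u : nat -> R -> R) k (d : R) : (forall n, prof_class (u n)) ->
  (forall n z, `|u n z - k z| <= d / 2 ^+ n * W z) -> prof_class k.
Proof.
move=> Pu uk.
have h0 (e : R) : e / 2 ^+ n @[n --> \oo] --> 0.
  have := @cvg_geometric R e 2^-1; rewrite ger0_norm// => /(_ _).
  rewrite invf_lt1 ?ltr1n// => /(_ isT) h; apply: cvg_trans h.
  by apply: near_eq_cvg; near=> n; rewrite /geometric/= exprVn.
split.
- move=> x; apply/cvgrPdist_lt => /= e e0.
  have /cvgr0Pnorm_lt/(_ (e / 3)) := h0 `|d|; rewrite divr_gt0// => /(_ isT)[n _ /(_ n (leqnn n)) Hn].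
  have Hn' y : `|u n y - k y| < e / 3.
    apply: le_lt_trans Hn; apply: le_trans (uk n y) _.
    rewrite normrM normr_id [`| _^-1|]ger0_norm ?invr_ge0 ?exprn_ge0//.
    have := W_gt0 y; have := W_le_half y; have := ler_norm d.
    have : 0 < (2 ^+ n : R)^-1 by rewrite invr_gt0 exprn_gt0.
    move: (_^-1) => q q0 h1 h2 h3.
    rewrite -mulrA; apply: le_trans (ler_wpM2r _ h1) _; first by rewrite mulr_ge0// ltW.
    by rewrite ler_wpM2l// -[X in _ <= X]mulr1 ler_wpM2l ?(ltW q0)//; lra.
  have [cu _] := Pu n; have /cvgrPdist_lt/(_ (e / 3)) := cu x; rewrite divr_gt0// => /(_ isT).
  apply: filterS => y hy.
  rewrite (_ : _ - _ = - (u n x - k x) + (u n x - u n y) + (u n y - k y)); last by ring.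
  apply: le_lt_trans (ler_normD _ _) _.
  apply: le_lt_trans (lerD (ler_normD _ _) (lexx _)) _.
  by rewrite normrN; have := Hn' x; have := Hn' y; lra.
- move=> z; apply/ler_addgt0Pr => e e0.
  have /cvgr0Pnorm_lt/(_ e) := h0 `|d|; rewrite e0 => /(_ isT)[n _ /(_ n (leqnn n)) Hn].
  have [_ /(_ z) un] := Pu n.
  rewrite (_ : k z = u n z - (u n z - k z)); last by ring.
  apply: le_trans (ler_normB _ _) _; rewrite lerD//.
  apply: ltW; apply: le_lt_trans Hn; apply: le_trans (uk n z) _.
  rewrite normrM normr_id [`| _^-1|]ger0_norm ?invr_ge0 ?exprn_ge0//.
  have := W_gt0 z; have := W_le_half z; have := ler_norm d.
  have : 0 < (2 ^+ n : R)^-1 by rewrite invr_gt0 exprn_gt0.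
  move: (_^-1) => q q0 h1 h2 h3.
  rewrite -mulrA; apply: le_trans (ler_wpM2r _ h1) _; first by rewrite mulr_ge0// ltW.
  by rewrite ler_wpM2l// -[X in _ <= X]mulr1 ler_wpM2l ?(ltW q0)//; lra.
Unshelve. all: by end_near. Qed.

Lemma prof_fixed_point : exists2 k, prof_class k & prof_step k = k.
Proof.
have P0 : prof_class (cst 0).
  by split; [exact: cst_continuous|move=> z; rewrite normr0 mulr_ge0// ltW ?W_gt0].
apply: (@contraction_fixed_point R prof_class prof_step W (cst 0) dl) => //.
- by move=> z; rewrite ltW ?W_gt0.
- exact: prof_step_class.
- by move=> z; rewrite subr0; have [_] := prof_step_class P0; apply.
- by move=> k l d; exact: prof_step_contract.
- exact: prof_class_lim.
Qed.

End Profile.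

Section Lipschitz.
Context {R : realType}.

Lemma derive_lipschitz (F f : R -> R) (c : R) : (forall x : R, is_derive x 1 F (f x)) ->
  (forall x, `|f x| <= c) -> forall x y, `|F y - F x| <= c * `|y - x|.
Proof.
move=> dF fc x y.
have dS (z : R) : is_derive z 1 (fun z => c * z) c.
  by have := is_deriveZ c (is_derive_id z (1 : R)); rewrite /GRing.scale/= mulr1.
have HH u w : u <= w -> `|F w - F u| <= c * `|w - u|.
  move=> uw; apply: le_trans (derive_norm_le uw dF dS fc) _.
  by rewrite -mulrBr (ger0_norm (x := w - u)) ?subr_ge0.
by case: (leP x y) => [/HH//|/ltW/HH]; rewrite distrC [X in _ <= _ * X]distrC.
Qed.

End Lipschitz.

(* In the variable [z = eps ln x], [phi] is the vorticity, [v] the velocity divided by [x],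
   and [G] the primitive of the vorticity divided by [x], up to constant factors. *)
Record is_profile {R : realType} (eps C : R) (phi p v G : R -> R) : Prop := {
  profile_continuous : continuous phi ;
  profile_phi_gt0 : forall z, 0 < phi z ;
  profile_v : forall z, v z = p z + eps / 2 * conv eps phi z ;
  profile_p_derive : forall z : R, is_derive z 1 p (- phi z) ;
  profile_p_cvg0 : p z @[z --> +oo] --> 0 ;
  profile_phiG : forall z, phi z * (1 - 2 * eps * v z) = G z ;
  profile_denom : forall z, 1 / 2 <= 1 - 2 * eps * v z <= 2 ;
  profile_G_derive : forall z : R, is_derive z 1 G (- (1 - 2 * v z) * phi z) ;
  profile_v_bounded : forall z, `|v z| <= 3 ;
  profile_phi_left : forall z, phi z <= expR (z / 2) ;
  profile_phi_right : forall z, phi z <= C * expR (- z) ;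
  profile_v_right : forall z, `|v z| <= C * expR (- z) ;
  profile_increment_right : forall z z', z <= z' ->
    `|phi z' - phi z| <= C * expR (- z) * (z' - z) ;
  profile_increment_left : forall z z', z <= z' ->
    `|phi z' - phi z| <= C * expR (z' / 2) * (z' - z) }.

(** * Positivity, decay and increments of the fixed point *)

Section ProfileFacts.
Context {R : realType}.
Variables eps dl : R.
Hypothesis eps_gt0 : 0 < eps.
Hypothesis dl_gt0 : 0 < dl.
Hypothesis dl_small : 480 * dl <= 1/4.
Let M : R := kap_mass.
Hypothesis eps_small : eps * (60 * (M + 1)) <= dl.
Variable k : R -> R.
Hypothesis Pk : prof_class dl k.
Hypothesis fixk : prof_step eps k = k.

Let phi := prof_phi k.
Let p := prof_p k.
Let v := prof_v eps k.
Let J z := conv eps phi z * phi z.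
(** The primitive of [- (1 - 2 v) phi] that vanishes at [+oo]: the part of [v] equal to [p]
    integrates to [p - p^2] because [p' = - phi], and only the convolution part leaves a tail. *)
Let G z := p z - p z ^+ 2 - eps * tail J z.

Let M0 : 0 <= M. Proof. exact: kap_mass_ge0. Qed.
Let eM0 : 0 <= eps * M. Proof. by rewrite mulr_ge0// ltW. Qed.
Let eMs : 60 * (eps * M) + 60 * eps <= dl.
Proof. by have -> : 60 * (eps * M) + 60 * eps = eps * (60 * (M + 1)) by ring. Qed.

Let bounds := prof_bounds eps_gt0 dl_gt0 dl_small eps_small Pk.
Let gf_bounds := prof_gf_bounds eps_gt0 dl_gt0 dl_small eps_small Pk.

Let cphi : continuous phi. Proof. by case: bounds. Qed.
Let cv : continuous v. Proof. by case: bounds. Qed.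
Let phiW z : `|phi z| <= W z. Proof. by case: bounds => _ _ _ _ []. Qed.
Let phi_half z : `|phi z| <= 1/2. Proof. exact: le_trans (phiW z) (W_le_half z). Qed.
Let v3 z : `|v z| <= 3. Proof. by case: bounds => _ _ _ _ []. Qed.
Let t4 z : `|tail k z| <= 4 * dl. Proof. by case: bounds => _ _ _ _ []. Qed.
Let cJ : continuous J.
Proof. by have [_ _ h _ _] := bounds; move=> x; apply: cvgM; [exact: h|exact: cphi]. Qed.
Let JW z : `|J z| <= M / 2 * W z.
Proof. by rewrite normrM ler_pM//; case: bounds => _ _ _ _ []. Qed.
Let tail_g z : tail (prof_g eps k) z = tail k z ^+ 2 + eps * tail J z.
Proof.
have [cg _ gb _] := gf_bounds.
have [dt t0 _] := tail_spec Pk.1 Pk.2.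
have [dJ J0 _] := tail_spec cJ JW.
suff -> : tail (prof_g eps k) = (fun z => tail k z ^+ 2 + eps * tail J z) by [].
apply: (@tail_unique R (prof_g eps k) (fun z : R => tail k z ^+ 2 + eps * tail J z) _ cg gb).
- move=> x.
  have := is_deriveD (is_deriveX 2 (dt x)) (is_deriveZ eps (dJ x)).
  move=> /is_derive_eq; apply; rewrite /GRing.scale/= /prof_g /J -/phi.
  by rewrite ?expr1; ring.
- have : tail k x * tail k x + eps * tail J x @[x --> +oo] --> 0 * 0 + eps * 0.
    by apply: cvgD; apply: cvgM => //; exact: cvg_cst.
  by rewrite !mulr0 addr0.
Qed.

(** The fixed-point equation read backwards: [lin_solves] turns it into
    [k = Th tail k - tail g - f], and [W^2 = (1 - Th^2) / 4] then rebuilds [p - p^2]. *)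
Let phiG z : phi z * (1 - 2 * eps * v z) = G z.
Proof.
have [cg cf gb fb] := gf_bounds.
have H1 : tail k z = W z ^+ 2 * Bw z * tail (prof_g eps k) z +
  W z ^+ 2 * signed_integral (fun x => prof_g eps k x * Bw x + prof_f eps k x / W x ^+ 2) z.
  by rewrite -[X in tail X]fixk /prof_step (lin_solves cg cf gb fb); ring.
have H2 : k z = Th z * tail k z - tail (prof_g eps k) z - prof_f eps k z.
  have h : 4 * W z ^+ 2 - 2 * z * W z ^+ 2 * Th z = 1 - Th z * (W z ^+ 2 * Bw z).
    by rewrite Bw_W mulrDr -expr2 Th_sqr; ring.
  by rewrite -[LHS](congr1 (fun f => f z) fixk) /prof_step /lin h {}H1; ring.
have -> : phi z * (1 - 2 * eps * v z) = W z ^+ 2 + k z + prof_f eps k z.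
  by rewrite /prof_f -/v -/phi {1}/phi /prof_phi /phi /prof_phi; ring.
rewrite H2 tail_g /G /p /prof_p.
have : W z ^+ 2 = (1 - Th z ^+ 2) / 4 by rewrite Th_sqr; field.
by move=> ->; field.
Qed.

Let dp (x : R) : is_derive x 1 p (- phi x).
Proof.
have [dt _ _] := tail_spec Pk.1 Pk.2.
have h : is_derive x 1 (fun x => (1 - Th x) / 2) (- W x ^+ 2).
  have -> : (fun x => (1 - Th x) / 2) = (2^-1 : R) *: (cst 1 - Th).
    by apply/funext => y; rewrite /= /GRing.scale/= mulrC.
  apply: (is_derive_eq (is_deriveZ (2^-1 : R) (is_deriveB (is_derive_cst (1 : R) x 1) (is_derive_Th x)))).
  by rewrite /GRing.scale/=; field.
by rewrite opprD; apply: is_deriveD.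
Qed.

Let dG (x : R) : is_derive x 1 G (- (1 - 2 * v x) * phi x).
Proof.
have [dJ _ _] := tail_spec cJ JW.
have := is_deriveB (is_deriveB (dp x) (is_deriveX 2 (dp x))) (is_deriveZ eps (dJ x)).
move=> /is_derive_eq; apply; rewrite /GRing.scale/= ?expr1 /J /v /prof_v -/p -/phi.
by field.
Qed.

Let ev z : 1/2 <= 1 - 2 * eps * v z <= 2.
Proof.
have h : `|2 * eps * v z| <= 2 * eps * 3.
  by rewrite normrM (gtr0_norm (x := 2 * eps)) ?mulr_gt0// ler_wpM2l// mulr_ge0// ltW.
move: h; rewrite ler_norml => /andP[h1 h2]; move: eMs eM0 dl_small => *.
by apply/andP; split; lra.
Qed.

Let evn0 z : 1 - 2 * eps * v z != 0.
Proof. by rewrite gt_eqF//; have /andP[h _] := ev z; lra. Qed.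

Let a z := (1 - 2 * v z) / (1 - 2 * eps * v z).
Let ca : continuous a.
Proof.
move=> x; apply: cvgM; last apply: cvgV => //; (apply: cvgB; first exact: cvg_cst);
  apply: cvgM; [exact: cvg_cst|exact: cv|exact: cvg_cst|exact: cv].
Qed.

(** [p 0 = 1/2 + tail k 0], so [p - p^2] is close to [1/4] and dominates the nonlocal term. *)
Let G0 : 0 < G 0.
Proof.
have [_ _ tb] := tail_spec cJ JW; have := tb 0; have := t4 0.
have : `|eps * tail J 0| <= 2 * (eps * M).
  by rewrite normrM (gtr0_norm eps_gt0) (_ : 2 * _ = eps * (4 * (M / 2))) ?ler_wpM2l ?(ltW eps_gt0)//; field.
rewrite /G /p /prof_p /Th mul0r oppr0 subrr mul0r subr0 !ler_norml.
move: (tail k 0) => t /andP[h1 h2] /andP[h5 h6] _; move: eMs eM0 dl_small dl_gt0 eps_gt0 => *.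
have : t ^+ 2 <= 1/100 by nra.
by rewrite sqrrD; lra.
Qed.

(** Substituting [phi = G / (1 - 2 eps v)] gives the linear equation [G' = - a G]. The sign of [G]
    at [0] therefore spreads to the whole line, and the decay of [G] can be read off [a]. *)
Let GE z : G z = G 0 * expR (- signed_integral a z).
Proof.
have dI := signed_integral_derive ca.
have d0 x : is_derive x (1 : R) (fun z => G z * expR (signed_integral a z)) 0.
  have := is_deriveM (dG x) (is_derive1_comp (is_derive_expR (signed_integral a x)) (dI x)).
  move=> /is_derive_eq; apply; rewrite /GRing.scale/= /a -(phiG x).
  by field; exact: evn0.
have := derive_0_const d0 z 0; rewrite signed_integral0 expR0 mulr1 => <-.
by rewrite -mulrA expRxMexpNx_1 mulr1.
Qed.

Let Ggt0 z : 0 < G z.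
Proof. by rewrite GE mulr_gt0 ?expR_gt0. Qed.

Let phi_gt0 z : 0 < phi z.
Proof.
have := Ggt0 z; rewrite -phiG pmulr_lgt0//; have /andP[h _] := ev z; lra.
Qed.

Let W_le_expN (z : R) : W z <= expR (- (z / 2)).
Proof. by rewrite expRN lef_pV2 ?posrE ?addr_gt0 ?expR_gt0// lerDl expR_ge0. Qed.

Let W_le_exp (z : R) : W z <= expR (z / 2).
Proof.
by rewrite -[X in _ <= X]invrK -expRN lef_pV2 ?posrE ?invr_gt0 ?addr_gt0 ?expR_gt0// lerDr expR_ge0.
Qed.

Lemma is_derive_NexpN (c b x : R) : b != 0 -> is_derive x 1 (fun z => - (c / b) * expR (- (b * z))) (c * expR (- (b * x))).
Proof.
move=> b0; have d : is_derive x 1 (fun x : R => - (b * x)) (- b).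
  have := is_deriveN (is_deriveZ b (is_derive_id x (1 : R))); rewrite /GRing.scale/= mulr1; exact.
have := is_deriveZ (- (c / b)) (@is_derive1_comp _ expR (fun x => - (b * x)) x _ _ (is_derive_expR _) d).
by move=> /is_derive_eq; apply; rewrite /GRing.scale/=; field.
Qed.

Let le_tail_exp (D g : R -> R) (c b : R) : 0 < b -> 0 <= c -> (forall x : R, is_derive x 1 D (g x)) ->
  (forall x, `|g x| <= c * expR (- (b * x))) -> D x @[x --> +oo] --> 0 ->
  forall x, `|D x| <= c / b * expR (- (b * x)).
Proof.
move=> b0 c0 dD gc D0 x.
have bn0 : b != 0 by rewrite gt_eqF.
have := @le_tail R D g (fun z => - (c / b) * expR (- (b * z))) (fun z => c * expR (- (b * z))) 0 dD
  (fun x => is_derive_NexpN c x bn0) gc _ D0 x.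
rewrite sub0r mulNr opprK; apply.
by move=> y; rewrite mulNr oppr_le0 mulr_ge0 ?expR_ge0// divr_ge0// ltW.
Qed.

Let half (z : R) : - (z / 2) = - (2^-1 * z). Proof. by rewrite mulrC. Qed.

(** A first, weaker rate inherited from the weight [W]; it suffices to make [a - 1] integrable at
    [+oo]. *)
Let v_decay_half z : `|v z| <= (1 + 2 * dl + M) * expR (- (2^-1 * z)).
Proof.
have [dt t0 _] := tail_spec Pk.1 Pk.2.
have h1 : `|(1 - Th z) / 2| <= expR (- (2^-1 * z)).
  have := W_denom z => hW.
  have -> : (1 - Th z) / 2 = expR (- (z / 2)) * W z.
    by rewrite /Th -{1}hW; field.
  rewrite half normrM !gtr0_norm ?expR_gt0 ?W_gt0//.
  by rewrite -[X in _ <= X]mulr1 ler_wpM2l ?expR_ge0//; have := W_le_half z; lra.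
have h2 : `|tail k z| <= dl / 2^-1 * expR (- (2^-1 * z)).
  apply: (le_tail_exp _ _ dt _ t0) => //; first exact: ltW.
  by move=> x; rewrite normrN; apply: le_trans (Pk.2 x) _; rewrite ler_wpM2l ?(ltW dl_gt0)// -half W_le_expN.
have h3 : `|conv eps phi z| <= M * 1 * expR (- (2^-1 * z)).
  apply: conv_decay => //.
    by move: eMs eM0 dl_small eps_gt0 => *; apply/andP; split; lra.
  by move=> y; rewrite mul1r -half; exact: le_trans (phiW y) (W_le_expN y).
have h4 : `|eps / 2 * conv eps phi z| <= M * expR (- (2^-1 * z)).
  rewrite normrM ger0_norm; last by rewrite divr_ge0// ltW.
  rewrite mulr1 in h3; apply: le_trans (ler_wpM2l _ h3) _; first by rewrite divr_ge0// ltW.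
  rewrite -[X in _ <= X]mul1r ler_wpM2r// ?mulr_ge0 ?expR_ge0//.
  by move: eMs eM0 dl_small eps_gt0 => *; lra.
rewrite /v /prof_v /prof_p.
apply: le_trans (ler_normD _ _) _; apply: le_trans (lerD (ler_normD _ _) (lexx _)) _.
set E := expR _ in h1 h2 h4 *.
have -> : (1 + 2 * dl + M) * E = E + dl / 2^-1 * E + M * E by field.
by rewrite !lerD.
Qed.

(** [a - 1] is a bounded multiple of [v], so for [z > 0] the primitive of [a] differs from [z] by at
    most [8 Cv]. This improves the rate [1/2] of the class to [1]; for [z <= 0] the bound [G <= 1]
    is enough. *)
Let G_decay : exists2 C, 1 <= C & forall z, G z <= C * expR (- z).
Proof.
set Cv := 1 + 2 * dl + M; have Cv0 : 0 <= Cv by rewrite /Cv; move: dl_gt0 M0 => *; lra.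
exists (expR (8 * Cv)); first by rewrite -expR0 ler_expR mulr_ge0.
move=> z; have h := Ggt0 z.
have Gle x : G x <= 1.
  rewrite -phiG; have := phi_half x; rewrite ler_norml => /andP[_ h1].
  have /andP[h2 h3] := ev x; have := phi_gt0 x; nra.
case: (leP z 0) => z0.
  apply: le_trans (Gle z) _; rewrite -expRD.
  have : 0 <= 8 * Cv - z by rewrite subr_ge0 (le_trans z0)// mulr_ge0.
  by rewrite -ler_expR expR0.
have ca1 : continuous (fun z => a z - 1) by move=> x; apply: cvgB; [exact: ca|exact: cvg_cst].
have ab x : `|a x - 1| <= 4 * Cv * expR (- (2^-1 * x)).
  have -> : a x - 1 = (2 * (eps - 1) / (1 - 2 * eps * v x)) * v x.
    by rewrite /a; field; exact: evn0.
  have hc : `|2 * (eps - 1) / (1 - 2 * eps * v x)| <= 4.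
    rewrite normrM normrV ?unitfE ?evn0//.
    have /andP[h2 h3] := ev x.
    rewrite (gtr0_norm (x := 1 - _)); last by lra.
    rewrite ler_pdivrMr; last by lra.
    move: eMs eM0 dl_small eps_gt0 => *; rewrite ler0_norm; lra.
  rewrite normrM -[4 * Cv * _]mulrA.
  exact: (ler_pM (normr_ge0 _) (normr_ge0 _) hc (v_decay_half x)).
have half0 : (2^-1 : R) != 0 by [].
have := derive_norm_le (ltW z0) (signed_integral_derive ca1)
  (fun x => is_derive_NexpN (4 * Cv) x half0) ab.
rewrite signed_integral0 subr0 mulr0 oppr0 expR0 => h1.
have h2 : `|signed_integral (fun z => a z - 1) z| <= 8 * Cv.
  apply: le_trans h1 _.
  have : 0 <= 4 * Cv / 2^-1 * expR (- (2^-1 * z)) by rewrite !mulr_ge0 ?expR_ge0.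
  by lra.
have h3 : signed_integral (fun z => a z - 1) z = signed_integral a z - z.
  have c1 : continuous (cst 1 : R -> R) by exact: cst_continuous.
  rewrite (_ : (fun _ => _) = a - cst 1)// signed_integralB//.
  congr (_ - _).
  have dc x : is_derive x (1 : R) (signed_integral (cst 1) - id) (1 - 1).
    by apply: is_deriveB; exact: (signed_integral_derive c1).
  rewrite subrr in dc; have := derive_0_const dc z 0.
  by rewrite !fctE signed_integral0 subrr => /eqP; rewrite subr_eq0 => /eqP.
rewrite GE -expRD.
have g1 : G 0 <= 1 by [].
apply: (@le_trans _ _ (1 * expR (- signed_integral a z))).
  by rewrite ler_wpM2r// expR_ge0.
rewrite mul1r ler_expR; move: h2; rewrite h3 ler_norml => /andP[h4 h5]; lra.
Qed.

Let lipG x y : `|G y - G x| <= 4 * `|y - x|.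
Proof.
have H z : `|- (1 - 2 * v z) * phi z| <= 4.
  rewrite normrM; have := v3 z; have := phi_half z; rewrite !ler_norml => /andP[h1 h2] /andP[h3 h4].
  have e1 : `|- (1 - 2 * v z)| <= 8 by rewrite ler_norml; apply/andP; split; lra.
  have e2 : `|phi z| <= 1/2 by [].
  have := ler_pM (normr_ge0 _) (normr_ge0 _) e1 e2; lra.
exact: (derive_lipschitz dG H).
Qed.

Let lipp x y : `|p y - p x| <= 1/2 * `|y - x|.
Proof. by apply: (derive_lipschitz dp) => z; rewrite normrN. Qed.

(** [conv] commutes with translations, so an increment bound for [phi] passes to [conv phi] with
    factor [M], and [eps / 2] damps it. *)
Let lipv_of (c s : R) : (forall z, `|phi (z + s) - phi z| <= c) ->
  forall z, `|v (z + s) - v z| <= 1/2 * `|s| + eps / 2 * (M * c).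
Proof.
move=> hc z; rewrite /v /prof_v -/p -/phi conv_shift.
rewrite (_ : _ - _ = (p (z + s) - p z) + eps / 2 * (conv eps (fun x => phi (x + s)) z - conv eps phi z)); last by ring.
apply: le_trans (ler_normD _ _) _; apply: lerD.
  by have := lipp z (z + s); rewrite (addrAC z s) subrr add0r.
rewrite normrM ger0_norm; last by rewrite divr_ge0// ltW.
rewrite ler_wpM2l//; first by rewrite divr_ge0// ltW.
apply: (@conv_sub_le R eps (fun x => phi (x + s)) phi z c (1/2)) => //.
by move=> x; apply: (@continuous_comp _ _ _ (fun x => x + s) phi); [apply: cvgD; [exact: cvg_id|exact: cvg_cst]|exact: cphi].
Qed.

(* The equation [phi (1 - 2 eps v) = G] loses only a factor [O(eps)] on increments of [phi],
   so a modulus [c] self-improves to [16 |s| + c / 2]. *)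
Let lipphi s z : `|phi (z + s) - phi z| <= 16 * `|s|.
Proof.
have H n : forall z, `|phi (z + s) - phi z| <= 16 * `|s| + 2^-1 ^+ n.
  elim: n => [|n IH] y.
    rewrite expr0; have := phi_half (y + s); have := phi_half y; have := normr_ge0 s.
    by rewrite !ler_norml => ? /andP[? ?] /andP[? ?]; apply/andP; split; lra.
  have hv := lipv_of IH y; have hG := lipG y (y + s); rewrite (addrAC y s) subrr add0r in hG.
  set q := 2^-1 ^+ n in IH hv *; have q0 : 0 <= q by rewrite exprn_ge0.
  have E : phi (y + s) - phi y = ((G (y + s) - G y) + 2 * eps * phi (y + s) * (v (y + s) - v y)) / (1 - 2 * eps * v y).
    by rewrite -!phiG; field; exact: evn0.
  rewrite E normrM normrV ?unitfE ?evn0//; have /andP[e1 e2] := ev y.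
  rewrite (gtr0_norm (x := 1 - _)); last by lra.
  rewrite ler_pdivrMr; last by lra.
  have h1 : `|2 * eps * phi (y + s) * (v (y + s) - v y)| <= eps * (1/2 * `|s| + eps / 2 * (M * (16 * `|s| + q))).
    rewrite normrM ler_pM// normrM (gtr0_norm (x := 2 * eps)) ?mulr_gt0//.
    have := phi_half (y + s); move: eps_gt0 => *; nra.
  apply: le_trans (ler_normD _ _) _; apply: le_trans (lerD hG h1) _.
  rewrite exprS -/q; set N := `|s| in hv hG h1 *; have N0 : 0 <= N by exact: normr_ge0.
  have e3 : eps / 2 * (M * (16 * N + q)) <= 16 * N + q.
    rewrite mulrA -[X in _ <= X]mul1r ler_wpM2r//; last by move: eMs eM0 dl_small eps_gt0 => *; nra.
    by rewrite addr_ge0// mulr_ge0.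
  have e4 : eps * (1/2 * N + eps / 2 * (M * (16 * N + q))) <= eps * (17 * N + q).
    by rewrite ler_wpM2l ?(ltW eps_gt0)//; lra.
  have e5 : eps * (17 * N + q) <= 60^-1 * (17 * N + q).
    rewrite ler_wpM2r//; first by rewrite addr_ge0// mulr_ge0.
    by move: eMs eM0 dl_small eps_gt0 => *; lra.
  apply: le_trans (lerD (lexx _) (le_trans e4 e5)) _.
  have : (16 * N + 2^-1 * q) * (1/2) <= (16 * N + 2^-1 * q) * (1 - 2 * eps * v y).
    by rewrite ler_wpM2l// addr_ge0// mulr_ge0.
  lra.
apply/ler_addgt0Pr => e e0.
have : (2^-1 : R) ^+ n @[n --> \oo] --> 0 by apply: cvg_expr; rewrite ger0_norm// invf_lt1 ?ltr1n.
move=> /cvgr0Pnorm_lt/(_ e e0)[n _ /(_ n (leqnn n)) Hn].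
apply: le_trans (H n z) _; rewrite lerD2l.
by apply: ltW; apply: le_lt_trans Hn; exact: ler_norm.
Qed.

Let lipv x y : `|v y - v x| <= `|y - x|.
Proof.
have := lipv_of (lipphi (y - x)) x; rewrite (addrC x (y - x)) subrK => /le_trans; apply.
have := normr_ge0 (y - x); move: `|y - x| => N N0.
have -> : eps / 2 * (M * (16 * N)) = 8 * (eps * M) * N by field.
have : 8 * (eps * M) * N <= 1/2 * N by rewrite ler_wpM2r//; move: eMs eM0 dl_small eps_gt0 => *; lra.
lra.
Qed.

Let p_cvg0 : p x @[x --> +oo] --> 0.
Proof.
have [dt t0 _] := tail_spec Pk.1 Pk.2.
rewrite -(addr0 0); apply: cvgD => //.
apply: (cvg0_dominated (c := 1) _ W_cvg0); near=> x.
have x0 : 0 <= x by near: x; apply: nbhs_pinfty_ge; rewrite num_real.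
have -> : (1 - Th x) / 2 = expR (- (x / 2)) * W x.
  by rewrite /Th -{1}(W_denom x); field.
rewrite normrM ler_wpM2r// ger0_norm ?expR_ge0//.
by rewrite expR_le1 oppr_le0 divr_ge0.
Unshelve. all: by end_near. Qed.

Let phi_le_2G z : phi z <= 2 * G z.
Proof. by rewrite -phiG; have := phi_gt0 z; have /andP[h _] := ev z; nra. Qed.

(** The local size [B] of [phi] stays as a factor, so the decay of [phi] carries over to its
    increments. The increment of [G] contributes [7 B], since [|1 - 2 v| <= 7], and that of [v] at
    most [B]. *)
Let phi_increment z z' (B : R) : z <= z' -> (forall x, z <= x <= z' -> phi x <= B) ->
  `|phi z' - phi z| <= 20 * B * (z' - z).
Proof.
move=> zz Bx.
have [c] := MVT_segment zz (fun x _ => dG x) (continuous_subspaceT (derive1_continuous dG)).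
rewrite in_itv/= => czz GG.
have B0 : 0 <= B by apply: le_trans (Bx z _); rewrite ?lexx//; exact: ltW.
have d0 : 0 <= z' - z by rewrite subr_ge0.
have hG : `|G z' - G z| <= 7 * B * (z' - z).
  rewrite GG normrM (ger0_norm d0) ler_wpM2r// normrM normrN.
  apply: ler_pM => //; last by rewrite (gtr0_norm (phi_gt0 c)) Bx.
  by have := v3 c; rewrite !ler_norml => /andP[? ?]; apply/andP; split; lra.
have E : phi z' - phi z = ((G z' - G z) + 2 * eps * phi z * (v z' - v z)) / (1 - 2 * eps * v z').
  by rewrite -!phiG; field; exact: evn0.
have /andP[e1 e2] := ev z'.
rewrite E normrM normrV ?unitfE ?evn0// (gtr0_norm (x := 1 - _)); last by lra.
rewrite ler_pdivrMr; last by lra.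
have h1 : `|2 * eps * phi z * (v z' - v z)| <= 1 * B * (z' - z).
  rewrite normrM; apply: ler_pM => //; last by have := lipv z z'; rewrite (ger0_norm d0).
  rewrite normrM; apply: ler_pM => //; last by rewrite (gtr0_norm (phi_gt0 z)) Bx// lexx.
  by rewrite gtr0_norm ?mulr_gt0//; move: eMs eM0 dl_small => *; lra.
apply: le_trans (ler_normD _ _) _; apply: le_trans (lerD hG h1) _.
have : 20 * B * (z' - z) * (1/2) <= 20 * B * (z' - z) * (1 - 2 * eps * v z').
  by rewrite ler_wpM2l// !mulr_ge0.
have : 0 <= B * (z' - z) by rewrite mulr_ge0.
lra.
Qed.

Lemma fixed_point_profile : exists phi p v G : R -> R, exists C, is_profile eps C phi p v G.
Proof.
have [C C1 GC] := G_decay.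
have phiC z : phi z <= 2 * C * expR (- z).
  by apply: le_trans (phi_le_2G z) _; rewrite -mulrA ler_wpM2l.
have C0 : 0 <= 2 * C by lra.
have pC z : `|p z| <= 2 * C * expR (- z).
  have := @le_tail_exp p (fun x => - phi x) (2 * C) 1 ltr01 C0 dp _ p_cvg0 z.
  rewrite divr1 mul1r; apply => x; rewrite normrN mul1r (gtr0_norm (phi_gt0 x)); exact: phiC.
have cC z : `|conv eps phi z| <= M * (2 * C) * expR (- z).
  have := @conv_decay R eps phi z 1 (2 * C) cphi ler01; rewrite !mul1r; apply.
    by move: eMs eM0 dl_small eps_gt0 => *; apply/andP; split; lra.
  by move=> y; rewrite mul1r (gtr0_norm (phi_gt0 y)); exact: phiC.
have vC z : `|v z| <= 4 * C * expR (- z).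
  rewrite /v /prof_v -/p -/phi; apply: le_trans (ler_normD _ _) _.
  rewrite normrM ger0_norm; last by rewrite divr_ge0// ltW.
  have h : eps / 2 * `|conv eps phi z| <= eps / 2 * (M * (2 * C) * expR (- z)).
    by rewrite ler_wpM2l// divr_ge0// ltW.
  apply: le_trans (lerD (pC z) h) _.
  have -> : eps / 2 * (M * (2 * C) * expR (- z)) = (eps * M) * (C * expR (- z)) by field.
  have CE : 0 <= C * expR (- z) by rewrite mulr_ge0 ?expR_ge0//; lra.
  have : eps * M * (C * expR (- z)) <= 1 * (C * expR (- z)).
    by rewrite ler_wpM2r//; move: eMs eM0 dl_small eps_gt0 => *; lra.
  lra.
(* [40 C] is [20] times the constant [2 C] bounding [phi] on the right; it also exceeds the [20] of
   the left increment because [1 <= C]. *)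
exists phi, p, v, G, (40 * C); split => //.
- move=> z; apply: le_trans (ler_norm _) _; exact: le_trans (phiW z) _.
- move=> z; apply: le_trans (phiC z) _; rewrite ler_wpM2r ?expR_ge0//; lra.
- move=> z; apply: le_trans (vC z) _; rewrite ler_wpM2r ?expR_ge0//; lra.
- move=> z z' zz; apply: le_trans (phi_increment zz (B := 2 * C * expR (- z)) _) _.
    by move=> x /andP[zx _]; apply: le_trans (phiC x) _; rewrite ler_wpM2l// ler_expR lerN2.
  by rewrite !mulrA; lra.
- move=> z z' zz; apply: le_trans (phi_increment zz (B := expR (z' / 2)) _) _.
    move=> x /andP[_ xz]; apply: le_trans (ler_norm _) _; apply: le_trans (phiW x) _.
    by apply: le_trans (W_le_exp x) _; rewrite ler_expR ler_pM2r.
  rewrite ler_wpM2r ?subr_ge0// ler_wpM2r ?expR_ge0//; lra.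
Qed.

End ProfileFacts.

Section ProfileExists.
Context {R : realType}.

Lemma profile_exists : exists2 e0 : R, 0 < e0 &
  forall eps, 0 < eps <= e0 ->
  exists phi p v G : R -> R, exists C, is_profile eps C phi p v G.
Proof.
(* [1 / 1936], just below the largest value [1 / 1920] that [480 dl <= 1/4] allows. *)
pose dl : R := (44 * 44)^-1.
have dl0 : 0 < dl by rewrite invr_gt0.
have dls : 480 * dl <= 1/4.
  rewrite /dl ler_pdivrMr//; lra.
have M1 : 0 < 60 * (@kap_mass R + 1) by have := @kap_mass_ge0 R; lra.
exists (dl / (60 * (kap_mass + 1))); first exact: divr_gt0.
move=> eps /andP[e0]; rewrite ler_pdivlMr// => es.
have [k Pk fk] := prof_fixed_point e0 dl0 dls es.
exact: (fixed_point_profile e0 dl0 dls es Pk fk).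
Qed.

End ProfileExists.

(** * Hilbert transform and velocity of an odd function *)

Section AffineTransfer.
Context {R : realType}.
Notation mu := (@lebesgue_measure R).
Implicit Types (f F : R -> R).

Lemma measurable_shift (x : R) :
  measurable_fun [set: measurableTypeR R] (fun r => x + r : measurableTypeR R).
Proof. exact: measurable_funD. Qed.

Lemma measurable_reflect (x : R) :
  measurable_fun [set: measurableTypeR R] (fun r => x - r : measurableTypeR R).
Proof. exact: measurable_funB. Qed.

Lemma lebesgue_measure_shift (x : R) (A : set (measurableTypeR R)) : measurable A ->
  pushforward mu (fun r => x + r : measurableTypeR R) A = mu A.
Proof.
move=> mA; apply/esym.
apply: (@lebesgue_measure_unique R (pushforward mu (fun r => x + r : measurableTypeR R))) => //.
  exact: measurable_shift.
move=> ? _ [[a b]] _ <-; rewrite [X in mu X = _]/= [X in _ = pushforward _ _ X]/=.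
have -> : pushforward mu (fun r => x + r : measurableTypeR R) `]a, b] = mu `]a - x, b - x]%classic.
  by rewrite /pushforward; congr (mu _); apply/seteqP; split => r /=; rewrite !in_itv/= => /andP[h1 h2]; apply/andP; split; lra.
by rewrite /= !lebesgue_measure_itv/= !lte_fin ltrD2r -!EFinB opprB addrA subrK.
Qed.

Lemma lebesgue_measure_reflect (x : R) (A : set (measurableTypeR R)) : measurable A ->
  pushforward mu (fun r => x - r : measurableTypeR R) A = mu A.
Proof.
move=> mA; apply/esym.
apply: (@lebesgue_measure_unique R (pushforward mu (fun r => x - r : measurableTypeR R))) => //.
  exact: measurable_reflect.
move=> ? _ [[a b]] _ <-; rewrite [X in mu X = _]/= [X in _ = pushforward _ _ X]/=.
have -> : pushforward mu (fun r => x - r : measurableTypeR R) `]a, b] = mu `[x - b, x - a[%classic.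
  by rewrite /pushforward; congr (mu _); apply/seteqP; split => r /=; rewrite !in_itv/= => /andP[h1 h2]; apply/andP; split; lra.
by rewrite /= !lebesgue_measure_itv/= !lte_fin ltrD2l ltrN2 -!EFinB (_ : x - a - (x - b) = b - a)//; ring.
Qed.

(** Change of variables through the push-forward measure; translations and reflections are both
    instances. *)
Lemma integral_transfer (phi : R -> R) (D : set R) F :
  measurable_fun [set: measurableTypeR R] (phi : _ -> measurableTypeR R) ->
  (forall A : set (measurableTypeR R), measurable A ->
    pushforward mu (phi : measurableTypeR R -> measurableTypeR R) A = mu A) ->
  measurable D -> measurable_fun setT F ->
  mu.-integrable (phi @^-1` D) (EFin \o (F \o phi)) ->
  mu.-integrable D (EFin \o F) /\
  \int[mu]_(y in D) F y = \int[mu]_(r in phi @^-1` D) F (phi r).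
Proof.
move=> mphi muphi mD mF iF.
have mEF : measurable_fun [set: measurableTypeR R] (EFin \o F) by exact/measurable_EFinP.
have E := @integral_pushforward _ _ (measurableTypeR R) (measurableTypeR R) R phi mphi mu D (EFin \o F) mEF iF mD.
have I := @integrable_pushforward _ _ (measurableTypeR R) (measurableTypeR R) R phi mphi mu D (EFin \o F) mEF iF mD.
split; last first.
  rewrite /Rintegral; congr fine; rewrite -E.
  by apply: eq_measure_integral => A mA _; exact/esym/muphi.
move/integrableP : I => [m1 i1]; apply/integrableP; split => //.
apply: le_lt_trans i1; rewrite le_eqVlt; apply/orP; left; apply/eqP.
by apply: eq_measure_integral => A mA _; exact/esym/muphi.
Qed.

Lemma powR_sub1 (r c : R) : 0 < r -> r `^ (c - 1) = r `^ c / r.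
Proof. by move=> r0; rewrite powRB ?powRr1 ?ltW// (gt_eqF r0) implybT. Qed.

Lemma powRN_half (r c : R) : 0 < r -> (r / 2) `^ (- c) = 2 `^ c * r `^ (- c).
Proof.
move=> r0; rewrite powRM ?invr_ge0 ?ltW// mulrC; congr (_ * _).
by rewrite -powR_inv1// -powRrM mulN1r opprK.
Qed.

Lemma powRN_le (x y c : R) : 0 <= c -> 0 < x -> x <= y -> y `^ (- c) <= x `^ (- c).
Proof.
move=> c0 x0 xy; have y0 := lt_le_trans x0 xy.
by rewrite !powRN lef_pV2 ?posrE ?powR_gt0// ge0_ler_powR ?nnegrE ?(ltW x0) ?(ltW y0).
Qed.

Lemma measurable_inv : measurable_fun [set: R] (GRing.inv : R -> R).
Proof.
have -> : [set: R] = [set x | x != 0] `|` [set 0].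
  by apply/seteqP; split => x //= _; case: (eqVneq x 0); [right|left].
have o : open [set x : R | x != 0] by exact: open_neq.
apply/measurable_funU => //; first exact: open_measurable.
split; last exact: measurable_fun_set1.
apply: open_continuous_measurable_fun => // x; rewrite inE/= => x0.
exact: inv_continuous.
Qed.

End AffineTransfer.

(** What the principal value and the Biot-Savart law need: Hölder continuity near the singularity,
    decay at infinity, and the sign on the right half-line for Tonelli's theorem. The class is
    stable under rescaling, so checking the profile settles every time. *)
Record hilbert_class {R : realType} (a b C : R) (f : R -> R) : Prop := {
  hc_a_gt0 : 0 < a ;
  hc_b_gt0 : 0 < b ;
  hc_C_gt0 : 0 < C ;
  hc_odd : forall x, f (- x) = - f x ;
  hc_holder : forall x y, `|f x - f y| <= C * `|x - y| `^ a ;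
  hc_decay : forall x, x != 0 -> `|f x| <= C * `|x| `^ (- b) ;
  hc_ge0 : forall x, 0 < x -> 0 <= f x }.

(** * The principal value as an absolutely convergent integral *)

Section HilbertClass.
Context {R : realType}.
Notation mu := (@lebesgue_measure R).
Variables (a b C : R) (f : R -> R).
Hypothesis hf : hilbert_class a b C f.

Let a0 : 0 < a := hc_a_gt0 hf.
Let b0 : 0 < b := hc_b_gt0 hf.
Let C0 : 0 < C := hc_C_gt0 hf.

Lemma hc_continuous : continuous f.
Proof.
move=> x; apply/cvgrPdist_lt => e e0.
pose d := (e / C) `^ a^-1.
have d0 : 0 < d by rewrite powR_gt0// divr_gt0.
near=> y.
apply: le_lt_trans (hc_holder hf x y) _.
rewrite -ltr_pdivlMl//.
have : `|x - y| < d by near: y; exact: (@cvgr_dist_lt _ _ _ _ _ id x).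
have h : d `^ a = C^-1 * e by rewrite /d -powRrM mulVf ?gt_eqF// powRr1 ?divr_ge0// ?ltW// mulrC.
by rewrite -h; apply: gt0_ltr_powR => //; rewrite nnegrE// ltW.
Unshelve. all: by end_near. Qed.

Let cf := hc_continuous.

Let mf : measurable_fun [set: R] f.
Proof. exact: continuous_measurable_fun. Qed.

(* Symmetrising the principal value around [x] makes the integrand integrable. *)
Definition hgap (x r : R) : R := (f (x - r) - f (x + r)) / r.

Definition hdom (L r : R) : R :=
  if r <= L then C * 2 `^ a * r `^ (a - 1) else 2 * C * 2 `^ b * r `^ (- b - 1).

(** Hölder continuity handles [r <= L]; beyond, [|x - r|] and [|x + r|] are at least [r / 2] and the
    decay applies. The majorant does not depend on [x], which allows domination locally uniform in
    [x]. *)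
Lemma hgap_le L x r : 0 < L -> 2 * `|x| <= L -> 0 < r -> `|hgap x r| <= hdom L r.
Proof.
move=> L0 xL r0; rewrite /hgap /hdom normrM normfV (gtr0_norm r0); case: ifPn => rL.
  rewrite powR_sub1// mulrA ler_wpM2r ?invr_ge0 1?(ltW r0)//.
  apply: le_trans (hc_holder hf _ _) _.
  rewrite (_ : x - r - (x + r) = - (2 * r)); last by ring.
  by rewrite normrN gtr0_norm ?mulr_gt0// powRM ?(ltW r0)// mulrA.
rewrite -ltNge in rL.
rewrite powR_sub1// mulrA ler_wpM2r ?invr_ge0 1?(ltW r0)//.
have h y : r / 2 <= `|y| -> `|f y| <= C * 2 `^ b * r `^ (- b).
  move=> ry; have y0 : 0 < `|y| by apply: lt_le_trans ry; rewrite divr_gt0.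
  apply: le_trans (hc_decay hf _) _; first by rewrite -normr_gt0.
  rewrite -mulrA ler_wpM2l ?(ltW C0)//.
  rewrite -powRN_half//.
  by apply: powRN_le => //; [exact: ltW|exact: divr_gt0].
have xr : `|x| <= r / 2 by lra.
apply: le_trans (ler_normB _ _) _.
have h1 := h (x - r); have h2 := h (x + r).
have n1 : r / 2 <= `|x - r|.
  by have := lerB_dist r x; rewrite distrC (gtr0_norm r0); lra.
have n2 : r / 2 <= `|x + r|.
  by have := lerB_dist r (- x); rewrite normrN opprK (addrC r) (gtr0_norm r0); lra.
have := h1 n1; have := h2 n2; lra.
Qed.

Lemma hdom_integrable L : 0 < L -> mu.-integrable `]0, +oo[ (fun r => (hdom L r)%:E).
Proof.
move=> L0.
have -> : `]0%R, +oo[%classic = (`]0, L[ `|` [set L]) `|` `]L, +oo[ :> set R.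
  apply/seteqP; split => x /=; rewrite !in_itv/= ?andbT.
    by move=> x0; case: (ltgtP x L) => h; [left; left; rewrite x0|right|left; right].
  by move=> [[/andP[]|->]|] //; exact: lt_trans.
apply: integrable_setU => //; first exact: measurableU.
  apply: integrable_setU => //; last exact: integrable_set1.
  have := integrableZ (C * 2 `^ a) (measurable_itv `]0, L[) (powR_integrable0 a0 L0).
  apply: eq_integrable => // x; rewrite inE/= in_itv/= => /andP[_ xL].
  by rewrite /hdom (ltW xL).
have := integrableZ (2 * C * 2 `^ b) (measurable_itv `]L, +oo[) (powR_integrabley b0 L0).
apply: eq_integrable => // x; rewrite inE/= in_itv/= andbT => Lx.
by rewrite /hdom leNgt Lx.
Qed.

Lemma measurable_hgap x D : measurable_fun D (hgap x).
Proof.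
apply: measurable_funTS; apply: measurable_funM; last exact: measurable_inv.
apply: measurable_funB; apply: measurableT_comp => //.
  exact: measurable_funB.
exact: measurable_funD.
Qed.

Lemma hgap_integrable x : mu.-integrable `]0, +oo[ (fun r => (hgap x r)%:E).
Proof.
have L0 : 0 < 2 * `|x| + 1 by have := normr_ge0 x; lra.
apply: (@integrable_dominated _ _ (hgap x) (hdom (2 * `|x| + 1))) => //.
- exact: measurable_hgap.
- exact: hdom_integrable.
- by move=> r /=; rewrite in_itv/= andbT => r0; apply: hgap_le => //; lra.
Qed.

(** The values [e = 1] and [e = -1] give the two halves of the truncated line, with
    [y = x + e r]. *)
Let half_integrable x (e d : R) : e ^+ 2 = 1 -> 0 < d ->
  mu.-integrable `]d, +oo[ (fun r => (f (x + e * r) / (- e * r))%:E).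
Proof.
move=> e1 d0; set L := Num.max d (2 * `|x| + 1).
have L0 : 0 < L by rewrite lt_max d0.
have eN : `|e| = 1 by apply/eqP; rewrite -(@eqrXn2 _ 2)// expr1n real_normK ?num_real// e1.
have m D : measurable_fun D (fun r => f (x + e * r) / (- e * r)).
  apply: measurable_funTS; apply: measurable_funM.
    by apply: measurableT_comp => //; apply: measurable_funD => //; exact: measurable_funM.
  by apply: measurableT_comp; [exact: measurable_inv|exact: measurable_funM].
have dL : d <= L by rewrite le_max lexx.
have -> : `]d, +oo[%classic = `]d, L] `|` `]L, +oo[ :> set R.
  by rewrite -itv_bndbnd_setU// bnd_simp.
apply: integrable_setU => //.
  apply: (@integrableS _ _ _ mu (`[d, L]%classic : set R)) => //; first exact: subset_itv_oc_cc.
  apply: continuous_compact_integrable; first exact: segment_compact.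
  apply: continuous_in_subspaceT => r; rewrite inE/= in_itv/= => /andP[dr _].
  have r0 := lt_le_trans d0 dr.
  have cl (c : R) : {for r, continuous (fun r => c * r)}.
    by apply: cvgM; [exact: cvg_cst|exact: cvg_id].
  apply: cvgM.
    apply: (@continuous_comp _ _ _ (fun r => x + e * r) f); last exact: cf.
    by apply: cvgD; [exact: cvg_cst|exact: cl].
  apply: cvgV; last exact: cl.
  by rewrite mulf_neq0 ?(gt_eqF r0)// oppr_eq0 -normr_gt0 eN.
apply: (@integrable_dominated _ _ _ (fun r => C * 2 `^ b * r `^ (- b - 1))) => //.
  by apply: integrableZ => //; exact: powR_integrabley.
move=> r /=; rewrite in_itv/= andbT => Lr; have r0 := lt_trans L0 Lr.
rewrite normrM normfV mulNr normrN normrM eN mul1r (gtr0_norm r0).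
rewrite powR_sub1// mulrA ler_wpM2r ?invr_ge0 1?(ltW r0)//.
have xr : `|x| <= r / 2.
  have : 2 * `|x| + 1 <= L by rewrite le_max lexx orbT.
  by lra.
have ry : r / 2 <= `|x + e * r|.
  have := lerB_dist (e * r) (- x); rewrite normrN opprK (addrC (e * r)) normrM eN mul1r (gtr0_norm r0); lra.
have y0 : 0 < `|x + e * r| by apply: lt_le_trans ry; rewrite divr_gt0.
apply: le_trans (hc_decay hf _) _; first by rewrite -normr_gt0.
rewrite -mulrA ler_wpM2l ?(ltW C0)//.
rewrite -powRN_half//.
by apply: powRN_le => //; [exact: ltW|exact: divr_gt0].
Qed.

Lemma truncation_split (x d : R) : 0 < d ->
  [set y | d < `|x - y|] = (fun r => x - r) @^-1` `]d, +oo[ `|` (fun r => - x + r) @^-1` `]d, +oo[.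
Proof.
move=> d0; apply/seteqP; split => y /=; rewrite !in_itv/= !andbT.
  by case: (ger0P (x - y)) => h dy; [left|right; lra].
move=> [h|h]; first by apply: lt_le_trans h (ler_norm _).
by rewrite distrC; apply: lt_le_trans (ler_norm _); lra.
Qed.

(** The line is folded at [x]: [y = x - r] and [y = x + r] carry the two halves to the same ray,
    where the integrands add up to [hgap]. *)
Lemma hilbert_truncation (x d : R) : 0 < d ->
  mu.-integrable [set y | d < `|x - y|] (fun y => (f y / (x - y))%:E) /\
  hilbert_truncated f x d = pi^-1 * \int[mu]_(r in `]d, +oo[) hgap x r.
Proof.
move=> d0.
pose F y := f y / (x - y).
have mF : measurable_fun setT F.
  by apply: measurable_funM => //; apply: measurableT_comp; [exact: measurable_inv|exact: measurable_funB].
have E1 : (fun r : R => x - r) @^-1` ((fun r => x - r) @^-1` `]d, +oo[) = `]d, +oo[%classic.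
  by apply/seteqP; split => r /=; rewrite opprB addrC subrK.
have E2 : (fun r : R => x + r) @^-1` ((fun r => - x + r) @^-1` `]d, +oo[) = `]d, +oo[%classic.
  by apply/seteqP; split => r /=; rewrite addKr.
have mS1 : measurable ((fun r : R => x - r) @^-1` `]d, +oo[).
  have := @measurable_reflect R x (measurableT) `]d, +oo[%classic (measurable_itv _).
  by rewrite setTI.
have mS2 : measurable ((fun r : R => - x + r) @^-1` `]d, +oo[).
  have := @measurable_shift R (- x) (measurableT) `]d, +oo[%classic (measurable_itv _).
  by rewrite setTI.
have H1 : mu.-integrable `]d, +oo[ (fun r => (F (x - r))%:E).
  have := half_integrable x (_ : (-1) ^+ 2 = 1) d0; rewrite sqrrN expr1n => /(_ erefl).
  apply: eq_integrable => // r _; rewrite /F /= opprK mul1r mulN1r.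
  by rewrite opprB addrCA subrr addr0.
have H2 : mu.-integrable `]d, +oo[ (fun r => (F (x + r))%:E).
  have := half_integrable x (_ : 1 ^+ 2 = 1) d0; rewrite expr1n => /(_ erefl).
  apply: eq_integrable => // r _; rewrite /F /= mul1r mulN1r.
  by rewrite opprD addrA subrr add0r.
have H1' : mu.-integrable ((fun r : R => x - r) @^-1` ((fun r => x - r) @^-1` `]d, +oo[)) (EFin \o (F \o (fun r => x - r))).
  by rewrite E1.
have H2' : mu.-integrable ((fun r : R => x + r) @^-1` ((fun r => - x + r) @^-1` `]d, +oo[)) (EFin \o (F \o (fun r => x + r))).
  by rewrite E2.
have [I1 J1] := integral_transfer (@measurable_reflect R x) (@lebesgue_measure_reflect R x) mS1 mF H1'.
have [I2 J2] := integral_transfer (@measurable_shift R x) (@lebesgue_measure_shift R x) mS2 mF H2'.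
have IU := integrable_setU mS1 mS2 I1 I2.
rewrite -truncation_split// in IU; split => //.
rewrite /hilbert_truncated; congr (_ * _).
rewrite truncation_split// Rintegral_setU//; last 2 first.
- by rewrite -truncation_split.
- by apply/disj_setPS => y /= []; rewrite !in_itv/= !andbT => h1 h2; lra.
rewrite J1 J2 E1 E2 -RintegralD//.
apply: eq_Rintegral => r _; rewrite /F /hgap mulrBl opprB addrCA subrr addr0.
by rewrite opprD addrA subrr add0r invrN mulrN.
Qed.

(** Dominated convergence along positive sequences tending to [0], with majorant [hdom]. *)
Lemma hilbert_truncated_cvg x :
  hilbert_truncated f x eps @[eps --> 0^'+] --> pi^-1 * \int[mu]_(r in `]0, +oo[) hgap x r.
Proof.
apply/cvg_at_rightP => u [u0 ucv].
suff h : \int[mu]_(r in `]u n, +oo[) hgap x r @[n --> \oo] --> \int[mu]_(r in `]0, +oo[) hgap x r.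
  rewrite (_ : (fun n => hilbert_truncated f x (u n)) = (fun n => pi^-1 * \int[mu]_(r in `]u n, +oo[) hgap x r)).
    by apply: cvgM; [exact: cvg_cst|exact: h].
  by apply/funext => n; have [_ ->] := hilbert_truncation x (u0 n).
have L0 : 0 < 2 * `|x| + 1 by have := normr_ge0 x; lra.
pose g n r := ((hgap x \_ `]u n, +oo[) r)%:E.
have mg n : measurable_fun (`]0%R, +oo[%classic : set R) (g n).
  by apply/measurable_EFinP; apply/measurable_restrict => //; exact: measurable_hgap.
have mh : measurable_fun (`]0%R, +oo[%classic : set R) (fun r => (hgap x r)%:E).
  by apply/measurable_EFinP; exact: measurable_hgap.
have gcv : {ae mu, forall r, `]0%R, +oo[%classic r -> g ^~ r @ \oo --> (hgap x r)%:E}.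
  apply: aeW => r; rewrite /= in_itv/= andbT => r0.
  apply: cvg_near_cst; near=> n.
  rewrite /g patchE mem_set//= in_itv/= andbT.
  near: n; move/cvgrPdist_lt : ucv => /(_ r r0); apply: filterS => n.
  by rewrite sub0r normrN gtr0_norm.
have gdom : {ae mu, forall r n, `]0%R, +oo[%classic r -> (`|g n r| <= (hdom (2 * `|x| + 1) r)%:E)%E}.
  apply: aeW => r n; rewrite /= in_itv/= andbT => r0.
  rewrite /g lee_fin patchE; case: ifPn => _; first by apply: hgap_le => //; lra.
  by rewrite normr0 /hdom; case: ifPn => _; rewrite !mulr_ge0 ?powR_ge0 ?(ltW C0).
have [_ _ H] := @dominated_convergence _ (measurableTypeR R) R mu _ (measurable_itv _) g _ _
  mg mh gcv (hdom_integrable L0) gdom.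
have E n : \int[mu]_(r in `]u n, +oo[) hgap x r = fine (\int[mu]_(r in `]0%R, +oo[) g n r)%E.
  have -> : `]u n, +oo[%classic = `]0, +oo[ `&` `]u n, +oo[ :> set R.
    apply/seteqP; split => r /=; rewrite !in_itv/= !andbT; last by case.
    by move=> h; split => //; exact: lt_trans (u0 n) h.
  by rewrite Rintegral_mkcondr.
rewrite (_ : (fun n => _) = (fine \o (fun n => \int[mu]_(r in `]0%R, +oo[) g n r)%E)); last exact/funext.
apply: fine_cvg; rewrite fineK//.
exact: integrable_fin_num (hgap_integrable x).
Unshelve. all: by end_near. Qed.

Lemma hc_hilbertE x : hilbert f x = pi^-1 * \int[mu]_(r in `]0, +oo[) hgap x r.
Proof. by apply/cvg_lim => //; exact: hilbert_truncated_cvg. Qed.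

Lemma hc_hilbert_defined x : hilbert_defined f x.
Proof.
split; first by move=> e e0; have [] := hilbert_truncation x e0.
by apply/cvg_ex; eexists; exact: hilbert_truncated_cvg.
Qed.

Lemma hc_hilbert_continuous : continuous (hilbert f).
Proof.
rewrite (_ : hilbert f = fun x => pi^-1 * \int[mu]_(r in `]0, +oo[) hgap x r); last first.
  by apply/funext => x; exact: hc_hilbertE.
move=> z; apply: cvgM; first exact: cvg_cst.
have zI : z \in `]z - 1, z + 1[%classic by rewrite inE/= in_itv/=; apply/andP; split; lra.
have H := @continuity_under_integral R _ (measurableTypeR R) mu hgap `]0, +oo[ _ (z - 1) (z + 1) _ _
  (hdom (2 * (`|z| + 1))) _ _.
have L0 : 0 < 2 * (`|z| + 1) by have := normr_ge0 z; lra.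
apply: H zI => //.
- by move=> x _; exact: hgap_integrable.
- apply: aeW => r _ x _; apply: cvgM; last exact: cvg_cst.
  apply: cvgB; [apply: (@continuous_comp _ _ _ (fun x => x - r) f)|apply: (@continuous_comp _ _ _ (fun x => x + r) f)];
    try exact: cf; [apply: cvgB|apply: cvgD]; by [exact: cvg_id|exact: cvg_cst].
- exact: hdom_integrable.
- move=> x; rewrite /= in_itv/= => xz; apply: aeW => r; rewrite /= in_itv/= andbT => r0.
  apply: hgap_le => //; rewrite ler_pM2l//.
  have : `|x - z| <= 1 by rewrite ler_norml; lra.
  by have := ler_normD (x - z) z; rewrite subrK; lra.
Qed.

End HilbertClass.

Lemma integral_itv_if {R : realType} (i : interval R) (g : R -> R) :
  (\int[@lebesgue_measure R]_(x in [set` i]) (g x)%:E =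
   \int[@lebesgue_measure R]_x (if x \in i then g x else 0)%:E)%E.
Proof.
rewrite integral_mkcond; apply: eq_integral => x _.
by rewrite patchE; case: ifPn => h; case: ifPn => h' //; move: h h'; rewrite ?inE/= ?notin_setE/= => h h'; exfalso; auto; move/negP: h'.
Qed.

Lemma measurable_fun_itv_mem {R : realType} (i : interval R) :
  measurable_fun [set: R] (fun x : R => x \in i).
Proof.
have m : measurable [set` i] by [].
apply: (measurable_fun_bool true); rewrite setTI.
by rewrite (_ : _ @^-1` _ = [set` i]).
Qed.

(** * From the Hilbert transform to the logarithmic kernel *)

Section BiotSavart.
Context {R : realType}.
Notation mu := (@lebesgue_measure R).
Variables (a b C : R) (f : R -> R).
Hypothesis hf : hilbert_class a b C f.

Let cf : continuous f := hc_continuous hf.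
Let th := signed_integral f.
Let dth : forall x : R, is_derive x 1 th (f x).
Proof. exact: signed_integral_derive. Qed.

Let mf : measurable_fun [set: R] f.
Proof. exact: continuous_measurable_fun. Qed.

Lemma hc_at0 : f 0 = 0.
Proof. by have := hc_odd hf 0; rewrite oppr0; lra. Qed.

Lemma hc_primitive_even x : th (- x) = th x.
Proof.
have dN (y : R) : is_derive y 1 (fun z => th (- z)) (f y).
  have := @is_derive1_comp _ th (fun z : R => - z) y _ _ (dth (- y)) (is_deriveNid y (1 : R)).
  by move=> /is_derive_eq; apply; rewrite (hc_odd hf) mulrN1 opprK.
have d0 (y : R) : is_derive y 1 (fun z => th (- z) - th z) 0.
  by rewrite -(subrr (f y)); exact: is_deriveB.
have := derive_0_const d0 x 0; rewrite oppr0 subrr; lra.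
Qed.

(** The primitive in [x] vanishes at [x = 0] because [th] is even. *)
Lemma hgap_integral (X r : R) : 0 < r -> 0 <= X ->
  (\int[mu]_(x in `[0%R, X]) (hgap f x r)%:E = (- ((th (X + r) - th (X - r)) / r))%:E)%E.
Proof.
move=> r0 X0.
have E : - ((th (X + r) - th (X - r)) / r) = (th (X - r) - th (X + r)) / r - (th (0 - r) - th (0 + r)) / r.
  by rewrite !add0r hc_primitive_even; ring.
rewrite E; apply: (@FTC2_segment R (fun x => (th (x - r) - th (x + r)) / r) (fun x => hgap f x r)) => // x _.
  have d1 : is_derive x 1 (fun y => th (y - r)) (f (x - r)).
    have dd : is_derive x 1 (fun y : R => y - r) 1 by rewrite -[X in is_derive _ _ _ X]subr0; apply: is_deriveB.
    by have := @is_derive1_comp _ th (fun y : R => y - r) x _ _ (dth _) dd; rewrite mulr1.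
  have d2 : is_derive x 1 (fun y => th (y + r)) (f (x + r)).
    have dd : is_derive x 1 (fun y : R => y + r) 1 by rewrite -[X in is_derive _ _ _ X]addr0; apply: is_deriveD.
    by have := @is_derive1_comp _ th (fun y : R => y + r) x _ _ (dth _) dd; rewrite mulr1.
  have -> : (fun y => (th (y - r) - th (y + r)) / r) = r^-1 *: ((fun y => th (y - r)) - (fun y => th (y + r))).
    by apply/funext => y; rewrite /GRing.scale/= mulrC !fctE.
  by apply: is_derive_eq; rewrite /hgap /GRing.scale/= mulrC.
apply: cvgM; last exact: cvg_cst.
apply: cvgB; [apply: (@continuous_comp _ _ _ (fun x => x - r) f)|apply: (@continuous_comp _ _ _ (fun x => x + r) f)];
  try exact: cf; [apply: cvgB|apply: cvgD]; by [exact: cvg_id|exact: cvg_cst].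
Qed.

Lemma measurable_hdom L : measurable_fun [set: R] (hdom a b C L).
Proof.
apply: measurable_fun_ifT; first exact: measurable_fun_ler.
  by apply: measurable_funM => //; exact: measurable_powR.
by apply: measurable_funM => //; exact: measurable_powR.
Qed.

(** Fubini; absolute integrability holds since [hdom] with [L = 2 X] dominates [hgap] for all [x] in
    [[0, X]] at once. *)
Lemma hilbert_integral (X : R) : 0 < X ->
  (\int[mu]_(x in `[0%R, X]) (hilbert f x)%:E =
   (pi^-1)%:E * \int[mu]_(r in `]0%R, +oo[) (- ((th (X + r) - th (X - r)) / r))%:E)%E.
Proof.
move=> X0; have L0 : 0 < 2 * X by lra.
pose G (p : R * R) : R := if [&& 0 <= p.1, p.1 <= X & 0 < p.2] then hgap f p.1 p.2 else 0.
have m1 : measurable_fun [set: R * R] (fun p : R * R => p.1) by exact: measurable_fst.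
have m2 : measurable_fun [set: R * R] (fun p : R * R => p.2) by exact: measurable_snd.
have mG : measurable_fun [set: R * R] (EFin \o G).
  apply/measurable_EFinP; apply: measurable_fun_ifT => //.
    apply: measurable_and; first exact: measurable_fun_ler.
    by apply: measurable_and; [exact: measurable_fun_ler|exact: measurable_fun_ltr].
  apply: measurable_funM; last by apply: measurableT_comp => //; exact: measurable_inv.
  by apply: measurable_funB; apply: measurableT_comp => //; [exact: measurable_funB|exact: measurable_funD].
have E1 x : (\int[mu]_r (G (x, r))%:E = if (0 <= x <= X)%R then \int[mu]_(r in `]0%R, +oo[) (hgap f x r)%:E else 0)%E.
  rewrite integral_itv_if /G/=; case: ifPn => h.
    by apply: eq_integral => r _; rewrite andbA h in_itv/= andbT.
  by rewrite integral0_eq// => r _; rewrite andbA (negbTE h).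
have E2 r : (\int[mu]_x (G (x, r))%:E = if (0 < r)%R then \int[mu]_(x in `[0%R, X]) (hgap f x r)%:E else 0)%E.
  rewrite integral_itv_if /G/=; case: ifPn => h.
    by apply: eq_integral => x _; rewrite andbT in_itv.
  by rewrite integral0_eq// => x _; rewrite !andbF.
have iG : (mu \x mu)%E.-integrable [set: R * R] (EFin \o G).
  have H := @integrable12ltyP _ _ (measurableTypeR R) (measurableTypeR R) R mu mu (EFin \o G) mG.
  apply/H => {H}.
  pose A := fine (\int[mu]_(r in `]0%R, +oo[) (hdom a b C (2 * X) r)%:E)%E.
  have EA : (\int[mu]_(r in `]0%R, +oo[) (hdom a b C (2 * X) r)%:E = A%:E)%E.
    by rewrite /A fineK//; apply: integrable_fin_num => //; exact: (hdom_integrable hf).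
  have h0 r : 0 <= hdom a b C (2 * X) r.
    by rewrite /hdom; case: ifPn => _; rewrite !mulr_ge0 ?powR_ge0 ?(ltW (hc_C_gt0 hf)).
  have A0 : 0 <= A by rewrite /A fine_ge0// integral_ge0// => r _; rewrite lee_fin.
  apply: (@le_lt_trans _ _ (\int[mu]_x (A%:E * (\1_(`[0%R, X]%classic : set R) x)%:E))%E); last first.
    rewrite ge0_integralZl//; last by apply/measurable_EFinP; exact: measurable_indic.
    by rewrite integral_indic//= setIT lebesgue_measure_itv/= lte_fin X0 -EFinB -EFinM ltry.
  apply: ge0_le_integral => //.
  - by move=> x _; apply: integral_ge0 => r _; exact: abse_ge0.
  - have mA : measurable_fun [set: R * R] (fun p => `|(EFin \o G) p|)%E by exact: measurableT_comp.
    exact: (@measurable_fun_fubini_tonelli_F _ _ (measurableTypeR R) (measurableTypeR R) R mu _ mA (fun _ => abse_ge0 _)).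
  - by apply: measurable_funeM; apply/measurable_EFinP; exact: measurable_indic.
  move=> x _.
  case: (boolP (0 <= x <= X)) => h; last first.
    rewrite integral0_eq; first by rewrite mule_ge0// lee_fin.
    by move=> r _; rewrite /G/= andbA (negbTE h)/= normr0.
  rewrite indicE mem_set ?in_itv//= mule1 -EA integral_itv_if.
  apply: ge0_le_integral => //.
  - rewrite /G/=; apply/measurable_EFinP; apply: measurableT_comp => //; apply: measurable_fun_ifT => //.
      by apply: measurable_and => //; apply: measurable_and => //; exact: measurable_fun_ltr.
    exact: (measurable_hgap hf).
  - by apply/measurable_EFinP; apply: measurable_fun_ifT => //; [exact: measurable_fun_itv_mem|exact: measurable_hdom].
  move=> r _; rewrite /G/= andbA h/= in_itv/= andbT; case: ifPn => r0; last by rewrite normr0.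
  rewrite lee_fin; apply: (hgap_le hf) => //.
  by move/andP: h => [x0 xX]; rewrite ger0_norm//; lra.
have -> : (\int[mu]_(x in `[0%R, X]) (hilbert f x)%:E = (pi^-1)%:E * \int[mu]_x \int[mu]_r (G (x, r))%:E)%E.
  rewrite -integralZl//; last exact: (@integrable_fubini_F _ _ (measurableTypeR R) (measurableTypeR R) R mu mu (EFin \o G) iG).
  rewrite integral_itv_if; apply: eq_integral => x _.
  rewrite E1 in_itv/=; case: ifPn => h; last by rewrite mule0.
  rewrite (hc_hilbertE hf) EFinM /Rintegral fineK//; apply: integrable_fin_num => //; exact: (hgap_integrable hf).
rewrite (@Fubini _ _ (measurableTypeR R) (measurableTypeR R) R mu mu (EFin \o G) iG) => {iG}; congr (_ * _)%E.
rewrite [RHS]integral_itv_if; apply: eq_integral => r _.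
by rewrite /= E2 in_itv/= andbT; case: ifPn => r0 //; rewrite hgap_integral// ltW.
Qed.


Lemma is_derive_scale (X : R) (s : R) : is_derive s 1 (fun s => th (X * s)) (X * f (X * s)).
Proof.
have dX : is_derive s 1 (fun s : R => X * s) X.
  by have := is_deriveZ X (is_derive_id s (1 : R)); rewrite /GRing.scale/= mulr1; exact.
by have := @is_derive1_comp _ th (fun s : R => X * s) s _ _ (dth _) dX; rewrite mulrC.
Qed.

(** The slice at fixed [r] of the double integral below; evenness of [th] allows [|X - r|] in place
    of [X - r], which keeps [s] nonnegative. *)
Lemma primitive_gap_scaled (X r : R) : 0 < X -> 0 < r ->
  (\int[mu]_(s in `[(`|X - r| / X)%R, ((X + r) / X)%R]) (X * f (X * s) / r)%:E =
   ((th (X + r) - th (X - r)) / r)%:E)%E.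
Proof.
move=> X0 r0; have Xn0 : X != 0 by rewrite gt_eqF.
have le1 : `|X - r| / X <= (X + r) / X.
  rewrite ler_pM2r ?invr_gt0//.
  by case: (ger0P (X - r)) => _; lra.
have dF (s : R) : is_derive s 1 (fun s => th (X * s) / r) (X * f (X * s) / r).
  have -> : (fun s => th (X * s) / r) = r^-1 *: (fun s => th (X * s)).
    by apply/funext => y; rewrite /GRing.scale/= mulrC.
  have := is_deriveZ r^-1 (is_derive_scale X s).
  by move=> /is_derive_eq; apply; rewrite /GRing.scale/= mulrC.
have cF (s : R) : {for s, continuous (fun s => X * f (X * s) / r)}.
  apply: cvgM; last exact: cvg_cst.
  apply: cvgM; first exact: cvg_cst.
  apply: (@continuous_comp _ _ _ (fun s => X * s) f); last exact: cf.
  by apply: cvgM; [exact: cvg_cst|exact: cvg_id].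
have F := @FTC2_segment R (fun s => th (X * s) / r) _ _ _ le1 (fun s _ => dF s) (fun s _ => cF s).
rewrite F -mulrBl (mulrC X) (mulrC X) !(divfK Xn0) => {F}; congr (EFin ((_ - _) / _)).
by case: (ger0P (X - r)) => // _; rewrite hc_primitive_even.
Qed.

(** The slice at fixed [s]: integrating [1 / r] produces the logarithms. At [s = 1] the lower
    endpoint would be [0]. *)
Lemma inv_integral_scaled (X s c : R) : 0 < X -> 0 < s -> s != 1 ->
  (\int[mu]_(r in `[`|X - X * s|%R, (X + X * s)%R]) (X * c / r)%:E =
   (X * (c * log_kernel s))%:E)%E.
Proof.
move=> X0 s0 s1.
have d1 : 0 < `|1 - s| by rewrite normr_gt0 subr_eq0 eq_sym.
have E1 : `|X - X * s| = X * `|1 - s| by rewrite -[X in X - _]mulr1 -mulrBr normrM (gtr0_norm X0).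
have E2 : X + X * s = X * (1 + s) by ring.
have d0 : 0 < X * `|1 - s| by rewrite mulr_gt0.
have le1 : X * `|1 - s| <= X * (1 + s).
  by rewrite ler_pM2l//; case: (ger0P (1 - s)) => _; lra.
have dF (r : R) : X * `|1 - s| <= r <= X * (1 + s) -> is_derive r 1 (fun r => X * c * ln r) (X * c / r).
  move=> /andP[h _]; have r0 := lt_le_trans d0 h.
  by have := is_deriveZ (X * c) (is_derive1_ln r0).
have cF (r : R) : X * `|1 - s| <= r <= X * (1 + s) -> {for r, continuous (fun r : R => X * c / r)}.
  move=> /andP[h _]; have r0 := lt_le_trans d0 h.
  apply: cvgM; first exact: cvg_cst.
  by apply: inv_continuous; rewrite gt_eqF.
have F := @FTC2_segment R (fun r => X * c * ln r) _ _ _ le1 dF cF.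
rewrite E1 E2 F -mulrBr -mulrA; congr (EFin (_ * (_ * _))).
by rewrite !lnM ?posrE ?addr_gt0// /log_kernel; lra.
Qed.

(* Tonelli: for [r, s > 0], [|X - r| <= X s <= X + r] iff [|X - X s| <= r <= X + X s]. *)
Lemma primitive_gap_integral (X : R) : 0 < X ->
  (\int[mu]_(r in `]0%R, +oo[) ((th (X + r) - th (X - r)) / r)%:E =
   \int[mu]_(s in `]0%R, +oo[) (X * (f (X * s) * log_kernel s))%:E)%E.
Proof.
move=> X0; have Xn0 : X != 0 by rewrite gt_eqF.
pose S (p : R * R) : bool := [&& 0 < p.1, 0 < p.2, `|X - p.1| <= X * p.2 & X * p.2 <= X + p.1].
pose G (p : R * R) : R := if S p then X * f (X * p.2) / p.1 else 0.
have m1 : measurable_fun [set: R * R] (fun p : R * R => p.1) by exact: measurable_fst.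
have m2 : measurable_fun [set: R * R] (fun p : R * R => p.2) by exact: measurable_snd.
have mX : measurable_fun [set: R * R] (fun p : R * R => X * p.2) by exact: measurable_funM.
have mG : measurable_fun [set: R * R] (EFin \o G).
  apply/measurable_EFinP; apply: measurable_fun_ifT => //.
    apply: measurable_and; first exact: measurable_fun_ltr.
    apply: measurable_and; first exact: measurable_fun_ltr.
    apply: measurable_and; apply: measurable_fun_ler => //; last exact: measurable_funD.
    by apply: measurableT_comp => //; exact: measurable_funB.
  apply: measurable_funM; last by apply: measurableT_comp => //; exact: measurable_inv.
  by apply: measurable_funM => //; apply: measurableT_comp.
have G0 p : (0%R <= (EFin \o G) p)%E.
  rewrite lee_fin /G; case: ifPn => // /and4P[r0 s0 _ _].
  by rewrite !mulr_ge0 ?invr_ge0 1?(ltW r0) 1?(ltW X0)// (hc_ge0 hf)// mulr_gt0.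
transitivity (\int[mu]_r \int[mu]_s (G (r, s))%:E)%E.
  rewrite integral_itv_if; apply: eq_integral => r _.
  rewrite in_itv/= andbT; case: ifPn => r0; last first.
    by rewrite integral0_eq// => s _; rewrite /G/S/= (negbTE r0).
  transitivity (\int[mu]_(s in `[(`|X - r| / X)%R, ((X + r) / X)%R]) (X * f (X * s) / r)%:E)%E.
    by rewrite -primitive_gap_scaled.
  rewrite integral_itv_if; apply: eq_integral => s _.
  rewrite /G/S/= r0/= in_itv/= ler_pdivrMr// ler_pdivlMr// (mulrC s).
  case: (ltP 0 s) => s0 //=.
  (* A point [s <= 0] lies in the slice only if [X s = 0], where [f] vanishes. *)
  case: ifPn => // /andP[h1 h2]; have := normr_ge0 (X - r) => h3.
  have -> : X * s = 0 by nra.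
  by rewrite hc_at0 mulr0 mul0r.
rewrite (@fubini_tonelli _ _ (measurableTypeR R) (measurableTypeR R) R mu mu (EFin \o G) mG G0) integral_itv_if.
have m (g : R -> R) : measurable_fun [set: R] g -> measurable_fun [set: R] (fun s => (if s \in `]0, +oo[ then g s else 0)%:E).
  by move=> mg; apply/measurable_EFinP; apply: measurable_fun_ifT => //; exact: measurable_fun_itv_mem.
apply: (@ae_eq_integral _ (measurableTypeR R)) => //.
- exact: (@measurable_fun_fubini_tonelli_G _ _ (measurableTypeR R) (measurableTypeR R) R mu _ mG G0).
- apply: m; apply: measurable_funM => //; apply: measurable_funM; last exact: measurable_log_kernel.
  by apply: measurableT_comp => //; exact: measurable_funM.
(* At [s = 1] the slice reaches [r = 0], where [1 / r] is not integrable, while [log_kernel] takes a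
   default value through [ln 0]; this is a null set. *)
exists [set 1]; split => //; first exact: lebesgue_measure_set1.
move=> s /=; apply: contra_notP => s1 _; move/eqP in s1.
rewrite in_itv/= andbT; case: ifPn => s0; last first.
  by rewrite integral0_eq// => r _; rewrite /G/S/= (negbTE s0) andbF.
have d0 : 0 < `|X - X * s|.
  by rewrite normr_gt0 -[X in X - _]mulr1 -mulrBr mulf_neq0// subr_eq0 eq_sym.
transitivity (\int[mu]_(r in `[`|X - X * s|%R, (X + X * s)%R]) (X * f (X * s) / r)%:E)%E.
  rewrite integral_itv_if; apply: eq_integral => r _.
  rewrite /G/S/= s0/= in_itv/=; congr (EFin (if _ then _ else _)).
  apply/and3P/andP => [[r0 h1 h2]|[h1 h2]].
    by split; [rewrite ler_norml|]; move: h1; rewrite ler_norml => /andP[h1 h3]; [apply/andP; split|]; lra.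
  split; first exact: lt_le_trans h1.
    by move: h1; rewrite ler_norml => /andP[h1 h3]; rewrite ler_norml; apply/andP; split; lra.
  by move: h1; rewrite ler_norml => /andP[h1 h3]; lra.
by rewrite inv_integral_scaled.
Qed.


Lemma hilbert_odd_even x : hilbert f (- x) = hilbert f x.
Proof.
rewrite !(hc_hilbertE hf); congr (_ * _); apply: eq_Rintegral => r _.
have e1 : - x - r = - (x + r) by ring.
have e2 : - x + r = - (x - r) by ring.
by rewrite /hgap e1 e2 !(hc_odd hf) opprK addrC.
Qed.

Lemma Lambda_inv_derive (x : R) : is_derive x 1 (Lambda_inv f) (hilbert f x).
Proof. exact: (signed_integral_derive (hc_hilbert_continuous hf)). Qed.

Lemma Lambda_inv_odd x : Lambda_inv f (- x) = - Lambda_inv f x.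
Proof.
have dN (y : R) : is_derive y 1 (fun z => Lambda_inv f (- z)) (- hilbert f y).
  have := @is_derive1_comp _ (Lambda_inv f) (fun z : R => - z) y _ _ (Lambda_inv_derive (- y)) (is_deriveNid y (1 : R)).
  by move=> /is_derive_eq; apply; rewrite hilbert_odd_even mulrN1.
have d0 (y : R) : is_derive y 1 (fun z => Lambda_inv f (- z) + Lambda_inv f z) 0.
  have := is_deriveD (dN y) (Lambda_inv_derive y).
  by rewrite addNr.
have L0 : Lambda_inv f 0 = 0 by exact: signed_integral0.
have := derive_0_const d0 x 0; rewrite oppr0 L0; lra.
Qed.

Lemma hilbert_locally_integrable : locally_integrable setT (hilbert f).
Proof.
have ch := hc_hilbert_continuous hf.
split; [exact: continuous_measurable_fun|exact: openT|move=> K _ cK].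
have [_] := integrableP _ _ _ (continuous_compact_integrable cK (continuous_subspaceT ch)).
by [].
Qed.

Lemma log_kernel_ge0 (s : R) : 0 < s -> 0 <= log_kernel s.
Proof.
move=> s0; rewrite /log_kernel subr_ge0.
have [->|s1] := eqVneq s 1; first by rewrite subrr normr0 ln0// ln_ge0//; lra.
rewrite ler_ln ?posrE ?normr_gt0 ?subr_eq0 1?eq_sym//; last by lra.
by case: (ger0P (1 - s)) => _; lra.
Qed.

Lemma Lambda_inv_log_kernel (X : R) : 0 < X ->
  Lambda_inv f X = - (X / pi * \int[mu]_(s in `]0, +oo[) (f (X * s) * log_kernel s)).
Proof.
move=> X0; rewrite /Lambda_inv (ltW X0) /Rintegral hilbert_integral//.
have D0 (r : R) : 0 < r -> 0 <= (th (X + r) - th (X - r)) / r.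
  move=> r0; rewrite -lee_fin -primitive_gap_scaled//; apply: integral_ge0 => s /=.
  rewrite in_itv/= => /andP[h _]; have : 0 <= s by apply: le_trans h; rewrite divr_ge0// ltW.
  rewrite le_eqVlt => /predU1P[<-|s0]; first by rewrite mulr0 hc_at0 mulr0 mul0r.
  by rewrite lee_fin !mulr_ge0 ?invr_ge0 1?(ltW r0) 1?(ltW X0)// (hc_ge0 hf)// mulr_gt0.
have -> : (\int[mu]_(r in `]0%R, +oo[) (- ((th (X + r) - th (X - r)) / r))%:E =
    - \int[mu]_(r in `]0%R, +oo[) ((th (X + r) - th (X - r)) / r)%:E)%E.
  by rewrite -integral_ge0N// => r /=; rewrite in_itv/= andbT lee_fin => /D0.
rewrite primitive_gap_integral//.
have -> : (\int[mu]_(s in `]0%R, +oo[) (X * (f (X * s) * log_kernel s))%:E =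
    \int[mu]_(s in `]0%R, +oo[) (X%:E * (f (X * s) * log_kernel s)%:E))%E by [].
rewrite ge0_integralZl_EFin//; last 3 first.
- move=> s /=; rewrite in_itv/= andbT => s0.
  by rewrite lee_fin mulr_ge0 ?log_kernel_ge0// (hc_ge0 hf)// mulr_gt0.
- apply/measurable_EFinP; apply: measurable_funTS; apply: measurable_funM; last exact: measurable_log_kernel.
  by apply: measurableT_comp => //; exact: measurable_funM.
- exact: ltW.
rewrite muleN fineN muleA -EFinM (mulrC pi^-1); congr (- _).
(* [fine] sends infinite values to [0], so the constant comes out even then; finiteness for the
   profile is part of [profile_biot_savart]. *)
case: (\int[_]_(_ in _) _)%E => [c| |] //=.
- by rewrite gt0_muley ?lte_fin ?divr_gt0 ?pi_gt0//= mulr0.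
- by rewrite gt0_muleNy ?lte_fin ?divr_gt0 ?pi_gt0//= mulr0.
Qed.

End BiotSavart.

(** * The self-similar solution *)

Section HolderTools.
Context {R : realType}.
Implicit Types (f : R -> R).

(** Converts a logarithmic increment, of size [d / y <= 1], into a Hölder increment. *)
Lemma powR_ratio_le (a d y : R) : 0 < a <= 1 -> 0 < y -> 0 <= d <= y -> y `^ a * (d / y) <= d `^ a.
Proof.
move=> /andP[a0 a1] y0 /andP[d0 dy].
have dyE : d `^ a = y `^ a * (d / y) `^ a.
  by rewrite -powRM ?divr_ge0 ?(ltW y0)// mulrC divfK// gt_eqF.
rewrite dyE ler_wpM2l ?powR_ge0//.
move: d0; rewrite le_eqVlt => /predU1P[<-|d0]; first by rewrite mul0r powR_ge0.
have h : 0 < d / y <= 1 by rewrite divr_gt0//= ler_pdivrMr ?mul1r.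
by rewrite -[X in X <= _]powRr1 ?(ltW (proj1 (andP h)))// ger_powR.
Qed.

Lemma powR_double_le (a x y : R) : 0 < a <= 1 -> 0 <= x -> 0 <= y -> x <= 2 * y ->
  x `^ a <= 2 * y `^ a.
Proof.
move=> /andP[a0 a1] x0 y0 xy.
apply: (@le_trans _ _ ((2 * y) `^ a)); first by rewrite ge0_ler_powR ?nnegrE ?(ltW a0)// mulr_ge0.
rewrite powRM// ler_wpM2r ?powR_ge0//.
by rewrite -[X in _ <= X]powRr1// ler_powR// ler1n.
Qed.

(** If [x > 2 y > 0], or if the signs are opposite, both points are controlled by [|x - y|] and the
    pointwise bound suffices; only comparable points need the increment bound. The factor [3] comes
    from [x^a <= 2 (x - y)^a] and [y^a <= (x - y)^a]. *)
Lemma holder_odd f (a M : R) : 0 < a <= 1 ->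
  (forall x, f (- x) = - f x) ->
  (forall x, 0 < x -> `|f x| <= M * x `^ a) ->
  (forall x y, 0 < y -> y <= x -> x <= 2 * y -> `|f x - f y| <= M * (x - y) `^ a) ->
  forall x y, `|f x - f y| <= 3 * M * `|x - y| `^ a.
Proof.
move=> a01 fN fM fI; have /andP[a0 a1] := a01.
have M0 : 0 <= M by have := le_trans (normr_ge0 _) (fM 1 ltr01); rewrite powR1 mulr1.
have f0 : f 0 = 0 by have := fN 0; rewrite oppr0; lra.
have fB x : `|f x| <= M * `|x| `^ a.
  case: (ltgtP x 0) => [x0|x0|->].
  - by have := fM (- x); rewrite fN normrN (ltr0_norm x0) oppr_gt0; exact.
  - by rewrite (gtr0_norm x0); exact: fM.
  - by rewrite f0 normr0 mulr_ge0 ?powR_ge0.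
have le1 (s t : R) : 0 <= s -> s <= t -> s `^ a <= t `^ a.
  by move=> s0 st; rewrite ge0_ler_powR ?nnegrE ?(ltW a0)// (le_trans s0).
have pos x y : 0 < y -> y <= x -> `|f x - f y| <= 3 * M * `|x - y| `^ a.
  move=> y0 yx; rewrite (ger0_norm (x := x - y)) ?subr_ge0//.
  have P0 := powR_ge0 (x - y) a.
  case: (leP x (2 * y)) => xy.
    apply: le_trans (fI _ _ y0 yx xy) _; rewrite ler_wpM2r//; lra.
  have x0 := lt_le_trans y0 yx.
  have h1 := fM _ x0; have h2 := fM _ y0.
  have p1 : x `^ a <= 2 * (x - y) `^ a by apply: powR_double_le => //; lra.
  have p2 : y `^ a <= (x - y) `^ a by apply: le1; lra.
  have := ler_normB (f x) (f y).
  have : M * x `^ a <= M * (2 * (x - y) `^ a) by rewrite ler_wpM2l.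
  have : M * y `^ a <= M * (x - y) `^ a by rewrite ler_wpM2l.
  lra.
have opp x y : y <= 0 -> 0 <= x -> `|f x - f y| <= 3 * M * `|x - y| `^ a.
  move=> y0 x0; apply: le_trans (ler_normB _ _) _.
  have h1 : M * `|x| `^ a <= M * `|x - y| `^ a.
    by rewrite ler_wpM2l// le1// !ger0_norm; lra.
  have h2 : M * `|y| `^ a <= M * `|x - y| `^ a.
    by rewrite ler_wpM2l// le1// (ler0_norm y0) ger0_norm; lra.
  have := fB x; have := fB y; have : 0 <= M * `|x - y| `^ a by rewrite mulr_ge0// powR_ge0.
  lra.
have ord x y : y <= x -> `|f x - f y| <= 3 * M * `|x - y| `^ a.
  move=> yx; case: (ltP 0 y) => [y0|y0]; first exact: pos.
  case: (leP 0 x) => [x0|x0]; first exact: opp.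
  have := pos (- y) (- x); rewrite !fN oppr_gt0 lerN2 => /(_ x0 yx).
  rewrite (_ : - y - - x = x - y); last by ring.
  by rewrite (_ : - f y - - f x = f x - f y)//; ring.
move=> x y; case: (leP y x) => [|/ltW] xy; first exact: ord.
by rewrite distrC (distrC x); exact: ord.
Qed.

End HolderTools.

(** The factor [pi eps / 2] cancels the [1 / pi] of the Biot-Savart law and the [2 / eps] produced
    by the tail [2 / s] of the kernel, so that [p] enters the velocity with coefficient [1]. *)
Definition vorticity_profile {R : realType} (eps : R) (phi : R -> R) (x : R) : R :=
  Num.sg x * (pi * eps / 2 * phi (eps * ln `|x|)).

Definition velocity_profile {R : realType} (eps : R) (v : R -> R) (x : R) : R :=
  x * v (eps * ln `|x|).

(** * Size and Hölder estimates in the physical variable *)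

Section Profile.
Context {R : realType}.
Notation mu := (@lebesgue_measure R).
Variables (eps C : R) (phi p v G : R -> R).
Hypothesis eps_gt0 : 0 < eps.
Hypothesis eps_small : eps <= 1 / 3.
Hypothesis H : is_profile eps C phi p v G.

Let phi_gt0 := profile_phi_gt0 H.

Let C_gt0 : 0 < C.
Proof. by have := lt_le_trans (phi_gt0 0) (profile_phi_right H 0); rewrite oppr0 expR0 mulr1. Qed.

Notation Om := (vorticity_profile eps phi).
Notation U := (velocity_profile eps v).

Let expRM (x a : R) : 0 < x -> expR (a * ln x) = x `^ a.
Proof. by move=> x0; rewrite /powR gt_eqF. Qed.

Lemma profile_phi_bounded y : `|phi y| <= 1 + C.
Proof.
rewrite (gtr0_norm (phi_gt0 y)); case: (leP y 0) => y0.
  apply: le_trans (profile_phi_left H y) _.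
  by have : expR (y / 2) <= 1 by [rewrite expR_le1; lra]; move: C_gt0; lra.
apply: le_trans (profile_phi_right H y) _.
have : C * expR (- y) <= C * 1 by rewrite ler_wpM2l ?(ltW C_gt0)// expR_le1; lra.
lra.
Qed.

(** The mean value theorem for [p]; for the nonlocal part, the increment is the convolution of [phi]
    shifted minus [phi], which decays like [e^-y], so [conv_decay] applies. *)
Lemma profile_v_increment z z' : z <= z' ->
  `|v z' - v z| <= (1 + kap_mass) * C * expR (- z) * (z' - z).
Proof.
move=> zz'; rewrite !(profile_v H).
have d0 : 0 <= z' - z by lra.
have pI : `|p z' - p z| <= C * expR (- z) * (z' - z).
  have [c] := MVT_segment zz' (fun x _ => profile_p_derive H x) (continuous_subspaceT (derive1_continuous (profile_p_derive H))).
  rewrite in_itv/= => /andP[zc _] ->.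
  rewrite normrM normrN (gtr0_norm (phi_gt0 c)) (ger0_norm d0) ler_wpM2r//.
  apply: le_trans (profile_phi_right H c) _.
  by rewrite ler_wpM2l ?(ltW C_gt0)// ler_expR lerN2.
have cI : `|conv eps phi z' - conv eps phi z| <= kap_mass * (C * (z' - z)) * expR (- z).
  have cphi := profile_continuous H.
  pose psi x := phi (x + (z' - z)).
  have cpsi : continuous psi.
    move=> x; apply: (@continuous_comp _ _ _ (fun x => x + (z' - z)) phi); last exact: cphi.
    by apply: cvgD; [exact: cvg_id|exact: cvg_cst].
  have bpsi y : `|psi y| <= 1 + C by exact: profile_phi_bounded.
  have E : conv eps phi z' - conv eps phi z = conv eps (psi - phi) z.
    rewrite (_ : conv eps phi z' = conv eps psi z); last by rewrite -conv_shift addrC subrK.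
    rewrite /conv -RintegralB//.
    - by apply: eq_Rintegral => s _; rewrite !fctE mulrBr.
    - exact: conv_integrable bpsi.
    - exact: conv_integrable profile_phi_bounded.
  rewrite E; have := @conv_decay R eps (psi - phi) z 1 (C * (z' - z)); rewrite (mul1r z) (mul1r eps); apply => //.
  - by move=> x; apply: cvgB; [exact: cpsi|exact: cphi].
  - by move: eps_gt0 eps_small => e0 e1; apply/andP; split; lra.
  - move=> y; rewrite mul1r !fctE /psi; apply: le_trans (profile_increment_right H _) _; first lra.
    by rewrite (addrC y) addrK mulrAC.
apply: le_trans.
  rewrite (_ : p z' + eps / 2 * conv eps phi z' - (p z + eps / 2 * conv eps phi z) =
    (p z' - p z) + eps / 2 * (conv eps phi z' - conv eps phi z)); last by ring.
  exact: ler_normD.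
have e2 : 0 <= eps / 2 <= 1 by move: eps_gt0 eps_small => e0 e1; apply/andP; split; lra.
rewrite normrM (ger0_norm (x := eps / 2)) ?(proj1 (andP e2))//.
have : eps / 2 * `|conv eps phi z' - conv eps phi z| <= 1 * (kap_mass * (C * (z' - z)) * expR (- z)).
  by rewrite ler_pM//; case/andP: e2.
lra.
Qed.


Let A : R := pi * (1 + C).

Let A_gt0 : 0 < A.
Proof. by rewrite mulr_gt0 ?pi_gt0//; move: C_gt0; lra. Qed.

Let eps1 : eps < 1.
Proof. by move: eps_small; lra. Qed.

Lemma vorticity_odd x : Om (- x) = - Om x.
Proof. by rewrite /vorticity_profile sgrN normrN mulNr. Qed.

Lemma vorticity_pos x : 0 < x -> Om x = pi * eps / 2 * phi (eps * ln x).
Proof. by move=> x0; rewrite /vorticity_profile gtr0_sg// mul1r (gtr0_norm x0). Qed.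

Lemma vorticity_gt0 x : 0 < x -> 0 < Om x.
Proof. by move=> x0; rewrite vorticity_pos// !mulr_gt0// ?pi_gt0. Qed.

Lemma vorticity0 : Om 0 = 0.
Proof. by rewrite /vorticity_profile sgr0 mul0r. Qed.

Let pe : 0 <= pi * eps / 2 <= pi.
Proof.
have p0 := pi_gt0 R; apply/andP; split; first by rewrite !mulr_ge0// ltW.
by rewrite -mulrA ger_pMr//; move: eps1; lra.
Qed.

Lemma vorticity_le_norm x b : (forall z, phi (eps * ln z) <= b) -> `|Om x| <= pi * b.
Proof.
move=> pb; have b0 : 0 <= b := ltW (lt_le_trans (phi_gt0 _) (pb 1)).
rewrite /vorticity_profile normrM.
have s1 : `|Num.sg x| <= 1 by rewrite normr_sg; case: (x != 0).
have h : `|pi * eps / 2 * phi (eps * ln `|x|)| <= pi * b.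
  have /andP[h0 h1] := pe.
  by rewrite normrM (ger0_norm h0) (gtr0_norm (phi_gt0 _)) ler_pM// ltW.
by rewrite -[X in _ <= X]mul1r; apply: ler_pM.
Qed.

Lemma vorticity_bounded x : `|Om x| <= A.
Proof.
apply: vorticity_le_norm => z; apply: le_trans (ler_norm _) _; exact: profile_phi_bounded.
Qed.

Lemma vorticity_decay x : x != 0 -> `|Om x| <= A * `|x| `^ (- eps).
Proof.
wlog x0 : x / 0 < x => [W xn|_].
  case: (ltgtP x 0) xn => // x0 _; last by apply: W => //; rewrite gt_eqF.
  by have := W (- x); rewrite oppr_gt0 oppr_eq0 normrN vorticity_odd normrN; apply => //; rewrite lt_eqF.
rewrite vorticity_pos// (gtr0_norm x0).
have /andP[h0 h1] := pe.
rewrite normrM (ger0_norm h0) (gtr0_norm (phi_gt0 _)) /A -[X in _ <= X]mulrA; apply: ler_pM => //; first exact: ltW.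
apply: le_trans (profile_phi_right H _) _.
by rewrite -mulNr expRM// ler_wpM2r ?powR_ge0//; lra.
Qed.

Lemma vorticity_near0 x : 0 < x -> `|Om x| <= A * x `^ (eps / 2).
Proof.
move=> x0; rewrite vorticity_pos//.
have /andP[h0 h1] := pe.
rewrite normrM (ger0_norm h0) (gtr0_norm (phi_gt0 _)) /A -[X in _ <= X]mulrA; apply: ler_pM => //; first exact: ltW.
apply: le_trans (profile_phi_left H _) _.
rewrite mulrAC expRM// -[X in X <= _]mul1r ler_wpM2r ?powR_ge0//; move: C_gt0; lra.
Qed.

Lemma ln_increment (x y : R) : 0 < y -> y <= x -> ln x - ln y <= (x - y) / y.
Proof.
move=> y0 yx; have x0 := lt_le_trans y0 yx.
rewrite -ln_div ?posrE//; apply: le_trans (ln_le_subr1 _) _; first exact: divr_gt0.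
by rewrite mulrBl divff// gt_eqF.
Qed.

Lemma eps_ln_increment (x y : R) : 0 < y -> y <= x ->
  0 <= eps * ln x - eps * ln y <= eps * ((x - y) / y).
Proof.
move=> y0 yx; have x0 := lt_le_trans y0 yx.
rewrite -mulrBr; apply/andP; split; last by rewrite ler_wpM2l ?(ltW eps_gt0)// ln_increment.
by rewrite mulr_ge0 ?(ltW eps_gt0)// subr_ge0 ler_ln.
Qed.

(** The exponent is the left rate [e^(z/2)] read in [x]: for comparable points the increment is of
    order [y^(eps/2) (x - y) / y]. *)
Lemma vorticity_holder x y : `|Om x - Om y| <= 3 * (2 * A) * `|x - y| `^ (eps / 2).
Proof.
have e2 : 0 < eps / 2 <= 1 by move: eps1 eps_gt0 => h1 h2; apply/andP; split; lra.
apply: holder_odd => //.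
- exact: vorticity_odd.
- move=> {}x x0; apply: le_trans (vorticity_near0 x0) _.
  by rewrite ler_wpM2r ?powR_ge0//; move: A_gt0; lra.
move=> {}x {}y y0 yx xy; have x0 := lt_le_trans y0 yx.
have /andP[d0 d1] := eps_ln_increment y0 yx.
have /andP[h0 h1] := pe.
rewrite !vorticity_pos// -mulrBr normrM (ger0_norm h0).
have zz : eps * ln y <= eps * ln x by rewrite -subr_ge0.
have i := profile_increment_left H zz; rewrite (mulrAC eps) expRM// in i.
have p1 : x `^ (eps / 2) <= 2 * y `^ (eps / 2) by apply: powR_double_le => //; exact: ltW.
have p2 : y `^ (eps / 2) * ((x - y) / y) <= (x - y) `^ (eps / 2).
  by apply: powR_ratio_le => //; apply/andP; split; lra.
have q0 : 0 <= (x - y) / y by rewrite divr_ge0 ?(ltW y0)//; lra.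
have d2 : eps * ln x - eps * ln y <= (x - y) / y.
  apply: le_trans d1 _; rewrite -[X in _ <= X]mul1r ler_wpM2r//; exact: ltW.
have i2 : `|phi (eps * ln x) - phi (eps * ln y)| <= (1 + C) * (2 * (x - y) `^ (eps / 2)).
  apply: le_trans i _; rewrite -mulrA; apply: ler_pM.
  - exact: ltW.
  - by rewrite mulr_ge0 ?powR_ge0.
  - lra.
  apply: le_trans (_ : 2 * y `^ (eps / 2) * ((x - y) / y) <= _); first by rewrite ler_pM ?powR_ge0.
  by rewrite -mulrA ler_wpM2l.
apply: le_trans (_ : pi * ((1 + C) * (2 * (x - y) `^ (eps / 2))) <= _).
  by rewrite ler_pM.
by rewrite le_eqVlt; apply/orP; left; apply/eqP; rewrite /A; ring.
Qed.

Lemma vorticity_class : hilbert_class (eps / 2) eps (6 * A) Om.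
Proof.
have a0 := A_gt0; have e0 := eps_gt0; split.
- by rewrite divr_gt0.
- exact: e0.
- by rewrite mulr_gt0.
- exact: vorticity_odd.
- by move=> x y; apply: le_trans (vorticity_holder x y) _; rewrite mulrA -natrM.
- move=> x x0; apply: le_trans (vorticity_decay x0) _.
  by rewrite ler_wpM2r ?powR_ge0//; lra.
- by move=> x x0; exact: ltW (vorticity_gt0 x0).
Qed.

Lemma velocity_odd x : U (- x) = - U x.
Proof. by rewrite /velocity_profile normrN mulNr. Qed.

Lemma velocity_decay x : 0 < x -> `|v (eps * ln x)| <= C * x `^ (- eps).
Proof.
by move=> x0; apply: le_trans (profile_v_right H _) _; rewrite -mulNr expRM.
Qed.

Lemma powRD1 (x : R) : 0 < x -> x * x `^ (- eps) = x `^ (1 - eps).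
Proof.
by move=> x0; rewrite powRD ?(gt_eqF x0) ?implybT// powRr1// ltW.
Qed.

(** A homogeneous estimate on the whole line, the form that the self-similar scaling preserves. In
    [x vx - y vy = (x - y) vx + y (vx - vy)] both terms carry the factor [y^(-eps)]. *)
Lemma velocity_holder x y :
  `|U x - U y| <= 3 * ((2 + kap_mass) * C) * `|x - y| `^ (1 - eps).
Proof.
have b01 : 0 < 1 - eps <= 1 by move: eps1 eps_gt0 => h1 h2; apply/andP; split; lra.
have k0 := @kap_mass_ge0 R; have c0 := C_gt0.
have kC : 0 <= kap_mass * C by rewrite mulr_ge0// ltW.
apply: holder_odd => //.
- exact: velocity_odd.
- move=> {}x x0; rewrite /velocity_profile normrM (gtr0_norm x0).
  apply: (@le_trans _ _ (x * (C * x `^ (- eps)))); first by rewrite ler_wpM2l ?(ltW x0)// velocity_decay.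
  by rewrite mulrCA powRD1// ler_wpM2r ?powR_ge0//; lra.
move=> {}x {}y y0 yx xy; have x0 := lt_le_trans y0 yx.
have /andP[d0 d1] := eps_ln_increment y0 yx.
rewrite /velocity_profile (gtr0_norm x0) (gtr0_norm y0).
set vx := v _; set vy := v _.
have -> : x * vx - y * vy = (x - y) * vx + y * (vx - vy) by ring.
have xy0 : 0 <= x - y by lra.
have q0 : 0 <= (x - y) / y by rewrite divr_ge0 ?(ltW y0).
have p2 : y `^ (1 - eps) * ((x - y) / y) <= (x - y) `^ (1 - eps).
  by apply: powR_ratio_le => //; apply/andP; split; lra.
have E : y `^ (1 - eps) * ((x - y) / y) = y `^ (- eps) * (x - y).
  by rewrite -powRD1//; field; rewrite gt_eqF.
rewrite E in p2.
have i1 : `|vx| <= C * y `^ (- eps).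
  apply: le_trans (velocity_decay x0) _; rewrite ler_wpM2l ?(ltW c0)//.
  by apply: powRN_le => //; exact: ltW.
have zz : eps * ln y <= eps * ln x by rewrite -subr_ge0.
have Ey : expR (- (eps * ln y)) = y `^ (- eps) by rewrite -mulNr expRM.
have i2 := profile_v_increment zz; rewrite Ey -/vx -/vy in i2.
have d2 : eps * ln x - eps * ln y <= (x - y) / y.
  apply: le_trans d1 _; rewrite -[X in _ <= X]mul1r ler_wpM2r//; exact: ltW.
apply: le_trans (ler_normD _ _) _; rewrite !normrM (ger0_norm xy0) (gtr0_norm y0).
have j1 : (x - y) * `|vx| <= C * (y `^ (- eps) * (x - y)).
  by rewrite mulrC mulrA ler_wpM2r.
have j2 : y * `|vx - vy| <= (1 + kap_mass) * C * (y `^ (- eps) * (x - y)).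
  apply: le_trans (_ : y * ((1 + kap_mass) * C * y `^ (- eps) * ((x - y) / y)) <= _).
    rewrite ler_wpM2l ?(ltW y0)//; apply: le_trans i2 _.
    have K0 : 0 <= (1 + kap_mass) * C * y `^ (- eps).
      by rewrite mulr_ge0 ?powR_ge0// mulr_ge0 ?(ltW c0)// addr_ge0.
    exact: ler_wpM2l K0 _ _ d2.
  by rewrite le_eqVlt; apply/orP; left; apply/eqP; field; rewrite gt_eqF.
have : (2 + kap_mass) * C * (y `^ (- eps) * (x - y)) <= (2 + kap_mass) * C * (x - y) `^ (1 - eps).
  by rewrite ler_wpM2l//; lra.
lra.
Qed.

End Profile.

(** The factor [m^(-a)] is needed for the Hölder bound and [m^b] for the decay; their sum serves
    both. *)
Lemma hilbert_class_scale {R : realType} (a b C : R) (f : R -> R) (k m : R) :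
  hilbert_class a b C f -> 0 < k -> 0 < m ->
  hilbert_class a b (k * C * (m `^ (- a) + m `^ b)) (fun x => k * f (x / m)).
Proof.
move=> hf k0 m0; have C0 := hc_C_gt0 hf.
have im0 : 0 < m^-1 by rewrite invr_gt0.
have pa : 0 < m `^ (- a) by exact: powR_gt0.
have pb : 0 < m `^ b by exact: powR_gt0.
have iE (c : R) : m^-1 `^ c = m `^ (- c) by rewrite -powR_inv1 ?ltW// -powRrM mulN1r.
split.
- exact: hc_a_gt0 hf.
- exact: hc_b_gt0 hf.
- by rewrite !mulr_gt0// addr_gt0.
- by move=> x; rewrite mulNr (hc_odd hf) mulrN.
- move=> x y; rewrite -mulrBr normrM (gtr0_norm k0) -!mulrA ler_wpM2l ?(ltW k0)//.
  apply: le_trans (hc_holder hf _ _) _; rewrite ler_wpM2l ?(ltW C0)//.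
  rewrite -mulrBl normrM (gtr0_norm im0) powRM ?(ltW im0)// iE mulrC.
  by rewrite ler_wpM2r ?powR_ge0// lerDl ltW.
- move=> x x0; rewrite normrM (gtr0_norm k0) -!mulrA ler_wpM2l ?(ltW k0)//.
  apply: le_trans (hc_decay hf _) _; first by rewrite mulf_neq0// gt_eqF.
  rewrite ler_wpM2l ?(ltW C0)// normrM (gtr0_norm im0) powRM ?(ltW im0)// iE opprK mulrC.
  by rewrite ler_wpM2r ?powR_ge0// lerDr ltW.
- by move=> x x0; rewrite mulr_ge0 ?(ltW k0)// (hc_ge0 hf)// divr_gt0.
Qed.

(** * Biot-Savart law and integrated equation for the profile *)

Section ProfileEquation.
Context {R : realType}.
Notation mu := (@lebesgue_measure R).
Variables (eps C : R) (phi p v G : R -> R).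
Hypothesis eps_gt0 : 0 < eps.
Hypothesis eps_small : eps <= 1 / 3.
Hypothesis H : is_profile eps C phi p v G.
Notation Om := (vorticity_profile eps phi).
Notation U := (velocity_profile eps v).

Let C_gt0 : 0 < C.
Proof. by have := lt_le_trans (profile_phi_gt0 H 0) (profile_phi_right H 0); rewrite oppr0 expR0 mulr1. Qed.

Let hOm := vorticity_class eps_gt0 eps_small H.

Lemma is_derive_log_scale (z s : R) : 0 < s -> is_derive s 1 (fun s => z + eps * ln s) (eps / s).
Proof.
move=> s0; have := is_deriveD (is_derive_cst z s (1 : R)) (is_deriveZ eps (is_derive1_ln s0)).
by rewrite add0r; exact.
Qed.

Lemma is_derive_log_comp (F : R -> R) (z s d : R) : 0 < s -> is_derive (z + eps * ln s) 1 F d ->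
  is_derive s 1 (fun s => F (z + eps * ln s)) (d * (eps / s)).
Proof.
move=> s0 dF.
exact: (@is_derive1_comp _ F (fun s => z + eps * ln s) s _ _ dF (is_derive_log_scale z s0)).
Qed.

Lemma phi_tail_derive z (s : R) : 0 < s ->
  is_derive s 1 (fun s => - p (z + eps * ln s)) (phi (z + eps * ln s) * (eps / s)).
Proof.
move=> s0; have := is_deriveN (is_derive_log_comp s0 (profile_p_derive H (z + eps * ln s))).
by rewrite mulNr opprK.
Qed.

Lemma phi_tail_continuous z (s : R) : 0 < s ->
  {for s, continuous (fun s => phi (z + eps * ln s) * (eps / s))}.
Proof.
move=> s0; apply: cvgM.
  apply: (@continuous_comp _ _ _ (fun s => z + eps * ln s) phi); last exact: (profile_continuous H).
  exact: (is_derive_cont (is_derive_log_scale z s0)).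
by apply: cvgM; [exact: cvg_cst|apply: inv_continuous; rewrite gt_eqF].
Qed.

(** The non-integrable part [2 / s] of the kernel becomes, in the logarithmic variable, the
    primitive [p]. *)
Lemma phi_tail_integral z :
  (\int[mu]_(s in `[1%R, +oo[) (phi (z + eps * ln s) * (eps / s))%:E = (p z)%:E)%E.
Proof.
have dq := @phi_tail_derive z; have cF := @phi_tail_continuous z.
rewrite (@ge0_continuous_FTC2y _ _ (fun s => - p (z + eps * ln s)) _ 0).
- by rewrite ln1 mulr0 addr0 sub0e EFinN oppeK.
- move=> s s1; rewrite mulr_ge0 ?(ltW (profile_phi_gt0 H _))// divr_ge0 ?(ltW eps_gt0)//; lra.
- apply: continuous_in_subspaceT => s; rewrite inE/= in_itv/= andbT => s1; apply: cF; lra.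
- rewrite -oppr0; apply: cvgN.
  apply: (@cvg_comp _ _ _ (fun s => z + eps * ln s) p _ +oo); last exact: (profile_p_cvg0 H).
  apply/cvgryPge => B; near=> s.
  have sB : expR ((B - z) / eps) <= s by near: s; exact: nbhs_pinfty_ge.
  have s0 : 0 < s by apply: lt_le_trans sB; exact: expR_gt0.
  have : (B - z) / eps <= ln s by rewrite -[X in X <= _]expRK ler_ln ?posrE ?expR_gt0.
  by rewrite ler_pdivrMr// (mulrC _ eps); lra.
- by move=> s s1; have [] := dq s (lt_trans ltr01 s1).
- apply: cvg_at_right_filter; exact: (is_derive_cont (dq 1 ltr01)).
- by move=> s; rewrite in_itv/= andbT => s1; rewrite derive1E; have [_ ->] := dq s (lt_trans ltr01 s1).
Unshelve. all: by end_near. Qed.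

Lemma profile_p_bounded z : `|p z| <= 3 + kap_mass * (1 + C).
Proof.
have -> : p z = v z - eps / 2 * conv eps phi z by rewrite (profile_v H); ring.
apply: le_trans (ler_normB _ _) _; apply: lerD; first exact: (profile_v_bounded H).
have e0 : 0 <= eps / 2 by rewrite divr_ge0// ltW.
have e1 : eps / 2 <= 1 by move: eps_small; lra.
rewrite normrM (ger0_norm e0) -[X in _ <= X]mul1r; apply: ler_pM => //.
exact: (conv_le _ _ (profile_continuous H) (profile_phi_bounded H)).
Qed.

Lemma phi_tail_integrable z :
  mu.-integrable `]1, +oo[ (fun s => (phi (z + eps * ln s) * (eps / s))%:E).
Proof.
apply: (@improper_integrable_oy R _ (fun s => - p (z + eps * ln s)) 1 (3 + kap_mass * (1 + C))).
- by move=> s s1; exact: phi_tail_derive (lt_trans ltr01 s1).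
- by move=> s s1; exact: phi_tail_continuous (lt_trans ltr01 s1).
- move=> s s1; rewrite mulr_ge0 ?(ltW (profile_phi_gt0 H _))// divr_ge0 ?(ltW eps_gt0)//; lra.
- by move=> s _; rewrite normrN; exact: profile_p_bounded.
Qed.

(** Splitting [log_kernel] into [kap] and [2 / s] on [s > 1] yields the two terms of [profile_v]. *)
Lemma profile_biot_savart (X : R) : 0 < X ->
  mu.-integrable `]0, +oo[ (fun s => (Om (X * s) * log_kernel s)%:E) /\
  \int[mu]_(s in `]0, +oo[) (Om (X * s) * log_kernel s) = pi * v (eps * ln X).
Proof.
move=> X0; set z := eps * ln X.
pose h (s : R) : R := (if 1 < s then 2 / s else 0) * phi (z + eps * ln s).
have pE s : 0 < s -> Om (X * s) * log_kernel s = pi * eps / 2 * (kap s * phi (z + eps * ln s) + h s).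
  move=> s0; rewrite (vorticity_pos eps phi (mulr_gt0 X0 s0)) lnM ?posrE// (mulrDr eps) -/z.
  by rewrite /h /kap; case: ifPn => _; ring.
have I1 := conv_integrable eps z (profile_continuous H) (profile_phi_bounded H).
have I3 : mu.-integrable `]1, +oo[ (fun s => (2 / eps * (phi (z + eps * ln s) * (eps / s)))%:E).
  by apply: (@integrableZ _ _ (fun s => phi (z + eps * ln s) * (eps / s))) => //; exact: phi_tail_integrable.
have hE s : 1 < s -> h s = 2 / eps * (phi (z + eps * ln s) * (eps / s)).
  by move=> s1; rewrite /h s1; field; rewrite (gt_eqF eps_gt0) gt_eqF// (lt_trans ltr01).
have I2 : mu.-integrable `]0, +oo[ (fun s => (h s)%:E).
  have -> : `]0%R, +oo[%classic = `]0, 1] `|` `]1, +oo[ :> set R.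
    by rewrite -itv_bndbnd_setU// bnd_simp.
  apply: integrable_setU => //.
    apply: eq_integrable (integrable0 _ _) => // s; rewrite inE/= in_itv/= => /andP[_ s1].
    by rewrite /h ltNge s1 mul0r.
  by apply: eq_integrable I3 => // s; rewrite inE/= in_itv/= andbT => /hE ->.
have E2 : \int[mu]_(s in `]0, +oo[) h s = 2 / eps * p z.
  transitivity (\int[mu]_(s in `]1, +oo[) (2 / eps * (phi (z + eps * ln s) * (eps / s)))).
    rewrite /Rintegral !integral_itv_if; congr fine; apply: eq_integral => s _.
    rewrite !in_itv/= !andbT; case: (ltP 1 s) => s1.
      by rewrite (lt_trans ltr01 s1) hE.
    by rewrite /h (ltNge 1) s1/= mul0r if_same.
  rewrite RintegralZl//; last exact: phi_tail_integrable.
  congr (_ * _); rewrite Rintegral_itv_obnd_cbnd; first by rewrite /Rintegral phi_tail_integral.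
  exact: phi_tail_integrable.
have I4 : mu.-integrable `]0, +oo[ (fun s => (kap s * phi (z + eps * ln s) + h s)%:E).
  exact: integrableD I1 I2.
split.
  have := integrableZ (pi * eps / 2) (measurable_itv _) I4.
  by apply: eq_integrable => // s; rewrite inE/= in_itv/= andbT => /pE ->.
transitivity (pi * eps / 2 * \int[mu]_(s in `]0, +oo[) (kap s * phi (z + eps * ln s) + h s)).
  rewrite -RintegralZl//.
  by apply: eq_Rintegral => s; rewrite inE/= in_itv/= andbT => /pE.
rewrite RintegralD// E2 -/(conv eps phi z) (profile_v H).
by field; rewrite gt_eqF.
Qed.

Lemma Lambda_inv_profile (k m x : R) : 0 < k -> 0 < m ->
  Lambda_inv (fun x => k * Om (x / m)) x = - (k * m * U (x / m)).
Proof.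
move=> k0 m0; have hs := hilbert_class_scale hOm k0 m0.
have pos (y : R) : 0 < y -> Lambda_inv (fun x => k * Om (x / m)) y = - (k * m * U (y / m)).
  move=> y0; have ym : 0 < y / m by rewrite divr_gt0.
  rewrite (Lambda_inv_log_kernel hs y0); congr (- _).
  transitivity (y / pi * \int[mu]_(s in `]0, +oo[) (k * (Om (y / m * s) * log_kernel s))).
    by congr (_ * _); apply: eq_Rintegral => s _; rewrite mulrA (mulrAC y).
  have [I E] := profile_biot_savart ym.
  rewrite RintegralZl// E /velocity_profile (gtr0_norm ym).
  have pin0 : pi != 0 :> R by rewrite gt_eqF ?pi_gt0.
  have mn0 : m != 0 by rewrite gt_eqF.
  by move: pin0; move: pi => P pin0; field; rewrite mn0 pin0.
case: (ltgtP x 0) => [x0|x0|->]; last 2 first.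
- exact: pos.
- rewrite /velocity_profile !mul0r mulr0 oppr0; exact: signed_integral0.
have xN : 0 < - x by rewrite oppr_gt0.
have := pos _ xN; rewrite (Lambda_inv_odd hs) mulNr velocity_odd mulrN => /eqP.
by rewrite eqr_opp => /eqP.
Qed.

(** Both sides have derivative [Om], because [G + eps G' = (1 - eps) phi]. Their difference [D] is
    thus constant on the half-line, and [|D d| <= K d], from the boundedness of [Om] and [G], makes
    it [0]. *)
Lemma vorticity_primitive_pos (X : R) : 0 < X ->
  signed_integral Om X = X * (pi * eps / 2 / (1 - eps) * G (eps * ln X)).
Proof.
move=> X0; have e1 : 0 < 1 - eps by move: eps_small; lra.
have C0 := C_gt0.
set c := pi * eps / 2 / (1 - eps).
have c0 : 0 < c by rewrite !divr_gt0// mulr_gt0// pi_gt0.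
pose A := pi * (1 + C).
pose D x := signed_integral Om x - x * (c * G (0 + eps * ln x)).
have dth := signed_integral_derive (hc_continuous hOm).
have dD (x : R) : 0 < x -> is_derive x 1 D 0.
  move=> x0.
  have dG := is_deriveZ c (is_derive_log_comp x0 (profile_G_derive H (0 + eps * ln x))).
  have dQ := is_deriveM (is_derive_id x (1 : R)) dG.
  have := is_deriveB (dth x) dQ; move=> /is_derive_eq; apply.
  rewrite vorticity_pos// /GRing.scale/= -(profile_phiG H) /c !add0r /GRing.scale/=.
  by field; rewrite !gt_eqF.
have GB z : `|G z| <= (1 + C) * 2.
  rewrite -(profile_phiG H) normrM; have /andP[h0 h1] := profile_denom H z.
  rewrite ler_pM ?(profile_phi_bounded H)//.
  by rewrite ger0_norm//; lra.
have DB d : 0 < d -> `|D d| <= (A + c * ((1 + C) * 2)) * d.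
  move=> d0; apply: le_trans (ler_normB _ _) _; rewrite mulrDl; apply: lerD.
    have := @derive_norm_le R _ _ (fun x => A * x) (fun _ => A) 0 d (ltW d0) dth.
    rewrite signed_integral0 !(subr0, mulr0); apply.
      by move=> x; have := is_deriveZ A (is_derive_id x (1:R)); rewrite /GRing.scale/= mulr1; exact.
    exact: (vorticity_bounded eps_gt0 eps_small H).
  by rewrite normrM (gtr0_norm d0) mulrC ler_wpM2r ?(ltW d0)// normrM (gtr0_norm c0) ler_wpM2l// ltW.
have DE d : 0 < d -> d <= X -> D X = D d.
  move=> d0 dX.
  have dD' x : x \in `]d, X[ -> is_derive x (1 : R) D 0.
    by rewrite in_itv/= => /andP[dx _]; exact: dD (lt_trans d0 dx).
  have cD : {within `[d, X], continuous D}.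
    apply: continuous_in_subspaceT => x; rewrite inE/= in_itv/= => /andP[dx _].
    exact: is_derive_cont (dD x (lt_le_trans d0 dx)).
  by have [y _] := MVT_segment dX dD' cD; rewrite mul0r => /eqP; rewrite subr_eq0 => /eqP.
set K := A + c * ((1 + C) * 2) in DB.
have C1 : 0 < 1 + C by rewrite addr_gt0.
have C2 : 0 < (1 + C) * 2 by rewrite mulr_gt0.
have K0 : 0 < K by exact: addr_gt0 (mulr_gt0 (pi_gt0 R) C1) (mulr_gt0 c0 C2).
suff : D X = 0 by rewrite /D add0r => /eqP; rewrite subr_eq0 => /eqP.
apply/eqP; apply: contraT => nD; have n0 : 0 < `|D X| by rewrite normr_gt0.
pose d := Num.min X (`|D X| / (2 * K)).
have d0 : 0 < d by rewrite lt_min X0 divr_gt0// mulr_gt0.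
have := DB d d0; rewrite -DE// ?ge_min ?lexx//.
have : K * d <= K * (`|D X| / (2 * K)) by rewrite ler_wpM2l ?(ltW K0)// ge_min lexx orbT.
have -> : K * (`|D X| / (2 * K)) = `|D X| / 2 by field; rewrite gt_eqF.
lra.
Qed.

(** For [x > 0] this is [phi (1 - 2 eps v) = G] in the variable [x]; the parities of [Om], [U] and
    the primitive give the rest. *)
Lemma profile_identity x :
  eps^-1 * x * Om x - (eps^-1 - 1) * signed_integral Om x = 2 * U x * Om x.
Proof.
have pos y : 0 < y -> eps^-1 * y * Om y - (eps^-1 - 1) * signed_integral Om y = 2 * U y * Om y.
  move=> y0; rewrite vorticity_primitive_pos// vorticity_pos// /velocity_profile (gtr0_norm y0).
  have := profile_phiG H (eps * ln y); set P := phi _; set V := v _ => <-.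
  have e1 : 1 - eps != 0 by rewrite subr_eq0 gt_eqF//; move: eps_small; lra.
  by field; rewrite e1 gt_eqF.
case: (ltgtP x 0) => [x0|x0|->]; last 2 first.
- exact: pos.
- by rewrite signed_integral0 vorticity0 !mulr0 subrr.
have xN : 0 < - x by rewrite oppr_gt0.
have := pos _ xN; rewrite (hc_primitive_even hOm) velocity_odd vorticity_odd.
lra.
Qed.

End ProfileEquation.

Definition self_similar {R : realType} (N : nat) (f : R -> R) (x t : R) : R :=
  (1 - t)^-1 * f (x / (1 - t) ^+ N).

Section SelfSimilar.
Context {R : realType}.
Variables (N : nat) (t : R).
Hypothesis t1 : t < 1.

Let k0 : 0 < (1 - t)^-1.
Proof. by rewrite invr_gt0 subr_gt0. Qed.

Let m0 : 0 < (1 - t) ^+ N.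
Proof. by rewrite exprn_gt0// subr_gt0. Qed.

Let s0 : 1 - t != 0.
Proof. by rewrite subr_eq0 gt_eqF. Qed.

Lemma is_derive_1sub : is_derive t 1 (fun s : R => 1 - s) (-1).
Proof. by have := is_deriveB (is_derive_cst (1 : R) t (1 : R)) (is_derive_id t (1 : R)); rewrite sub0r. Qed.

Lemma is_derive_inv_1sub : is_derive t 1 (fun s : R => (1 - s)^-1) ((1 - t)^-1 ^+ 2).
Proof.
have := @is_deriveV _ (fun s : R => 1 - s) t _ 1 s0 is_derive_1sub.
by move=> /is_derive_eq; apply; rewrite /GRing.scale/= exprVn; field.
Qed.

Lemma is_derive_scale_time :
  is_derive t 1 (fun s : R => (1 - s) ^+ N) (- (N%:R * (1 - t) ^+ N / (1 - t))).
Proof.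
have := is_deriveX N is_derive_1sub; rewrite exprfctE.
move=> /is_derive_eq; apply; rewrite /GRing.scale/=.
case: N => [|n]; first by rewrite !mul0r oppr0.
by rewrite exprS -mulr_natl/=; field.
Qed.

Lemma is_derive_similarity (x : R) :
  is_derive t 1 (fun s : R => x / (1 - s) ^+ N) (N%:R * (x / (1 - t) ^+ N) / (1 - t)).
Proof.
have m1 : (1 - t) ^+ N != 0 by rewrite gt_eqF.
have := is_deriveZ x (@is_deriveV _ (fun s : R => (1 - s) ^+ N) t _ 1 m1 is_derive_scale_time).
move=> /is_derive_eq; apply; rewrite /GRing.scale/=.
by field; rewrite s0 m1.
Qed.

Lemma is_derive_self_similar_time (f : R -> R) (x d : R) : is_derive (x / (1 - t) ^+ N) 1 f d ->
  is_derive t 1 (self_similar N f x)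
    ((1 - t)^-1 ^+ 2 * (f (x / (1 - t) ^+ N) + N%:R * (x / (1 - t) ^+ N) * d)).
Proof.
move=> df.
have dc := @is_derive1_comp _ f (fun s : R => x / (1 - s) ^+ N) t _ _ df (is_derive_similarity x).
have := is_deriveM is_derive_inv_1sub dc.
move=> /is_derive_eq; apply; rewrite /GRing.scale/=.
by field; rewrite s0 (gt_eqF m0).
Qed.

Lemma is_derive_self_similar_space (f : R -> R) (x d : R) : is_derive (x / (1 - t) ^+ N) 1 f d ->
  is_derive x 1 (self_similar N f ^~ t) ((1 - t)^-1 * (d / (1 - t) ^+ N)).
Proof.
move=> df.
have dx : is_derive x 1 (fun x : R => x / (1 - t) ^+ N) ((1 - t) ^+ N)^-1.
  have -> : (fun x : R => x / (1 - t) ^+ N) = ((1 - t) ^+ N)^-1 *: id by apply/funext => y; rewrite /GRing.scale/= mulrC.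
  by apply: is_derive_eq; rewrite /GRing.scale/= mulr1.
have dc := @is_derive1_comp _ f (fun x : R => x / (1 - t) ^+ N) x _ _ df dx.
have := is_deriveZ (1 - t)^-1 dc.
by move=> /is_derive_eq; apply; rewrite /GRing.scale/=.
Qed.

End SelfSimilar.

(** * The equation for the self-similar function *)

Section ProfileSolution.
Context {R : realType}.
Notation mu := (@lebesgue_measure R).
Variables (N : nat) (C : R) (phi p v G : R -> R).
Hypothesis N_ge3 : (3 <= N)%N.
Let eps : R := N%:R^-1.
Hypothesis H : is_profile eps C phi p v G.
Notation Om := (vorticity_profile eps phi).
Notation U := (velocity_profile eps v).
Notation th := (signed_integral Om).
Notation w := (self_similar N Om).

Let eps_gt0 : 0 < eps.
Proof. by rewrite invr_gt0 ltr0n; case: N N_ge3. Qed.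

Let eps_small : eps <= 1 / 3.
Proof. by rewrite mul1r lef_pV2 ?posrE ?ltr0n ?ler_nat//; case: N N_ge3. Qed.

Let k_gt0 (t : R) : t < 1 -> 0 < (1 - t)^-1.
Proof. by move=> t1; rewrite invr_gt0 subr_gt0. Qed.

Let m_gt0 (t : R) : t < 1 -> 0 < (1 - t) ^+ N.
Proof. by move=> t1; rewrite exprn_gt0// subr_gt0. Qed.

Let Om_class := vorticity_class eps_gt0 eps_small H.

Let w_class (t : R) (t1 : t < 1) := hilbert_class_scale Om_class (k_gt0 t1) (m_gt0 t1).

Let dth (x : R) : is_derive x 1 th (Om x).
Proof. exact: (signed_integral_derive (hc_continuous Om_class)). Qed.

Lemma self_similar_velocity (x t : R) : t < 1 ->
  velocity w x t = (1 - t)^-1 * (1 - t) ^+ N * U (x / (1 - t) ^+ N).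
Proof.
move=> t1; rewrite /velocity /self_similar.
by rewrite (Lambda_inv_profile eps_gt0 eps_small H x (k_gt0 t1) (m_gt0 t1)) opprK.
Qed.

Lemma velocity_derive (x t : R) : t < 1 ->
  is_derive x 1 (velocity w ^~ t) (- hilbert (w ^~ t) x).
Proof. move=> t1; exact: (is_deriveN (Lambda_inv_derive (w_class t1) x)). Qed.

(** At [t = 0] the velocity is [U], and the derivative of [Lambda_inv] is the Hilbert transform; no
    differentiability of [v] has to be proved. *)
Lemma velocity_profile_derivable (x : R) : exists d, is_derive x (1 : R) U d.
Proof.
exists (- hilbert (w ^~ 0) x); have := velocity_derive x ltr01.
rewrite (_ : velocity w ^~ 0 = U)//; apply/funext => y.
by rewrite self_similar_velocity// subr0 expr1n invr1 !mul1r mulr1.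
Qed.

(** [phi] is so far only locally Lipschitz, but near [x > 0] the function [Om] is a multiple of
    [G / (1 - 2 eps U y / y)], whose ingredients are differentiable. *)
Lemma vorticity_profile_derivable_pos (x : R) : 0 < x -> derivable Om x 1.
Proof.
move=> x0; have [u' dU] := velocity_profile_derivable x.
have VE y : 0 < y -> U y / y = v (eps * ln y).
  by move=> y0; rewrite /velocity_profile (gtr0_norm y0) mulrC mulKf// gt_eqF.
pose F y := pi * eps / 2 * (G (0 + eps * ln y) / (1 - 2 * eps * (U y / y))).
have nx : x != 0 by rewrite gt_eqF.
have nd : 1 - 2 * eps * (U x / x) != 0.
  by rewrite VE// gt_eqF//; have /andP[h _] := profile_denom H (eps * ln x); apply: lt_le_trans h.
have dF : derivable F x 1.
  apply: derivableM; first exact: derivable_cst.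
  apply: derivableM; first by have [] := is_derive_log_comp x0 (profile_G_derive H (0 + eps * ln x)).
  have d1 := is_deriveM dU (@is_deriveV _ (fun y : R => y) x _ 1 nx (is_derive_id x (1 : R))).
  have d2 := is_deriveB (is_derive_cst (1 : R) x (1 : R)) (is_deriveZ (2 * eps) d1).
  by have [] := @is_deriveV _ (fun y : R => 1 - 2 * eps * (U y / y)) x _ 1 nd d2.
apply: (@near_eq_derivable _ _ _ F Om) => //.
near=> y.
have y0 : 0 < y by near: y; exact: lt_nbhsr.
rewrite /F add0r VE// vorticity_pos// -(profile_phiG H) mulfK//.
by rewrite gt_eqF//; have /andP[h _] := profile_denom H (eps * ln y); apply: lt_le_trans h.
Unshelve. all: by end_near. Qed.

Lemma vorticity_profile_derivable (x : R) : x != 0 -> derivable Om x 1.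
Proof.
case: (ltgtP x 0) => // x0 _; last exact: vorticity_profile_derivable_pos.
have xN : 0 < - x by rewrite oppr_gt0.
have dN := @derivableP _ _ _ _ _ _ (vorticity_profile_derivable_pos xN).
have dc := is_deriveN (@is_derive1_comp _ Om (fun y : R => - y) x _ _ dN (is_deriveNid x (1 : R))).
have [d _] := dc.
rewrite (_ : Om = - (Om \o -%R))//; apply/funext => y.
by rewrite !fctE vorticity_odd opprK.
Qed.

Lemma profile_equation (x o u : R) : is_derive x 1 Om o -> is_derive x 1 U u ->
  Om x + N%:R * x * o = 2 * u * Om x + 2 * U x * o.
Proof.
move=> dO dU.
have E : (fun y => N%:R * (y * Om y) - (N%:R - 1) * th y - 2 * (U y * Om y)) = cst 0.
  apply/funext => y; have := profile_identity eps_gt0 eps_small H y; rewrite invrK => I.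
  by rewrite (mulrA N%:R) I /= mulrA subrr.
have d1 := is_deriveZ N%:R (is_deriveM (is_derive_id x (1 : R)) dO).
have d2 := is_deriveZ (N%:R - 1) (dth x).
have d3 := is_deriveZ 2 (is_deriveM dU dO).
have d := is_deriveB (is_deriveB d1 d2) d3.
have [_ D1] := d; have [_ D2] := is_derive_cst (0 : R) x (1 : R).
have := D2; rewrite -E D1 /GRing.scale/= => ?; lra.
Qed.

Lemma self_similar_CCF_ae (x t : R) : t < 1 -> x != 0 ->
  [/\ derivable (w x) t 1, derivable (w ^~ t) x 1, derivable (velocity w ^~ t) x 1 &
    derive1 (w x) t - 2 * velocity w x t * derive1 (w ^~ t) x
      = 2 * w x t * derive1 (velocity w ^~ t) x].
Proof.
move=> t1 x0; have m0 := m_gt0 t1; have k0 := k_gt0 t1.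
have mn0 : (1 - t) ^+ N != 0 by rewrite gt_eqF.
set z := x / (1 - t) ^+ N.
have z0 : z != 0 by rewrite mulf_neq0// invr_eq0.
have dO := @derivableP _ _ _ _ _ _ (vorticity_profile_derivable z0).
have [u dU] := velocity_profile_derivable z.
have [d1 E1] := is_derive_self_similar_time t1 dO.
have [d2 E2] := is_derive_self_similar_space dO.
have [d3 E3] : is_derive x 1 (velocity w ^~ t) ((1 - t)^-1 * u).
  have -> : velocity w ^~ t = (1 - t) ^+ N *: (self_similar N U ^~ t).
    by apply/funext => y; rewrite self_similar_velocity// /GRing.scale/= /self_similar -mulrA mulrCA.
  have := is_deriveZ ((1 - t) ^+ N) (is_derive_self_similar_space dU).
  by move=> /is_derive_eq; apply; rewrite /GRing.scale/=; field; rewrite mn0 subr_eq0 gt_eqF.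
split; [exact: d1|exact: d2|exact: d3|].
rewrite !derive1E E1 E2 E3 (self_similar_velocity x t1) /self_similar -/z.
have := profile_equation dO dU; move: ('D_1 Om z) => o; set k := (1 - t)^-1 => E.
transitivity (k ^+ 2 * (Om z + N%:R * z * o - 2 * U z * o)); first by field.
by rewrite E; ring.
Qed.


Lemma self_similar_continuous :
  {within [set p : R * R | 0 <= p.2 < 1], continuous (fun p => w p.1 p.2)}.
Proof.
apply: continuous_in_subspaceT => q0; rewrite inE/= => /andP[_ q1].
have c2 : {for q0, continuous (fun q : R * R => 1 - q.2)}.
  by apply: cvgB; [exact: cvg_cst|exact: cvg_snd].
have n0 : 1 - q0.2 != 0 by rewrite subr_eq0 gt_eqF.
apply: cvgM; first exact: cvgV.
apply: (@continuous_comp _ _ _ (fun q : R * R => q.1 / (1 - q.2) ^+ N) Om); last exact: (hc_continuous Om_class).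
apply: cvgM; first exact: cvg_fst.
apply: cvgV; first by rewrite expf_neq0.
apply: (@continuous_comp _ _ _ (fun q : R * R => 1 - q.2) (fun y => y ^+ N)); first exact: c2.
exact: exprn_continuous.
Qed.

(** The product of two powers stands for the exponent [N - 1] and avoids a subtraction in [nat]. *)
Definition stream (x s : R) : R := (1 - s)^-1 * (1 - s) ^+ N * th (x / (1 - s) ^+ N).

Lemma stream_derive_space (x s : R) : s < 1 -> is_derive x 1 (stream ^~ s) (w x s).
Proof.
move=> s1; have mn0 : (1 - s) ^+ N != 0 by rewrite gt_eqF// m_gt0.
have -> : stream ^~ s = (1 - s) ^+ N *: (self_similar N th ^~ s).
  by apply/funext => y; rewrite /stream /GRing.scale/= /self_similar -mulrA mulrCA.
have := is_deriveZ ((1 - s) ^+ N) (is_derive_self_similar_space (dth (x / (1 - s) ^+ N))).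
move=> /is_derive_eq; apply; rewrite /GRing.scale/= /self_similar.
by field; rewrite mn0 subr_eq0 gt_eqF.
Qed.

Lemma stream_derive_time (x s : R) : s < 1 ->
  is_derive s 1 (stream x) (2 * (velocity w x s * w x s)).
Proof.
move=> s1; have mn0 : (1 - s) ^+ N != 0 by rewrite gt_eqF// m_gt0.
have sn0 : 1 - s != 0 by rewrite subr_eq0 gt_eqF.
have -> : stream x = (fun s => (1 - s) ^+ N) * self_similar N th x.
  by apply/funext => y; rewrite /stream /self_similar fctE -mulrA mulrCA.
have := is_deriveM (is_derive_scale_time N s1) (is_derive_self_similar_time s1 (dth (x / (1 - s) ^+ N))).
move=> /is_derive_eq; apply; rewrite (self_similar_velocity x s1) /self_similar /GRing.scale/=.
have := profile_identity eps_gt0 eps_small H (x / (1 - s) ^+ N); rewrite invrK.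
set z := x / _; move: (th z) (Om z) (U z) ((1 - s) ^+ N) mn0 => a b c m mn0 E.
transitivity (m * (1 - s)^-1 ^+ 2 * (N%:R * z * b - (N%:R - 1) * a)); first by field.
by rewrite E; field.
Qed.

Let cw (s : R) : s < 1 -> continuous (w ^~ s).
Proof. by move=> s1; exact: (hc_continuous (w_class s1)). Qed.

Let cvel (s : R) : s < 1 -> continuous (velocity w ^~ s).
Proof. by move=> s1; apply: derive1_continuous => x; exact: velocity_derive. Qed.

Lemma Rintegral_support (L : R) (g : R -> R) : (forall x, L <= `|x| -> g x = 0) ->
  \int[mu]_x g x = \int[mu]_(x in `[- L, L]) g x.
Proof.
move=> g0; rewrite /Rintegral integral_itv_if; congr fine; apply: eq_integral => x _.
rewrite in_itv/=; case: ifPn => //; rewrite negb_and -!ltNge => xL.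
rewrite g0//; case/orP: xL => xL.
  by apply: le_trans (_ : - x <= _); [lra|rewrite -normrN ler_norm].
by apply: le_trans (ler_norm x); exact: ltW.
Qed.

Lemma continuous_funM (f g : R -> R) : continuous f -> continuous g -> continuous (fun x => f x * g x).
Proof. by move=> cf cg x; apply: cvgM; [exact: cf|exact: cg]. Qed.

Lemma velocity_le (x s : R) : s < 1 -> `|velocity w x s| <= 3 * (1 - s)^-1 * `|x|.
Proof.
move=> s1; have m0 := m_gt0 s1; have k0 := k_gt0 s1.
rewrite self_similar_velocity// /velocity_profile.
set V := v _; have VB : `|V| <= 3 by exact: (profile_v_bounded H).
have -> : (1 - s)^-1 * (1 - s) ^+ N * (x / (1 - s) ^+ N * V) = (1 - s)^-1 * x * V.
  have mn0 : (1 - s) ^+ N != 0 by rewrite gt_eqF.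
  have sn0 : 1 - s != 0 by rewrite subr_eq0 gt_eqF.
  by field; rewrite sn0 mn0.
rewrite !normrM (gtr0_norm k0) mulrC mulrA ler_wpM2r// ler_wpM2r// ltW//.
Qed.

(** * The weak formulation *)

Section WeakForm.
Variables (f : R -> R) (t : R).
Hypothesis f_test : test_function f.
Hypothesis t_lt1 : 0 < t < 1.

Let df x : is_derive x (1 : R) f (derive1 f x).
Proof. by case: f_test => d _ _; rewrite derive1E; exact: derivableP. Qed.

Let cf : continuous f := derive1_continuous df.

Let cdf : continuous (derive1 f).
Proof. by case: f_test. Qed.

Lemma test_function_support : exists2 L : R, 0 < L &
  forall x, L <= `|x| -> f x = 0 /\ derive1 f x = 0.
Proof.
case: f_test => _ _ [r fr]; exists (`|r| + 1); first by rewrite ltr_wpDl.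
move=> x xr; have rx : r < `|x| by have := ler_norm r; lra.
split; first exact: fr.
have : is_derive x (1 : R) f 0.
  apply: (@near_eq_is_derive _ _ _ (cst 0)).
  near=> y; rewrite fr//; near: y.
  have := @norm_continuous _ _ x; move/cvgrPdist_lt => /(_ (`|x| - r)); rewrite subr_gt0 => /(_ rx).
  by apply: filterS => y; have := ler_norm (`|x| - `|y|); lra.
by case=> _; rewrite derive1E.
Unshelve. all: by end_near. Qed.

Lemma stream_by_parts (L s : R) : 0 < L -> s < 1 -> (forall x, L <= `|x| -> f x = 0) ->
  \int[mu]_(x in `[- L, L]) (w x s * f x) = - \int[mu]_(x in `[- L, L]) (stream x s * derive1 f x).
Proof.
move=> L0 s1 fL.
have cs : continuous (stream ^~ s) by apply: derive1_continuous => x; exact: stream_derive_space.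
have c1 : continuous (fun x => w x s * f x) by apply: continuous_funM => //; exact: cw.
have c2 : continuous (fun x => stream x s * derive1 f x) by exact: continuous_funM.
have dF (x : R) : is_derive x 1 (fun x => stream x s * f x) (w x s * f x + stream x s * derive1 f x).
  have := is_deriveM (stream_derive_space x s1) (df x).
  by move=> /is_derive_eq; apply; rewrite /GRing.scale/=; ring.
have LL : - L <= L by lra.
have cF : continuous (fun x => w x s * f x + stream x s * derive1 f x).
  by move=> x; apply: cvgD; [exact: c1|exact: c2].
have F := @FTC2_segment R _ _ _ _ LL (fun x _ => dF x) (fun x _ => cF x).
have {F} : \int[mu]_(x in `[- L, L]) (w x s * f x + stream x s * derive1 f x) = 0.
  by rewrite /Rintegral F/= !fL ?normrN ?ger0_norm ?(ltW L0)// !mulr0 subrr.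
rewrite RintegralD//; [|exact: continuous_itv_integrable|exact: continuous_itv_integrable].
by move=> /eqP; rewrite addr_eq0 => /eqP.
Qed.

Lemma stream_under_integral (L : R) : 0 < L ->
  is_derive t 1 (fun s => \int[mu]_(x in `[- L, L]) (stream x s * derive1 f x))
    (2 * \int[mu]_(x in `[- L, L]) (w x t * (velocity w x t * derive1 f x))).
Proof.
move=> L0; have /andP[t0 t1] := t_lt1.
pose F (s x : R) := stream x s * derive1 f x.
(* The midpoint of [t] and [1] keeps [(1 - s)^-1] bounded near [t], hence also the time derivative
   [2 u w] on [[-L, L]]. *)
pose b := (t + 1) / 2.
have tI : `]t - 1, b[%classic t by rewrite /= in_itv/=; apply/andP; split; rewrite /b; lra.
have b1 : b < 1 by rewrite /b; lra.
have sI s : `]t - 1, b[%classic s -> s < 1.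
  by rewrite /= in_itv/= => /andP[_ h]; exact: lt_trans b1.
have dF (s x : R) : s < 1 -> is_derive s 1 (F ^~ x) (2 * (velocity w x s * w x s) * derive1 f x).
  move=> s1; have -> : F ^~ x = derive1 f x *: stream x.
    by apply/funext => y; rewrite /F /GRing.scale/= mulrC.
  by have := is_deriveZ (derive1 f x) (stream_derive_time x s1); move=> /is_derive_eq; apply; rewrite /GRing.scale/= mulrC.
have pE s x : s < 1 -> partial1of2 F s x = 2 * (velocity w x s * w x s) * derive1 f x.
  by move=> s1; rewrite partial1of2E; have [_ ->] := dF s x s1.
pose K := 2 * (3 * (1 - b)^-1 * L * ((1 - b)^-1 * (pi * (1 + C)))).
have C0 : 0 < C by have := lt_le_trans (profile_phi_gt0 H 0) (profile_phi_right H 0); rewrite oppr0 expR0 mulr1.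
have kb : 0 < (1 - b)^-1 by rewrite invr_gt0 subr_gt0.
have K0 : 0 <= K by rewrite !mulr_ge0 ?pi_ge0 ?addr_ge0 ?(ltW L0) ?(ltW kb) ?(ltW C0).
pose Gd x := K * `|derive1 f x|.
have mB : measurable (`[- L, L]%classic : set R) by [].
have iF s : `]t - 1, b[%classic s -> mu.-integrable `[- L, L] (EFin \o F s).
  move=> /sI s1; apply: continuous_itv_integrable; apply: continuous_funM => //.
  by apply: derive1_continuous => x; exact: stream_derive_space.
have dF' s x : `]t - 1, b[%classic s -> `[- L, L]%classic x -> derivable (F ^~ x) s 1.
  by move=> /sI s1 _; have [] := dF s x s1.
have Gd0 x : 0 <= Gd x by rewrite mulr_ge0.
have iG : mu.-integrable `[- L, L] (EFin \o Gd).
  apply: continuous_itv_integrable; apply: continuous_funM; first by move=> x; exact: cvg_cst.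
  by move=> x; apply: cvg_norm; exact: cdf.
have dom s x : `]t - 1, b[%classic s -> `[- L, L]%classic x -> `|partial1of2 F s x| <= Gd x.
  move=> sIs xL; have s1 := sI _ sIs; rewrite pE// normrM ler_wpM2r// normrM ger0_norm// ler_wpM2l// normrM.
  have ks : (1 - s)^-1 <= (1 - b)^-1.
    by rewrite lef_pV2 ?posrE ?subr_gt0//; move: sIs; rewrite /= in_itv/= => /andP[_ h]; lra.
  have xL' : `|x| <= L by move: xL; rewrite /= in_itv/= ler_norml.
  apply: ler_pM => //.
    apply: le_trans (velocity_le x s1) _.
    apply: ler_pM => //; first by rewrite mulr_ge0// ltW// k_gt0.
    by rewrite ler_wpM2l.
  rewrite /self_similar normrM (gtr0_norm (k_gt0 s1)); apply: ler_pM => //; first exact: ltW (k_gt0 s1).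
  exact: (vorticity_bounded eps_gt0 eps_small H).
have D := @derivable_under_integral R _ (measurableTypeR R) mu F _ mB t (t - 1) b tI iF dF' Gd Gd0 iG dom.
have DE := @differentiation_under_integral R _ (measurableTypeR R) mu F _ mB t (t - 1) b tI iF dF' Gd Gd0 iG dom.
apply: DeriveDef; first exact: D.
rewrite -derive1E DE -RintegralZl//; last first.
  apply: continuous_itv_integrable; apply: continuous_funM; first exact: cw.
  by apply: continuous_funM => //; exact: cvel.
by apply: eq_Rintegral => x _; rewrite pE//; ring.
Qed.

(** Expanding the derivative of [u f] cancels the two terms that contain the derivative of [u]. What
    remains, [- 2 \int w u f'], is the time derivative of [- \int stream f']. *)
Lemma self_similar_weak :
  is_derive t 1 (fun s => \int[mu]_x (w x s * f x))
    (2 * - (\int[mu]_x (w x t * derive1 (fun y => velocity w y t * f y) x)) +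
     2 * \int[mu]_x (w x t * derive1 (velocity w ^~ t) x * f x)).
Proof.
have /andP[t0 t1] := t_lt1.
have [L L0 fL] := test_function_support.
have dv x := velocity_derive x t1.
have dvE x : derive1 (velocity w ^~ t) x = - hilbert (w ^~ t) x.
  by rewrite derive1E; have [_ ->] := dv x.
have dvfE x : derive1 (fun y => velocity w y t * f y) x =
    - hilbert (w ^~ t) x * f x + velocity w x t * derive1 f x.
  rewrite derive1E; have [_ ->] := is_deriveM (dv x) (df x).
  by rewrite /GRing.scale/=; ring.
have ch : continuous (fun x => - hilbert (w ^~ t) x).
  by move=> x; apply: cvgN; exact: (hc_hilbert_continuous (w_class t1)).
have c1 : continuous (fun x => w x t * (- hilbert (w ^~ t) x * f x)).
  by apply: continuous_funM; [exact: cw|exact: continuous_funM].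
have c2 : continuous (fun x => w x t * (velocity w x t * derive1 f x)).
  by apply: continuous_funM; [exact: cw|apply: continuous_funM => //; exact: cvel].
have -> : \int[mu]_x (w x t * derive1 (fun y => velocity w y t * f y) x) =
    \int[mu]_(x in `[- L, L]) (w x t * (- hilbert (w ^~ t) x * f x)) +
    \int[mu]_(x in `[- L, L]) (w x t * (velocity w x t * derive1 f x)).
  rewrite (@Rintegral_support L).
    rewrite -RintegralD//; [|exact: continuous_itv_integrable|exact: continuous_itv_integrable].
    by apply: eq_Rintegral => x _; rewrite dvfE mulrDr.
  by move=> x /fL[f0 df0]; rewrite dvfE f0 df0 !mulr0 addr0 mulr0.
have -> : \int[mu]_x (w x t * derive1 (velocity w ^~ t) x * f x) =
    \int[mu]_(x in `[- L, L]) (w x t * (- hilbert (w ^~ t) x * f x)).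
  rewrite (@Rintegral_support L); last by move=> x /fL[f0 _]; rewrite f0 mulr0.
  by apply: eq_Rintegral => x _; rewrite dvE mulrA.
have d := is_deriveN (stream_under_integral L0).
apply: (@near_eq_is_derive _ _ _ (- (fun s => \int[mu]_(x in `[- L, L]) (stream x s * derive1 f x)))).
  near=> s; have s1 : s < 1 by near: s; exact: lt_nbhsl.
  rewrite fctE -stream_by_parts// => [|x /fL[]//].
  by rewrite (@Rintegral_support L)// => x /fL[f0 _]; rewrite f0 mulr0.
by move: d => /is_derive_eq; apply; ring.
Unshelve. all: by end_near. Qed.

End WeakForm.

End ProfileSolution.

(** * Initial data, blow-up and the uniform velocity bound *)

Section BlowUp.
Context {R : realType}.
Notation mu := (@lebesgue_measure R).

Lemma holder_norm_le (D : set R) (b B K : R) (f : R -> R) :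
  (forall x, D x -> `|f x| <= B) ->
  (forall x y, D x -> D y -> x != y -> `|f x - f y| <= K * `|x - y| `^ b) ->
  (holder_norm D b f <= (B + K)%:E)%E.
Proof.
move=> fB fK; rewrite EFinD; apply: leeD; apply/ereal_supP => z [].
  by move=> x Dx <-; rewrite lee_fin fB.
move=> [x y] [/= Dx Dy xy] <-; rewrite lee_fin ler_pdivrMr ?fK//.
by rewrite powR_gt0// normr_gt0 subr_eq0.
Qed.

(** [|f x| > s] forces [|x| <= (A / s)^N], so the quantity under the supremum is at most
    [2^(1/N) A]. *)
Lemma weak_Lp_decay (N : nat) (A : R) (f : R -> R) : (0 < N)%N -> 0 < A ->
  measurable_fun setT f -> f 0 = 0 ->
  (forall x, x != 0 -> `|f x| <= A * `|x| `^ (- N%:R^-1)) -> weak_Lp N%:R f.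
Proof.
move=> N0 A0 mf f0 fA; split => //.
apply: (@le_lt_trans _ _ (2 `^ N%:R^-1 * A)%:E); last exact: ltry.
apply/ereal_supP => _ [s s0 <-]; have {}s0 : 0 < s by [].
have N1 : 0 < N%:R^-1 :> R by rewrite invr_gt0 ltr0n.
pose r := (A / s) `^ N%:R.
have As : 0 < A / s by rewrite divr_gt0.
have r0 : 0 < r by exact: powR_gt0.
have sub : [set x | s < `|f x|] `<=` `[- r, r].
  move=> x /= sfx; rewrite in_itv/= -ler_norml.
  have [x0|x0] := eqVneq x 0; first by rewrite x0 normr0 ltW.
  have xp : 0 < `|x| by rewrite normr_gt0.
  have h : s < A * `|x| `^ (- N%:R^-1) := lt_le_trans sfx (fA _ x0).
  rewrite powRN ltr_pdivlMr ?powR_gt0// in h.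
  have {}h : `|x| `^ N%:R^-1 <= A / s by rewrite ler_pdivlMr// mulrC ltW.
  rewrite /r -[X in X <= _](powRr1 (ltW xp)) -[X in _ `^ X](@mulVf _ (N%:R : R)) ?pnatr_eq0 -?lt0n//.
  by rewrite powRrM ge0_ler_powR ?nnegrE ?powR_ge0// ltW.
have m1 : measurable [set x | s < `|f x|].
  have mn : measurable_fun setT (fun x => `|f x|) by exact: measurableT_comp.
  have := @measurable_fun_ltr _ _ R setT (cst s) (fun x => `|f x|) (measurable_cst _) mn.
  by move=> /(_ measurableT [set true]); rewrite setTI; apply.
have le1 : (mu [set x | (s < `|f x|)%R] <= (2 * r)%:E)%E.
  have : (mu [set x | (s < `|f x|)%R] <= mu `[(- r)%R, r])%E by apply: le_measure; rewrite ?inE.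
  move=> /le_trans; apply.
  by rewrite /= lebesgue_measure_itv/= lte_fin; case: ifPn => _; rewrite -?EFinB lee_fin; lra.
have le2 : (mu [set x | (s < `|f x|)%R] `^ N%:R^-1 <= (2 `^ N%:R^-1 * (A / s))%:E)%E.
  apply: (@le_trans _ _ ((2 * r)%:E `^ N%:R^-1)%E).
    apply: gt0_ler_poweR; rewrite ?(ltW N1)// in_itv/= ?leey ?andbT ?lee_fin//.
    by rewrite mulr_ge0// ltW.
  rewrite poweR_EFin lee_fin powRM ?(ltW r0)// /r -powRrM divff ?pnatr_eq0 -?lt0n//.
  by rewrite powRr1// ltW.
apply: le_trans (lee_pmul _ _ (lexx _) le2) _; rewrite ?lee_fin ?(ltW s0) ?poweR_ge0//.
by rewrite le_eqVlt; apply/orP; left; apply/eqP; field; rewrite gt_eqF.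
Qed.

Variables (N : nat) (C : R) (phi p v G : R -> R).
Hypothesis N_ge3 : (3 <= N)%N.
Let eps : R := N%:R^-1.
Hypothesis H : is_profile eps C phi p v G.
Notation Om := (vorticity_profile eps phi).
Notation U := (velocity_profile eps v).
Notation w := (self_similar N Om).

Let eps_gt0 : 0 < eps.
Proof. by rewrite invr_gt0 ltr0n; case: N N_ge3. Qed.

Let eps_small : eps <= 1 / 3.
Proof. by rewrite mul1r lef_pV2 ?posrE ?ltr0n ?ler_nat//; case: N N_ge3. Qed.

Let Om_class := vorticity_class eps_gt0 eps_small H.

Let w_class (t : R) : t < 1 -> exists C', hilbert_class (eps / 2) eps C' (w ^~ t).
Proof.
move=> t1; eexists; apply: (hilbert_class_scale Om_class); first by rewrite invr_gt0 subr_gt0.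
by rewrite exprn_gt0// subr_gt0.
Qed.

Lemma self_similar_solution : CCF_solution 1 w.
Proof.
split.
- exact: (self_similar_continuous N_ge3 H).
- by move=> x t /andP[_ /w_class[C' h]]; exact: (hc_hilbert_defined h).
- by move=> t /andP[_ /w_class[C' h]]; exact: (hilbert_locally_integrable h).
- by move=> f ft t t1; exact: (self_similar_weak N_ge3 H).
- move=> t /andP[_ t1]; exists [set 0]; split => //; first exact: lebesgue_measure_set1.
  move=> x /= nP; apply: contrapT => /eqP x0; apply: nP.
  exact: (self_similar_CCF_ae N_ge3 H).
Qed.

Lemma self_similar0 : w ^~ 0 = Om.
Proof. by apply/funext => x; rewrite /self_similar subr0 expr1n invr1 mul1r mulr1. Qed.

Lemma self_similar_weak_Lp : weak_Lp N%:R (w ^~ 0).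
Proof.
rewrite self_similar0.
have A0 : 0 < pi * (1 + C) by have := hc_C_gt0 Om_class; lra.
apply: (@weak_Lp_decay _ (pi * (1 + C))) => //.
- by case: N N_ge3.
- exact: continuous_measurable_fun (hc_continuous Om_class).
- exact: vorticity0.
- exact: (vorticity_decay eps_gt0 eps_small H).
Qed.

(** At distance at most [1] the exponent [eps / 2] may be lowered to [a]; for points further apart
    boundedness is enough. *)
Lemma self_similar_initial_holder (a : R) : 0 < a -> a <= eps / 2 ->
  (holder_norm setT a (w ^~ 0%R) < +oo)%E.
Proof.
move=> a0 ae; rewrite self_similar0.
set A := pi * (1 + C).
have OB := vorticity_bounded eps_gt0 eps_small H.
have A0 : 0 <= A by have := OB 0; apply: le_trans.
apply: le_lt_trans (holder_norm_le (fun x _ => OB x) (_ : forall x y, _ -> _ -> _ -> _ <= 6 * A * _)) (ltry _).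
move=> x y _ _ xy; have d0 : 0 < `|x - y| by rewrite normr_gt0 subr_eq0.
case: (leP `|x - y| 1) => d1.
  apply: le_trans (vorticity_holder eps_gt0 eps_small H x y) _.
  rewrite mulrA -natrM; apply: ler_wpM2l; first exact: mulr_ge0.
  by rewrite ger_powR// d0.
apply: le_trans (ler_normB _ _) _.
have : 1 <= `|x - y| `^ a by rewrite -[X in X <= _](powRr0 `|x - y|) ler_powR// ltW.
move=> h; have : A * 1 <= A * `|x - y| `^ a by rewrite ler_wpM2l.
have := OB x; have := OB y; rewrite -/A; lra.
Qed.

(** At the moving point [x = (1 - t)^N], which enters every neighbourhood of [0], the solution
    equals [(1 - t)^-1 Om 1] with [Om 1 > 0]. *)
Lemma self_similar_blows_up : blows_up_near0 1 w.
Proof.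
move=> V V0; apply/cvgeyPge => A.
have O1 : 0 < Om 1 by exact: (vorticity_gt0 eps_gt0 H).
have c1 : (1 - t) ^+ N @[t --> (1:R)^'-] --> (0:R).
  apply: cvg_at_left_filter.
  rewrite -[X in _ --> X](_ : (1 - 1) ^+ N = 0); last by rewrite subrr expr0n; case: N N_ge3.
  apply: (@continuous_comp _ _ _ (fun t : R => 1 - t) (fun y => y ^+ N)); last exact: exprn_continuous.
  by apply: cvgB; [exact: cvg_cst|exact: cvg_id].
have e0 : 0 < Om 1 / (`|A| + 1) by rewrite divr_gt0// ltr_wpDl.
near=> t.
have t1 : t < 1 by near: t; exact: nbhs_left_lt.
have Vt : V ((1 - t) ^+ N) by near: t; exact: c1.
have te : 1 - Om 1 / (`|A| + 1) < t by near: t; apply: nbhs_left_gt; lra.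
apply: le_trans (ereal_sup_ubound (_ : [set `|w x t|%:E | x in V] `|w ((1 - t) ^+ N) t|%:E)); last by exists ((1 - t) ^+ N).
rewrite lee_fin /self_similar divff ?gt_eqF ?exprn_gt0 ?subr_gt0//.
rewrite normrM !gtr0_norm ?invr_gt0 ?subr_gt0//.
rewrite mulrC ler_pdivlMr ?subr_gt0//.
have A1 : 0 < `|A| + 1 by rewrite ltr_wpDl.
have h : (1 - t) * (`|A| + 1) <= Om 1 by rewrite -ler_pdivlMr//; lra.
have := ler_norm A; have s0 : 0 < 1 - t by lra.
nra.
Unshelve. all: by end_near. Qed.

(** For [eps = 1/N] the amplitude [(1 - t)^(N - 1)] is [((1 - t)^N)^(1 - eps)], so it cancels the
    rescaling of [|x - y|] exactly and the constant is independent of [t]. *)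
Lemma self_similar_velocity_holder (t x y : R) : t < 1 ->
  `|velocity w x t - velocity w y t| <= 3 * ((2 + kap_mass) * C) * `|x - y| `^ (1 - eps).
Proof.
move=> t1; have s0 : 0 < 1 - t by rewrite subr_gt0.
have m0 : 0 < (1 - t) ^+ N by rewrite exprn_gt0.
rewrite !(self_similar_velocity N_ge3 H)// -mulrBr normrM.
have k0 : 0 < (1 - t)^-1 * (1 - t) ^+ N by rewrite mulr_gt0// invr_gt0.
rewrite (gtr0_norm k0).
apply: le_trans (ler_wpM2l (ltW k0) (velocity_holder eps_gt0 eps_small H _ _)) _.
rewrite -mulrBl normrM (gtr0_norm (x := (1 - t) ^- N)) ?invr_gt0// powRM ?invr_ge0 ?(ltW m0)//.
have -> : ((1 - t) ^- N) `^ (1 - eps) = ((1 - t)^-1 * (1 - t) ^+ N)^-1.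
  rewrite -powR_mulrn ?(ltW s0)// -powR_inv1 ?powR_ge0// -!powRrM.
  rewrite -[in RHS](powR_inv1 (ltW s0)) -powRD ?(gt_eqF s0) ?implybT//.
  rewrite -powR_inv1 ?powR_ge0// -powRrM; congr (_ `^ _).
  by rewrite /eps; field; rewrite pnatr_eq0; case: N N_ge3.
set k := _ * _ in k0 *.
rewrite le_eqVlt; apply/orP; left; apply/eqP; field.
by rewrite gt_eqF.
Qed.

(** The velocity vanishes at [0], so on [[-1, 1]] the Hölder estimate also bounds the sup norm by
    the same constant. *)
Lemma self_similar_velocity_norm :
  (ereal_sup [set holder_norm `[(-1)%R, 1%R] (1 - eps)%R (velocity w ^~ t)
             | t in [set t : R | (0 <= t < 1)%R]] < +oo)%E.
Proof.
set K := 3 * ((2 + kap_mass) * C).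
apply: (@le_lt_trans _ _ (K + K)%:E); last exact: ltry.
apply/ereal_supP => _ [t /andP[_ t1] <-].
apply: holder_norm_le => x; last by move=> y _ _ _; exact: self_similar_velocity_holder.
rewrite /= in_itv/= -ler_norml => x1.
have := self_similar_velocity_holder x 0 t1.
rewrite subr0 (self_similar_velocity N_ge3 H 0 t1) /velocity_profile !mul0r mulr0 subr0 -/K => h.
have K0 : 0 <= K.
  have := self_similar_velocity_holder 1 0 (t := 0) ltr01.
  by rewrite subr0 normr1 powR1 mulr1; apply: le_trans.
apply: le_trans h _; rewrite -[X in _ <= X]mulr1 ler_wpM2l//.
apply: (@le_trans _ _ (1 `^ (1 - eps))); last by rewrite powR1.
rewrite ge0_ler_powR ?nnegrE//.
by move: eps_small; lra.
Qed.

End BlowUp.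

Theorem corollary1p5 (R : realType) :
  exists alpha0 C0 alpha1 : R, [/\ 0 < alpha0, 0 < C0, 0 < alpha1 &
    forall (n : nat) (alpha : R),
      (1 <= n)%N -> alpha = n%:R^-1 -> alpha < alpha0 ->
    exists (lambda : R) (w : R -> R -> R),
      [/\ -1 < lambda /\ lambda <= C0 * alpha,
          CCF_solution 1 w,
          weak_Lp ((1 + lambda) / alpha) (w ^~ 0) /\
            (holder_norm setT alpha (w ^~ 0%R) < +oo)%E,
          blows_up_near0 1 w &
          (ereal_sup [set holder_norm `[(-1)%R, 1%R] (1 - alpha / (1 + lambda))%R
                                      (velocity w ^~ t)
                     | t in [set t : R | (0 <= t < 1)%R]] < +oo)%E /\
          (alpha < alpha1 -> 2^-1 < 1 - alpha / (1 + lambda))]].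
Proof.
have [e0 e0_gt0 prof] := @profile_exists R.
(* Large enough for [1 / N <= e0], and at least [3] so that [eps <= 1/3]. *)
pose N := maxn 3 (Num.truncn e0^-1).+1.
have N3 : (3 <= N)%N by rewrite leq_maxl.
have N0 : 0 < N%:R :> R by rewrite ltr0n (leq_trans _ N3).
have Ne : N%:R^-1 <= e0.
  rewrite -[X in _ <= X]invrK lef_pV2 ?posrE ?invr_gt0//.
  apply: ltW; apply: lt_le_trans (_ : (Num.truncn e0^-1).+1%:R <= _); first exact: truncnS_gt.
  by rewrite ler_nat leq_maxr.
have [|phi [p [v [G [C H]]]]] := prof N%:R^-1; first by rewrite invr_gt0 N0.
(* [alpha0 = 1 / (2 N)] is the Hölder exponent of the profile, [C0 = N] because
   [lambda = N alpha - 1], and [alpha1 = 1] will do since the velocity exponent [1 - 1/N] is at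
   least [2/3]. *)
exists (N%:R^-1 / 2), N%:R, 1; split; rewrite ?divr_gt0 ?invr_gt0//.
move=> n alpha n1 aE aN; exists (N%:R * alpha - 1), (self_similar N (vorticity_profile N%:R^-1 phi)).
have a0 : 0 < alpha by rewrite aE invr_gt0 ltr0n.
have Na : 0 < N%:R * alpha by rewrite mulr_gt0.
have E1 : (1 + (N%:R * alpha - 1)) / alpha = N%:R by field; rewrite gt_eqF.
have E2 : alpha / (1 + (N%:R * alpha - 1)) = N%:R^-1.
  by rewrite addrCA subrr addr0 invfM mulrCA divff ?mulr1// gt_eqF.
rewrite E1 E2; split.
- by split; lra.
- exact: self_similar_solution N3 H.
- split; first exact: self_similar_weak_Lp N3 H.
  by apply: (self_similar_initial_holder N3 H) => //; exact: ltW.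
- exact: self_similar_blows_up N3 H.
split; first exact: (self_similar_velocity_norm N3 H).
move=> _; have : N%:R^-1 <= 3^-1 :> R by rewrite lef_pV2 ?posrE ?ler_nat.
lra.
Qed.
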